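(* We have $$\mathcal{BMO}^c(\mathbb{R},\mathcal{M})=BMO^c(\mathbb{R},\mathcal{M})$$ with equivalent norms. Similarly $\mathcal{BMO}^r(\mathbb{R},\mathcal{M})=BMO^r(\mathbb{R},\mathcal{M})$ with equivalent norms. Consequently, $\mathcal{BMO}(\mathbb{R},\mathcal{M})=BMO(\mathbb{R},\mathcal{M})$ with equivalent norms.
   Context: Setting. $\mathcal M$ is a von Neumann algebra with a normal semifinite faithful trace $\tau$; $|x|=(x^*x)^{1/2}$. $L_\infty(\mathcal M;L_2^c(\mathbb R,\frac{dx}{1+x^2}))$ is the column Hilbert-space valued noncommutative $L_\infty$ space, with norm $\big\|\big(\int|\varphi(x)|^2\frac{dx}{1+x^2}\big)^{1/2}\big\|_{\mathcal M}$; the row version $L_2^r$ is obtained by taking adjoints. Wavelets. $\mathcal D$ is the collection of dyadic intervals of $\mathbb R$. Fix a Schwartz function $w$ such that $w_I(x)=|I|^{-1/2}w\big((x-c_I)/|I|\big)$, $I\in\mathcal D$ ($c_I$ the center of $I$), form a complete orthonormal system of $L_2(\mathbb R)$. For an operator-valued $f$, $\langle f,w_I\rangle=\int f(x)\overline{w_I(x)}\,dx$. Wavelet BMO. $\mathcal{BMO}^c(\mathbb R,\mathcal M)$ is the space of $\varphi\in L_\infty(\mathcal M;L_2^c(\mathbb R,\frac{dx}{1+x^2}))$, modulo constant functions, with $$\|\varphi\|_{\mathcal{BMO}^c}=\sup_{J\in\mathcal D}\Big\|\Big(\frac1{|J|}\sum_{I\in\mathcal D,\,I\subset J}|\langle\varphi,w_I\rangle|^2\Big)^{1/2}\Big\|_{\mathcal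 M}<\infty ;$$ $\mathcal{BMO}^r(\mathbb R,\mathcal M)$ is defined analogously inside $L_\infty(\mathcal M;L_2^r(\mathbb R,\frac{dx}{1+x^2}))$ with $\|\varphi\|_{\mathcal{BMO}^r}=\|\varphi^*\|_{\mathcal{BMO}^c}$; $\mathcal{BMO}(\mathbb R,\mathcal M)=\mathcal{BMO}^c\cap\mathcal{BMO}^r$ with the maximum of the norms. Mei's BMO. $BMO^c(\mathbb R,\mathcal M)$ is the space of $\varphi\in L_\infty(\mathcal M;L_2^c(\mathbb R,\frac{dx}{1+x^2}))$, modulo constant functions, with $$\|\varphi\|_{BMO^c}=\sup_{I}\Big\|\Big(\frac1{|I|}\int_I|\varphi(x)-\varphi_I|^2dx\Big)^{1/2}\Big\|_{\mathcal M}<\infty,\qquad\varphi_I=\frac1{|I|}\int_I\varphi(x)\,dx,$$ the supremum being over all bounded intervals $I\subset\mathbb R$; $BMO^r(\mathbb R,\mathcal M)$ is defined analogously in the row space with $\|\varphi\|_{BMO^r}=\|\varphi^*\|_{BMO^c}$; $BMO(\mathbb R,\mathcal M)=BMO^c\cap BMO^r$ with the maximum of the norms. *)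

(* Defs.v *)
From HB Require Import structures.
From mathcomp Require Import all_boot all_order all_algebra.
From mathcomp Require Import all_classical all_reals all_analysis.
From mathcomp Require Import complex.

Set Implicit Arguments.
Unset Strict Implicit.
Unset Printing Implicit Defensive.

Import Order.TTheory GRing.Theory Num.Theory.
Import numFieldNormedType.Exports.
Local Open Scope classical_set_scope.
Local Open Scope ring_scope.
Local Open Scope complex_scope.

(* Norms of spaces over R[i] are R[i]-valued in MathComp; nrm is the real one. *)
Definition nrm (R : realType) (V : normedZmodType R[i]) (v : V) : R :=
  complex.Re `|v|.

Section ScalarFunctions.
Variable R : realType.
Local Notation leb := (@lebesgue_measure R).

Definition cmeasurable (f : R -> R[i]) : Prop :=
  measurable_fun [set: R] (fun x => complex.Re (f x)) /\
  measurable_fun [set: R] (fun x => complex.Im (f x)).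

Definition cint (D : set R) (f : R -> R[i]) : R[i] :=
  (\int[leb]_(x in D) complex.Re (f x)) +i*
  (\int[leb]_(x in D) complex.Im (f x)).

Definition in_L2 (f : R -> R[i]) : Prop :=
  cmeasurable f /\ (\int[leb]_x ((nrm (f x)) ^+ 2)%:E < +oo)%E.

(* L_2(R, dx/(1+x^2)) *)
Definition in_wL2 (f : R -> R[i]) : Prop :=
  cmeasurable f /\
  (\int[leb]_x ((nrm (f x)) ^+ 2 / (1 + x ^+ 2))%:E < +oo)%E.

Definition rschwartz (f : R -> R) : Prop :=
  forall n : nat,
    (forall x, derivable (derive1n n f) x 1) /\
    (forall m : nat, exists C : R,
       forall x, `|x ^+ m * derive1n n f x| <= C).

Definition schwartz (f : R -> R[i]) : Prop :=
  rschwartz (fun x => complex.Re (f x)) /\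
  rschwartz (fun x => complex.Im (f x)).

(* The pair (j, k) encodes the dyadic interval [k 2^j, (k+1) 2^j[. *)
Definition dlen (I : int * int) : R := 2 ^ I.1.
Definition dyadic (I : int * int) : set R :=
  `[I.2%:~R * dlen I, (I.2%:~R + 1) * dlen I[%classic.
Definition dcenter (I : int * int) : R := (I.2%:~R + 2^-1) * dlen I.

Definition wavelet (w : R -> R[i]) (I : int * int) (x : R) : R[i] :=
  ((Num.sqrt (dlen I))^-1)%:C * w ((x - dcenter I) / dlen I).

Definition complete_orthonormal_wavelets (w : R -> R[i]) : Prop :=
  (forall I J : int * int,
     cint setT (fun x => wavelet w I x * (wavelet w J x)^*) = (I == J)%:R) /\
  (forall f : R -> R[i], in_L2 f ->
     (forall I, cint setT (fun x => f x * (wavelet w I x)^*) = 0) ->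
     {ae leb, forall x, f x = 0}).

End ScalarFunctions.

Section Operators.
Variables (R : realType) (H : completeNormedModType R[i]).
Variable dot : {dot H for Num.conj}.

Definition hilbert_norm : Prop := forall x : H, `|x| ^+ 2 = dot x x.

Definition bounded_op (a : H -> H) : Prop := linear a /\ continuous a.

Definition adjoint_ops (a b : H -> H) : Prop :=
  forall x y, dot (a x) y = dot x (b y).

Definition commutant (S : set (H -> H)) : set (H -> H) :=
  [set b | bounded_op b /\ forall a, S a -> a \o b = b \o a].

Definition von_neumann_algebra (M : set (H -> H)) : Prop :=
  [/\ M `<=` bounded_op,
      forall a, M a -> exists2 b, M b & adjoint_ops a b &
      commutant (commutant M) = M].

Definition positive_op (a : H -> H) : Prop := forall x, 0 <= dot (a x) x.

Definition loewner (a b : H -> H) : Prop :=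
  positive_op (fun x => b x - a x).

Definition pos_part (M : set (H -> H)) : set (H -> H) :=
  [set a | M a /\ positive_op a].

Definition is_lub (P D : set (H -> H)) (s : H -> H) : Prop :=
  [/\ P s, forall a, D a -> loewner a s &
      forall t, P t -> (forall a, D a -> loewner a t) -> loewner s t].

Record nsf_trace (M : set (H -> H)) (tau : (H -> H) -> \bar R) : Prop := {
  trace_ge0 : forall a, pos_part M a -> (0 <= tau a)%E ;
  traceD : forall a b, pos_part M a -> pos_part M b ->
    tau (fun x => a x + b x) = (tau a + tau b)%E ;
  traceZ : forall (c : R) a, 0 <= c -> pos_part M a ->
    tau (fun x => c%:C *: a x) = (c%:E * tau a)%E ;
  trace_tracial : forall a b, M a -> M b -> adjoint_ops a b ->
    tau (b \o a) = tau (a \o b) ;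
  trace_normal : forall (D : set (H -> H)) s,
    D `<=` pos_part M -> D !=set0 ->
    (forall a b, D a -> D b -> exists c, [/\ D c, loewner a c & loewner b c]) ->
    is_lub (pos_part M) D s -> tau s = ereal_sup (tau @` D) ;
  trace_faithful : forall a, pos_part M a -> tau a = 0%E -> a = (fun=> 0) ;
  trace_semifinite : forall a, pos_part M a -> a <> (fun=> 0) ->
    exists b, [/\ pos_part M b, loewner b a, b <> (fun=> 0) &
                  (tau b < +oo)%E]
}.

Definition op_norm (a : H -> H) : \bar R :=
  ereal_sup [set (nrm (a h))%:E | h in [set h : H | nrm h <= 1]].

(* An operator-valued sum or integral A = \sum_i |a_i|^2, A = \int |f(x)|^2 is
   given through its quadratic form q h = \sum_i ||a_i h||^2, etc.
   sqrt_norm q is ||A^(1/2)||, where b = A^(1/2) is the positive bounded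
   operator such that <b^2 h, h> = q h for all h (it is unique); it is +oo when
   q is not the form of a bounded operator. *)
Definition sqrt_norm (q : H -> \bar R) : \bar R :=
  ereal_inf [set op_norm b | b in
    [set b | [/\ bounded_op b, positive_op b &
                 forall h, q h = (complex.Re (dot (b (b h)) h))%:E]]].

End Operators.

(* Elements of the column and row spaces need not be functions R -> M.  They are
   given by their matrix entries: phi h k is the function x |-> <phi(x) h, k>,
   which only matters almost everywhere. *)
Definition opfun (R : realType) (H : completeNormedModType R[i]) : Type :=
  H -> H -> R -> R[i].

Section OperatorValued.
Variables (R : realType) (H : completeNormedModType R[i]).
Variable dot : {dot H for Num.conj}.
Variable M : set (H -> H).
Local Notation leb := (@lebesgue_measure R).
Local Notation opfun := (opfun H).

Definition adjf (phi : opfun) : opfun := fun h k x => (phi k h x)^*.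

Definition cstf (a : H -> H) : opfun := fun h k _ => dot (a h) k.

Definition simple_fun (s : R -> H) : Prop :=
  finite_set (range s) /\ forall v : H, measurable (s @^-1` [set v]).

Definition strongly_measurable (f : R -> H) : Prop :=
  exists2 s : nat -> R -> H, forall n, simple_fun (s n) &
    forall x, s n x @[n --> \oo] --> f x.

(* f(x) = phi(x) h for almost every x, tested against each vector k *)
Definition represents (phi : opfun) (h : H) (f : R -> H) : Prop :=
  strongly_measurable f /\
  forall k, {ae leb, forall x, phi h k x = dot (f x) k}.

(* x |-> phi(x) h as an H-valued function, unique almost everywhere *)
Definition vec (phi : opfun) (h : H) : R -> H :=
  xget (fun=> 0) [set f | represents phi h f].

(* (\int_D phi(x) g(x) dx) h *)
Definition wint (D : set R) (phi : opfun) (g : R -> R[i]) (h : H) : H :=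
  xget 0 [set v | forall k, dot v k = cint D (fun x => phi h k x * g x)].

(* L_oo(M; L_2^c(R, dx/(1+x^2))), the column space M (x) L_2^c : the bounded
   operators h |-> phi(.) h from H to L_2(R, dx/(1+x^2); H) all of whose slices
   by elements of L_2(R, dx/(1+x^2)) lie in M. *)
Definition L2c_norm (phi : opfun) : \bar R :=
  sqrt_norm dot (fun h =>
    \int[leb]_x ((nrm (vec phi h x)) ^+ 2 / (1 + x ^+ 2))%:E)%E.

Definition L2c : set opfun :=
  [set phi |
    [/\ forall h k, cmeasurable (phi h k),
        forall h, exists f, represents phi h f,
        forall (c : R[i]) h h' k, {ae leb, forall x,
          phi (c *: h + h') k x = c * phi h k x + phi h' k x},
        (L2c_norm phi < +oo)%E &
        forall g : R -> R[i], in_wL2 g -> exists2 a, M a & forall h k,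
          dot (a h) k =
          cint setT (fun x => phi h k x * g x * ((1 + x ^+ 2)^-1)%:C)]].

Definition L2r : set opfun := [set phi | L2c (adjf phi)].

Variable w : R -> R[i].

(* <phi, w_I> *)
Definition wcoef (phi : opfun) (I : int * int) : H -> H :=
  wint setT phi (fun x => (wavelet w I x)^*).

Definition wBMOc_norm (phi : opfun) : \bar R :=
  ereal_sup (range (fun J : int * int =>
    sqrt_norm dot (fun h => ((dlen R J)^-1)%:E *
      \esum_(I in [set I | dyadic I `<=` (dyadic J : set R)])
        ((nrm (wcoef phi I h)) ^+ 2)%:E)%E)).

Definition wBMOr_norm (phi : opfun) : \bar R := wBMOc_norm (adjf phi).

Definition wBMO_norm (phi : opfun) : \bar R :=
  maxe (wBMOc_norm phi) (wBMOr_norm phi).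

Definition wBMOc : set opfun :=
  [set phi | L2c phi /\ (wBMOc_norm phi < +oo)%E].
Definition wBMOr : set opfun :=
  [set phi | L2r phi /\ (wBMOr_norm phi < +oo)%E].
Definition wBMO : set opfun := wBMOc `&` wBMOr.

(* The bounded intervals of positive length are represented by [a, b], a < b:
   whether the endpoints belong to the interval does not affect the integrals. *)
Definition mean (phi : opfun) (a b : R) : H -> H :=
  wint `[a, b]%classic phi (fun=> ((b - a)^-1)%:C).

Definition BMOc_norm (phi : opfun) : \bar R :=
  ereal_sup [set
    sqrt_norm dot (fun h => ((I.2 - I.1)^-1)%:E *
      \int[leb]_(x in `[I.1, I.2]%classic)
        ((nrm (vec phi h x - mean phi I.1 I.2 h)) ^+ 2)%:E)%E
    | I in [set I : R * R | I.1 < I.2]].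

Definition BMOr_norm (phi : opfun) : \bar R := BMOc_norm (adjf phi).

Definition BMO_norm (phi : opfun) : \bar R :=
  maxe (BMOc_norm phi) (BMOr_norm phi).

Definition BMOc : set opfun :=
  [set phi | L2c phi /\ (BMOc_norm phi < +oo)%E].
Definition BMOr : set opfun :=
  [set phi | L2r phi /\ (BMOr_norm phi < +oo)%E].
Definition BMO : set opfun := BMOc `&` BMOr.

Definition eq_mod_const (phi psi : opfun) : Prop :=
  exists2 a, M a &
    forall h k, {ae leb, forall x, psi h k x = phi h k x + cstf a h k x}.

Definition mod_const (X : set opfun) : set (set opfun) :=
  [set [set psi | X psi /\ eq_mod_const phi psi] | phi in X].

(* Both seminorms are compared on every representative of every class. *)
Definition eq_equiv_norms (X Y : set opfun) (nX nY : opfun -> \bar R) : Prop :=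
  mod_const X = mod_const Y /\
  exists c C : R, [/\ 0 < c, 0 < C & forall phi, X phi ->
    (c%:E * nX phi <= nY phi)%E /\ (nY phi <= C%:E * nX phi)%E].

End OperatorValued.

(* Main.v *)
Require Import Defs.
From HB Require Import structures.
From mathcomp Require Import all_boot all_order all_algebra.
From mathcomp Require Import all_classical all_reals all_analysis.
From mathcomp Require Import measurable_realfun.
From mathcomp Require Import complex ring lra zify.

Set Implicit Arguments.
Unset Strict Implicit.
Unset Printing Implicit Defensive.
Import Order.TTheory GRing.Theory Num.Theory.
Import numFieldNormedType.Exports.
Local Open Scope classical_set_scope.
Local Open Scope ring_scope.
Local Open Scope complex_scope.

(** Both norms compare quadratic forms with the square of the norm of H.  A form q
    that satisfies the parallelogram law and is bounded comes from a positive
    operator (Jordan-von Neumann and Riesz, [form_operator]), which has a square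
    root ([positive_sqrt]); hence sqrt_norm q <= N means that q h <= N^2 |h|^2 for
    all h ([sqrt_norm_form], [sqrt_norm_le]).  So one vector h can be fixed, and
    the theorem becomes a comparison between the oscillation of the H-valued
    function F = phi(.) h and the sums of its squared wavelet coefficients, up to
    constants that depend on w alone.  The row statement is the column statement
    for the adjoints, and the last statement combines the two.

    Since F is strongly measurable, an orthonormal sequence spans its values and
    its coefficients ([frame_exists]), and Parseval's identity reduces F to its
    scalar coordinates f, for which there are two inequalities.

    First, the coefficients of f on the dyadic I inside J are square summable with
    sum at most a constant times the integral of |f - m|^2 against the bump
    1 / (1 + ((x - c) / |J|)^2), where c is the centre of J and m is any constant
    ([coef_le_poisson]).  The wavelets have mean zero ([mean_w]), so that m can be
    subtracted; near J this is Bessel's inequality, and far from J the decay of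
    the wavelets makes the contributions summable.  If the mean oscillations of F
    are bounded, its means over the dilates of J drift slowly, and the integral
    against the bump is at most a constant times |J| ([poisson_of_osc]).

    Conversely, on an interval of length at most 2^j the oscillation of f is
    bounded by the sum over all I of |f_I|^2 / omega_I, where f_I are the
    coefficients of f and the weights omega_I grow with the distance and the scale
    of I ([osc_le_coef]).  This is a duality: the function a equal to f minus its
    mean on the interval and to 0 elsewhere has coefficients that are square
    summable against omega_I ([atom_weighted]), its wavelet expansion converges in
    a norm strong enough to be paired with f ([atom_expansion]), and the pairing
    of a with f is |a|^2.  If the sums of |f_I|^2 over the I inside J are at most a
    multiple of |J|, the weighted sum is at most a multiple of 2^j
    ([carleson_sum]). *)

(** * Squared modulus and integrals of complex functions *)

Section ComplexScalars.
Variable R : realType.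
Implicit Types (z u v : R[i]) (f g h : R -> R[i]) (D : set (measurableTypeR R)).
Local Notation leb := (@lebesgue_measure R).

(** The real number |z|^2 spares the detour through the R[i]-valued norm of R[i]. *)
Definition sq z : R := complex.Re z ^+ 2 + complex.Im z ^+ 2.

Lemma sq_ge0 z : 0 <= sq z.
Proof. by rewrite /sq addr_ge0 ?sqr_ge0. Qed.

Lemma nrm_sq z : nrm z ^+ 2 = sq z.
Proof. by rewrite /nrm normc_def /= sqr_sqrtr // sq_ge0. Qed.

Lemma sqM u v : sq (u * v) = sq u * sq v.
Proof. by case: u v => a b [c d]; rewrite /sq /=; ring. Qed.

Lemma sq_conj z : sq (z^*) = sq z.
Proof. by case: z => a b; rewrite /sq /=; ring. Qed.

Lemma sqN z : sq (- z) = sq z.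
Proof. by case: z => a b; rewrite /sq /=; ring. Qed.

Lemma sq0 : sq 0 = 0. Proof. by rewrite /sq /=; ring. Qed.

Lemma sqr r : sq r%:C = r ^+ 2. Proof. by rewrite /sq /=; ring. Qed.

Lemma sqD_le u v : sq (u + v) <= 2 * sq u + 2 * sq v.
Proof.
case: u v => a b [c d]; rewrite /sq /= -subr_ge0.
have -> : 2 * (a ^+ 2 + b ^+ 2) + 2 * (c ^+ 2 + d ^+ 2) -
  ((a + c) ^+ 2 + (b + d) ^+ 2) = (a - c) ^+ 2 + (b - d) ^+ 2 by ring.
by rewrite addr_ge0 ?sqr_ge0.
Qed.

Lemma sq_eq0 z : sq z = 0 -> z = 0.
Proof.
case: z => a b; rewrite /sq /= => /eqP; rewrite paddr_eq0 ?sqr_ge0 // !sqrf_eq0.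
by case/andP => /eqP -> /eqP ->.
Qed.

Lemma mulzJ z : z * z^* = (sq z)%:C.
Proof. by case: z => a b; apply/eqP; rewrite eq_complex /sq /=; apply/andP; split; apply/eqP; ring. Qed.

(** Young's inequality with a free parameter; optimizing s gives Cauchy-Schwarz. *)
Lemma Re_mulJ_le u v (s : R) : 0 < s ->
  complex.Re (u * v^*) <= s / 2 * sq u + (2 * s)^-1 * sq v.
Proof.
move=> s0; case: u v => a b [c d]; rewrite /sq /= -subr_ge0.
have -> : s / 2 * (a ^+ 2 + b ^+ 2) + (2 * s)^-1 * (c ^+ 2 + d ^+ 2) -
  (a * c - b * - d) = (2 * s)^-1 * ((s * a - c) ^+ 2 + (s * b - d) ^+ 2).
  by field; rewrite gt_eqF.
by rewrite mulr_ge0 ?addr_ge0 ?sqr_ge0 // invr_ge0 mulr_ge0 ?ltW.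
Qed.

Definition cintegrable D f :=
  leb.-integrable D (EFin \o (fun x => complex.Re (f x))) /\
  leb.-integrable D (EFin \o (fun x => complex.Im (f x))).

Lemma eq_cint D f g : (forall x, D x -> f x = g x) -> cint D f = cint D g.
Proof.
move=> fg; rewrite /cint; congr (_ +i* _);
  by apply: eq_Rintegral => x /set_mem Dx; rewrite fg.
Qed.

Lemma cintD D f g : measurable D -> cintegrable D f -> cintegrable D g ->
  cint D (fun x => f x + g x) = cint D f + cint D g.
Proof.
move=> mD [rf jf] [rg jg]; rewrite /cint /=.
apply/eqP; rewrite eq_complex /=; apply/andP; split; apply/eqP.
  rewrite -RintegralD//; apply: eq_Rintegral => x _ /=.
  by case: (f x) (g x) => a b [].
rewrite -RintegralD//; apply: eq_Rintegral => x _ /=.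
by case: (f x) (g x) => a b [].
Qed.

Lemma cintegrableD D f g : measurable D -> cintegrable D f -> cintegrable D g ->
  cintegrable D (fun x => f x + g x).
Proof.
move=> mD [rf jf] [rg jg]; split.
  have := integrableD mD rf rg; apply: eq_integrable => // x _ /=.
  by case: (f x) (g x) => a b [].
have := integrableD mD jf jg; apply: eq_integrable => // x _ /=.
by case: (f x) (g x) => a b [].
Qed.

Lemma cintegrableZ D z f : measurable D -> cintegrable D f ->
  cintegrable D (fun x => z * f x).
Proof.
move=> mD [rf jf]; case: z => a b; split.
  have := integrableB mD (integrableZl mD a rf) (integrableZl mD b jf).
  by apply: eq_integrable => // x _ /=; case: (f x).
have := integrableD mD (integrableZl mD a jf) (integrableZl mD b rf).
by apply: eq_integrable => // x _ /=; case: (f x).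
Qed.

Lemma cintZ D z f : measurable D -> cintegrable D f ->
  cint D (fun x => z * f x) = z * cint D f.
Proof.
move=> mD [rf jf]; case: z => a b; rewrite /cint /=.
have iZ c k : leb.-integrable D (EFin \o k) -> leb.-integrable D (EFin \o (fun x => c * k x)).
  by move=> /(integrableZl mD c); apply: eq_integrable.
apply/eqP; rewrite eq_complex /=; apply/andP; split; apply/eqP.
  rewrite -!RintegralZl// -RintegralB//; [|exact: iZ|exact: iZ].
  by apply: eq_Rintegral => x _; case: (f x).
rewrite -!RintegralZl// -RintegralD//; [|exact: iZ|exact: iZ].
by apply: eq_Rintegral => x _; case: (f x).
Qed.

Lemma cintegrable_conj D f : measurable D -> cintegrable D f ->
  cintegrable D (fun x => (f x)^*).
Proof.
move=> mD [rf jf]; split.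
  by move: rf; apply: eq_integrable => // x _ /=; case: (f x).
have := integrableZl mD (-1) jf.
by apply: eq_integrable => // x _ /=; case: (f x) => a b; rewrite mulN1e.
Qed.

Lemma cint_conj D f : measurable D -> cintegrable D f ->
  cint D (fun x => (f x)^*) = (cint D f)^*.
Proof.
move=> mD [rf jf]; rewrite /cint /=.
apply/eqP; rewrite eq_complex /=; apply/andP; split; apply/eqP.
  by apply: eq_Rintegral => x _ /=; case: (f x).
rewrite -mulN1r -RintegralZl//; apply: eq_Rintegral => x _ /=.
by case: (f x) => a b; rewrite mulN1r.
Qed.

Lemma cint0 D : cint D (fun=> 0 : R[i]) = 0.
Proof. by rewrite /cint /= /Rintegral !integral0_eq. Qed.

Lemma cintegrable0 D : cintegrable D (fun=> 0).
Proof. by split; exact: integrable0. Qed.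

Lemma cint_mkcond D f : cint D f = cint setT (fun x => if x \in D then f x else 0).
Proof.
rewrite /cint; congr (_ +i* _);
by rewrite Rintegral_mkcond; apply: eq_Rintegral => x _; rewrite /patch; case: ifP.
Qed.

Lemma cmeasD f g : cmeasurable f -> cmeasurable g -> cmeasurable (fun x => f x + g x).
Proof.
move=> [rf jf] [rg jg]; split.
  have := measurable_funD rf rg; apply: eq_measurable_fun => x _ /=.
  by case: (f x) (g x) => a b [].
have := measurable_funD jf jg; apply: eq_measurable_fun => x _ /=.
by case: (f x) (g x) => a b [].
Qed.

Lemma cmeasM f g : cmeasurable f -> cmeasurable g -> cmeasurable (fun x => f x * g x).
Proof.
move=> [rf jf] [rg jg]; split.
  have := measurable_funB (measurable_funM rf rg) (measurable_funM jf jg).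
  apply: eq_measurable_fun => x _ /=.
  by case: (f x) (g x) => a b [].
have := measurable_funD (measurable_funM rf jg) (measurable_funM jf rg).
apply: eq_measurable_fun => x _ /=.
by case: (f x) (g x) => a b [].
Qed.

Lemma cmeas_conj f : cmeasurable f -> cmeasurable (fun x => (f x)^*).
Proof.
move=> [rf jf]; split.
  by move: rf; apply: eq_measurable_fun => x _ /=; case: (f x).
have := measurable_funN jf.
by apply: eq_measurable_fun => x _ /=; case: (f x).
Qed.

Lemma cmeas_cst z : cmeasurable (fun=> z).
Proof. by split; exact: measurable_cst. Qed.

Lemma cmeasZ z f : cmeasurable f -> cmeasurable (fun x => z * f x).
Proof. by move=> mf; apply: cmeasM => //; exact: cmeas_cst. Qed.

Lemma cmeas_real (k : R -> R) : measurable_fun setT k -> cmeasurable (fun x => (k x)%:C).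
Proof. by move=> mk; split => //=; exact: measurable_cst. Qed.

Lemma cmeas_if D f : measurable D -> cmeasurable f ->
  cmeasurable (fun x => if x \in D then f x else 0).
Proof.
move=> mD mf.
have -> : (fun x => if x \in D then f x else 0) = (fun x => (\1_D x)%:C * f x).
  by apply/funext => x; rewrite indicE; case: (x \in D); rewrite ?mul1r ?mul0r.
by apply: cmeasM => //; apply: cmeas_real; exact: measurable_indic.
Qed.

Lemma cmeasB f g : cmeasurable f -> cmeasurable g -> cmeasurable (fun x => f x - g x).
Proof.
move=> mf mg; have -> : (fun x => f x - g x) = (fun x => f x + (-1) * g x).
  by apply/funext => x; rewrite mulN1r.
by apply: cmeasD => //; apply: cmeasZ.
Qed.

Lemma meas_sq f : cmeasurable f -> measurable_fun setT (fun x => sq (f x)).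
Proof.
by move=> [rf jf]; apply: measurable_funD; apply: measurable_funX.
Qed.

Lemma measE_sq f : cmeasurable f -> measurable_fun setT (fun x => (sq (f x))%:E).
Proof. by move=> mf; apply/measurable_EFinP; exact: meas_sq. Qed.

Lemma cmeas_sum (I : Type) (s : seq I) (F : I -> R -> R[i]) :
  (forall i, cmeasurable (F i)) -> cmeasurable (fun x => \sum_(i <- s) F i x).
Proof.
move=> mF; elim: s => [|i s IH].
  rewrite [X in cmeasurable X](_ : _ = fun=> 0); first exact: cmeas_cst.
  by apply/funext => x; rewrite big_nil.
rewrite [X in cmeasurable X](_ : _ = fun x => F i x + \sum_(j <- s) F j x).
  exact: cmeasD.
by apply/funext => x; rewrite big_cons.
Qed.

End ComplexScalars.

(** * Square integrable functions and Bessel's inequality *)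

Section SquareIntegrable.
Variable R : realType.
Implicit Types (z u v : R[i]) (f g h : R -> R[i]) (D : set (measurableTypeR R)).
Local Notation leb := (@lebesgue_measure R).

Lemma integrable_le (k m : R -> R) : measurable_fun setT k -> measurable_fun setT m ->
  (forall x, `|k x| <= m x) -> (\int[leb]_x (m x)%:E < +oo)%E ->
  leb.-integrable setT (EFin \o k).
Proof.
move=> mk mm km fm; apply/integrableP; split; first exact/measurable_EFinP.
apply: le_lt_trans fm; apply: ge0_le_integral => //.
- by apply: measurableT_comp => //; exact/measurable_EFinP.
- exact/measurable_EFinP.
- by move=> x _ /=; rewrite lee_fin.
Qed.

Lemma cintegrable_le f (m : R -> R) : cmeasurable f -> measurable_fun setT m ->
  (forall x, `|complex.Re (f x)| <= m x) -> (forall x, `|complex.Im (f x)| <= m x) ->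
  (\int[leb]_x (m x)%:E < +oo)%E -> cintegrable setT f.
Proof. by move=> [rf jf] mm rm jm fm; split; apply: (integrable_le _ mm). Qed.

Definition int2 f : \bar R := (\int[leb]_x (sq (f x))%:E)%E.
Definition L2f f := cmeasurable f /\ (int2 f < +oo)%E.

Lemma in_L2P f : in_L2 f <-> L2f f.
Proof. by rewrite /in_L2 /L2f /int2; under eq_integral do rewrite nrm_sq. Qed.

Lemma int2_ge0 f : (0 <= int2 f)%E.
Proof. by apply: integral_ge0 => x _; rewrite lee_fin sq_ge0. Qed.

Lemma int2_fin f : L2f f -> int2 f = (fine (int2 f))%:E.
Proof. by case=> _ f2; rewrite fineK// ge0_fin_numE// int2_ge0. Qed.

Lemma ge0_intD (k m : R -> R) : measurable_fun setT k -> measurable_fun setT m ->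
  (forall x, 0 <= k x) -> (forall x, 0 <= m x) ->
  (\int[leb]_x (k x + m x)%:E = \int[leb]_x (k x)%:E + \int[leb]_x (m x)%:E)%E.
Proof.
move=> mk mm k0 m0; under eq_integral do rewrite EFinD.
by rewrite ge0_integralD//; (try exact/measurable_EFinP) => x _; rewrite lee_fin.
Qed.

Lemma ge0_intZ (c : R) (k : R -> R) : 0 <= c -> measurable_fun setT k ->
  (forall x, 0 <= k x) ->
  (\int[leb]_x (c * k x)%:E = c%:E * \int[leb]_x (k x)%:E)%E.
Proof.
move=> c0 mk k0; under eq_integral do rewrite EFinM.
by rewrite ge0_integralZl_EFin//; (try exact/measurable_EFinP) => x _; rewrite lee_fin.
Qed.

Lemma ge0_le_int (k m : R -> R) : measurable_fun setT k -> measurable_fun setT m ->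
  (forall x, 0 <= k x) -> (forall x, k x <= m x) ->
  (\int[leb]_x (k x)%:E <= \int[leb]_x (m x)%:E)%E.
Proof.
move=> mk mm k0 km; apply: ge0_le_integral => //; (try exact/measurable_EFinP) => x _;
  rewrite lee_fin //.
Qed.

Lemma L2D f g : L2f f -> L2f g -> L2f (fun x => f x + g x).
Proof.
move=> [mf f2] [mg g2]; split; first exact: cmeasD.
apply: (@le_lt_trans _ _ (\int[leb]_x (2 * sq (f x) + 2 * sq (g x))%:E)%E).
  apply: ge0_le_int => //.
  - exact: meas_sq (cmeasD mf mg).
  - by apply: measurable_funD; apply: measurable_funM => //; exact: meas_sq.
  - by move=> x; exact: sq_ge0.
  - by move=> x; exact: sqD_le.
rewrite ge0_intD; last 4 first.
- by apply: measurable_funM => //; exact: meas_sq.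
- by apply: measurable_funM => //; exact: meas_sq.
- by move=> x; rewrite mulr_ge0 ?sq_ge0.
- by move=> x; rewrite mulr_ge0 ?sq_ge0.
rewrite !ge0_intZ//; (try exact: meas_sq); (try by move=> x; exact: sq_ge0).
by rewrite lte_add_pinfty// lte_mul_pinfty// ?lee_fin.
Qed.

Lemma int2Z z f : cmeasurable f -> int2 (fun x => z * f x) = ((sq z)%:E * int2 f)%E.
Proof.
move=> mf; rewrite /int2; under eq_integral do rewrite sqM.
by rewrite ge0_intZ ?sq_ge0//; [exact: meas_sq|move=> x; exact: sq_ge0].
Qed.

Lemma L2Z z f : L2f f -> L2f (fun x => z * f x).
Proof.
move=> [mf f2]; split; first exact: cmeasZ.
by rewrite int2Z// lte_mul_pinfty// lee_fin sq_ge0.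
Qed.

Lemma L2_0 : L2f (fun=> 0).
Proof.
split; first exact: cmeas_cst.
by rewrite /int2 integral0_eq// => x _; rewrite sq0.
Qed.

Lemma L2_sum (I : Type) (s : seq I) (F : I -> R -> R[i]) :
  (forall i, L2f (F i)) -> L2f (fun x => \sum_(i <- s) F i x).
Proof.
move=> mF; elim: s => [|i s IH].
  rewrite [X in L2f X](_ : _ = fun=> 0); first exact: L2_0.
  by apply/funext => x; rewrite big_nil.
rewrite [X in L2f X](_ : _ = fun x => F i x + \sum_(j <- s) F j x).
  exact: L2D.
by apply/funext => x; rewrite big_cons.
Qed.

Lemma L2B f g : L2f f -> L2f g -> L2f (fun x => f x - g x).
Proof.
move=> Lf Lg; have -> : (fun x => f x - g x) = (fun x => f x + (-1) * g x).
  by apply/funext => x; rewrite mulN1r.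
by apply: L2D => //; exact: L2Z.
Qed.

Definition ip f g : R[i] := cint setT (fun x => f x * (g x)^*).

Lemma ip_integrable f g : L2f f -> L2f g ->
  cintegrable setT (fun x => f x * (g x)^*).
Proof.
move=> [mf f2] [mg g2].
apply: (@cintegrable_le _ (fun x => sq (f x) + sq (g x))).
- by apply: cmeasM => //; exact: cmeas_conj.
- by apply: measurable_funD; exact: meas_sq.
- move=> x; rewrite ler_norml; case: (f x) (g x) => a b [c d]; rewrite /sq /=.
  have := sqr_ge0 (a + c); have := sqr_ge0 (a - c); have := sqr_ge0 (b + d).
  have := sqr_ge0 (b - d); have := sqr_ge0 a; have := sqr_ge0 b; have := sqr_ge0 c.
  by have := sqr_ge0 d; rewrite !expr2 => *; apply/andP; split; lra.
- move=> x; rewrite ler_norml; case: (f x) (g x) => a b [c d]; rewrite /sq /=.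
  have := sqr_ge0 (a + d); have := sqr_ge0 (a - d); have := sqr_ge0 (b + c).
  have := sqr_ge0 (b - c); have := sqr_ge0 a; have := sqr_ge0 b; have := sqr_ge0 c.
  by have := sqr_ge0 d; rewrite !expr2 => *; apply/andP; split; lra.
- rewrite ge0_intD//; try (by move=> x; exact: sq_ge0); try exact: meas_sq.
  exact: lte_add_pinfty f2 g2.
Qed.

Lemma ipC f g : L2f f -> L2f g -> ip g f = (ip f g)^*.
Proof.
move=> Lf Lg; rewrite /ip -cint_conj//; last exact: ip_integrable.
by apply: eq_cint => x _; rewrite rmorphM /= conjcK mulrC.
Qed.

Lemma ipDl f g h : L2f f -> L2f g -> L2f h ->
  ip (fun x => f x + g x) h = ip f h + ip g h.
Proof.
move=> Lf Lg Lh; rewrite /ip -cintD//; try exact: ip_integrable.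
by apply: eq_cint => x _; rewrite mulrDl.
Qed.

Lemma ipZl z f h : L2f f -> L2f h -> ip (fun x => z * f x) h = z * ip f h.
Proof.
move=> Lf Lh; rewrite /ip -cintZ//; last exact: ip_integrable.
by apply: eq_cint => x _; rewrite mulrA.
Qed.

Lemma ipBl f g h : L2f f -> L2f g -> L2f h ->
  ip (fun x => f x - g x) h = ip f h - ip g h.
Proof.
move=> Lf Lg Lh; have -> : (fun x => f x - g x) = (fun x => f x + (-1) * g x).
  by apply/funext => x; rewrite mulN1r.
by rewrite ipDl// ?ipZl// ?mulN1r//; exact: L2Z.
Qed.

Lemma ip0l h : ip (fun=> 0) h = 0.
Proof. by rewrite /ip -[RHS](cint0 setT); apply: eq_cint => x _; rewrite mul0r. Qed.

Lemma ip_suml (I : Type) (s : seq I) (F : I -> R -> R[i]) h :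
  (forall i, L2f (F i)) -> L2f h ->
  ip (fun x => \sum_(i <- s) F i x) h = \sum_(i <- s) ip (F i) h.
Proof.
move=> LF Lh; elim: s => [|i s IH].
  by rewrite big_nil -[RHS](ip0l h); apply: eq_cint => x _; rewrite big_nil.
rewrite big_cons -IH -ipDl//; last exact: L2_sum.
by apply: eq_cint => x _; rewrite big_cons.
Qed.

Lemma ip_self f : L2f f -> ip f f = (fine (int2 f))%:C.
Proof.
move=> Lf; rewrite /ip (eq_cint (g := fun x => (sq (f x))%:C)); last first.
  by move=> x _; rewrite mulzJ.
by rewrite /cint /=; congr (_ +i* _); rewrite /Rintegral integral0_eq.
Qed.

(** Multiplying f by the conjugate z^* of z = <f, g> makes the pairing equal to
    |z|^2, which is real; Young's inequality with parameter s bounds it, and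
    s = 1 / A is the optimal choice. *)
Lemma cauchy_schwarz f g (A B : R) : L2f f -> L2f g ->
  (int2 f <= A%:E)%E -> (int2 g <= B%:E)%E -> sq (ip f g) <= A * B.
Proof.
move=> Lf Lg fA gB.
have A0 : 0 <= A by rewrite -lee_fin (le_trans (int2_ge0 f)).
have B0 : 0 <= B by rewrite -lee_fin (le_trans (int2_ge0 g)).
set z := ip f g; have z0 := sq_ge0 z.
have key s : 0 < s -> sq z <= s / 2 * (sq z * A) + (2 * s)^-1 * B.
  move=> s0; have s20 : 0 <= s / 2 by rewrite divr_ge0// ltW.
  have is0 : 0 <= (2 * s)^-1 by rewrite invr_ge0 mulr_ge0// ltW.
  have mf := Lf.1; have mg := Lg.1.
  have LZ := L2Z (z^*) Lf.
  rewrite [leLHS](_ : _ = complex.Re (ip (fun x => z^* * f x) g)); last first.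
    by rewrite ipZl// -/z mulrC mulzJ.
  have [ri _] := ip_integrable LZ Lg.
  rewrite -lee_fin {1}/ip /cint /= /Rintegral fineK; last exact: integrable_fin_num ri.
  apply: (@le_trans _ _ (\int[leb]_x (s / 2 * sq (z^* * f x) + (2 * s)^-1 * sq (g x))%:E)%E).
    apply: le_integral => //.
      apply: (@integrable_le _ (fun x => s / 2 * sq (z^* * f x) + (2 * s)^-1 * sq (g x))) => //.
      + by apply: measurable_funD; apply: measurable_funM => //; apply: meas_sq => //; exact: cmeasZ.
      + by apply: measurable_funD; apply: measurable_funM => //; apply: meas_sq => //; exact: cmeasZ.
      + by move=> x; rewrite ger0_norm// addr_ge0// mulr_ge0// sq_ge0.
      + rewrite ge0_intD; last 4 first.
        * by apply: measurable_funM => //; apply: meas_sq; exact: cmeasZ.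
        * by apply: measurable_funM => //; apply: meas_sq.
        * by move=> x; rewrite mulr_ge0// sq_ge0.
        * by move=> x; rewrite mulr_ge0// sq_ge0.
        rewrite !ge0_intZ//; try (by move=> x; exact: sq_ge0); last 2 first.
        * exact: meas_sq.
        * apply: meas_sq; exact: cmeasZ.
        rewrite lte_add_pinfty// lte_mul_pinfty//; [exact: LZ.2|exact: Lg.2].
    by move=> x _; rewrite lee_fin; exact: Re_mulJ_le.
  rewrite ge0_intD; last 4 first.
  - by apply: measurable_funM => //; apply: meas_sq; exact: cmeasZ.
  - by apply: measurable_funM => //; apply: meas_sq.
  - by move=> x; rewrite mulr_ge0// sq_ge0.
  - by move=> x; rewrite mulr_ge0// sq_ge0.
  rewrite !ge0_intZ//; try (by move=> x; exact: sq_ge0); last 2 first.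
  - exact: meas_sq.
  - apply: meas_sq; exact: cmeasZ.
  rewrite EFinD leeD//; last by rewrite [leRHS]EFinM lee_wpmul2l// lee_fin.
  rewrite [leRHS]EFinM lee_wpmul2l ?lee_fin//.
  rewrite -/(int2 (fun x => z^* * f x)) int2Z// sq_conj.
  by rewrite [leRHS]EFinM lee_wpmul2l ?lee_fin.
have [A00|A00] := eqVneq A 0.
  rewrite A00 mul0r leNgt; apply/negP => zp.
  have := key ((B + 1) / sq z) ltac:(by rewrite divr_gt0// ltr_wpDl).
  rewrite A00 !mulr0 add0r.
  have -> : (2 * ((B + 1) / sq z))^-1 * B = sq z * (B / (2 * (B + 1))).
    have zn : sq z != 0 by rewrite gt_eqF.
    have Bn : B + 1 != 0 by rewrite gt_eqF// ltr_wpDl.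
    by field; rewrite ?zn ?Bn.
  rewrite leNgt gtr_pMr// => /negP; apply.
  by rewrite ltr_pdivrMr ?mulr_gt0 ?ltr_wpDl//; lra.
have Ap : 0 < A by rewrite lt_neqAle eq_sym A00.
have := key A^-1 ltac:(by rewrite invr_gt0).
have -> : A^-1 / 2 * (sq z * A) = sq z / 2 by field; rewrite gt_eqF.
have -> : (2 * A^-1)^-1 * B = A * B / 2 by field; rewrite gt_eqF.
by lra.
Qed.

Section Bessel.
Variables (I : choiceType) (e : I -> R -> R[i]).
Hypothesis eL2 : forall i, L2f (e i).
Hypothesis eo : forall i j, ip (e i) (e j) = (i == j)%:R.

Lemma ip_comb (s : seq I) (b : I -> R[i]) j : uniq s -> j \in s ->
  ip (fun x => \sum_(i <- s) b i * e i x) (e j) = b j.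
Proof.
move=> us js; rewrite ip_suml//; last by move=> i; exact: L2Z.
rewrite (bigD1_seq j)//= ipZl// eo eqxx mulr1 big1 ?addr0// => i ij.
by rewrite ipZl// eo (negbTE ij) mulr0.
Qed.

Lemma ip_combr (s : seq I) (b : I -> R[i]) f : L2f f ->
  ip f (fun x => \sum_(i <- s) b i * e i x) = \sum_(i <- s) (b i)^* * ip f (e i).
Proof.
move=> Lf; have Lb i : L2f (fun x => b i * e i x) by exact: L2Z.
rewrite ipC//; last exact: L2_sum.
rewrite ip_suml// rmorph_sum; apply: eq_bigr => i _.
by rewrite [ip f (e i)]ipC// ipZl// rmorphM.
Qed.

Lemma int2_comb (s : seq I) (b : I -> R[i]) : uniq s ->
  int2 (fun x => \sum_(i <- s) b i * e i x) = (\sum_(i <- s) sq (b i))%:E.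
Proof.
move=> us; have Lb i : L2f (fun x => b i * e i x) by exact: L2Z.
have Lg := L2_sum s Lb; rewrite int2_fin//; congr EFin.
have := ip_self Lg; rewrite ip_combr// => /(congr1 (@complex.Re R)) /= <-.
rewrite big_seq (eq_bigr (fun i => (sq (b i))%:C)); last first.
  by move=> i si; rewrite ip_comb// mulrC mulzJ.
by rewrite -big_seq -rmorph_sum.
Qed.

(** Cauchy-Schwarz between f and its partial sum: their pairing and the squared
    norm of the partial sum are both the sum S of the squared coefficients, so
    that S^2 <= |f|^2 S. *)
Lemma bessel (s : seq I) f : uniq s -> L2f f ->
  ((\sum_(i <- s) sq (ip f (e i)))%:E <= int2 f)%E.
Proof.
move=> us Lf; set S := \sum_(i <- s) _.
have S0 : 0 <= S by apply: sumr_ge0 => i _; exact: sq_ge0.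
have Lb i : L2f (fun x => ip f (e i) * e i x) by exact: L2Z.
have Lg := L2_sum s Lb; rewrite int2_fin//.
have := cauchy_schwarz (A := fine (int2 f)) (B := S) Lf Lg.
rewrite -int2_fin// int2_comb// -/S => /(_ (lexx _) (lexx _)).
rewrite ip_combr// (eq_bigr (fun i => (sq (ip f (e i)))%:C)); last first.
  by move=> i _; rewrite mulrC mulzJ.
rewrite -rmorph_sum -/S sqr int2_fin// lee_fin; have [->|S1] := eqVneq S 0.
  by move=> _; rewrite fine_ge0// int2_ge0.
by rewrite expr2 ler_pM2r// lt_neqAle eq_sym S1.
Qed.

Lemma bessel_esum (f : R -> R[i]) : L2f f ->
  (\esum_(i in setT) (sq (ip f (e i)))%:E <= int2 f)%E.
Proof.
move=> Lf; apply: ge_ereal_sup => _ [X [finX _] <-].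
by rewrite fsbig_finite// sumEFin bessel.
Qed.

End Bessel.

End SquareIntegrable.

(** * Poisson-type weights *)

Section Poisson.
Variable R : realType.
Implicit Types (D : set (measurableTypeR R)).
Local Notation leb := (@lebesgue_measure R).

(** A bump of height 1 and width L around c.  Its quadratic decay matches the
    weight 1 / (1 + x^2) of the ambient space, and averages against it replace
    averages over [c - L, c + L] when a wavelet has tails. *)
Definition pois (c L x : R) : R := (1 + ((x - c) / L) ^+ 2)^-1.

Lemma pois_gt0 c L x : 0 < pois c L x.
Proof. by rewrite invr_gt0 ltr_pwDl// sqr_ge0. Qed.

Lemma pois_le1 c L x : pois c L x <= 1.
Proof. by rewrite invf_le1 ?lerDl ?sqr_ge0// ltr_pwDl// sqr_ge0. Qed.

Lemma meas_pois c L : measurable_fun [set: R] (pois c L).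
Proof.
apply: continuous_measurable_fun => x; rewrite /pois; apply: cvgV.
  by rewrite gt_eqF// ltr_pwDl// sqr_ge0.
apply: cvgD; first exact: cvg_cst.
rewrite (_ : (fun y => ((y - c) / L) ^+ 2) = (fun y => ((y - c) / L) * ((y - c) / L))); last first.
  by apply/funext => y; rewrite expr2.
by rewrite expr2; apply: cvgM; apply: cvgM; (try exact: cvg_cst); apply: cvgB;
  [exact: cvg_id|exact: cvg_cst|exact: cvg_id|exact: cvg_cst].
Qed.

Lemma int_restrict D (k : R -> R) :
  (\int[leb]_(x in D) (k x)%:E = \int[leb]_x (\1_D x * k x)%:E)%E.
Proof.
rewrite integral_mkcond; apply: eq_integral => x _; rewrite /patch indicE.
by case: (x \in D); rewrite ?mul1r ?mul0r.
Qed.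

Definition sym (c r : R) : set (measurableTypeR R) := `[c - r, c + r]%classic.

Lemma meas_sym c r : measurable (sym c r).
Proof. exact: measurable_itv. Qed.

Lemma symP c r x : (x \in sym c r) = (`|x - c| <= r).
Proof. by rewrite mem_setE in_itv /= lter_distl. Qed.

(** Take the least n for which the dilate contains x: the previous dilate misses
    x, so the weight at x is at most 4 / 4^n. *)
Lemma pois_cover c L x : 0 < L -> exists n, pois c L x <= 4 / 4 ^+ n /\ x \in sym c (2 ^+ n * L).
Proof.
move=> L0; have [n xn] : exists n, `|x - c| <= 2 ^+ n * L.
  pose m := Num.truncn (`|x - c| / L); exists m.+1.
  rewrite -ler_pdivrMr//; apply: (@le_trans _ _ m.+1%:R).
    by apply/ltW; exact: truncnS_gt.
  by rewrite -natrX ler_nat; apply/ltnW/ltn_expl.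
have [N HN Nmin] := ex_minnP (ex_intro (fun n => `|x - c| <= 2 ^+ n * L) n xn).
exists N; rewrite symP; split => //.
case: N HN Nmin => [|N] HN Nmin.
  by rewrite expr0 divr1 (le_trans (pois_le1 _ _ _))// ler1n.
have : 2 ^+ N * L < `|x - c|.
  by rewrite ltNge; apply/negP => /Nmin; rewrite ltnn.
rewrite -ltr_pdivlMr// => h.
rewrite exprS invfM mulrA divff ?mul1r// /pois lef_pV2 ?posrE ?exprn_gt0//; last first.
  by rewrite ltr_pwDl// sqr_ge0.
rewrite (_ : 4 = 2 ^+ 2 :> R); last by rewrite expr2; ring.
rewrite -exprM mulnC exprM; apply: (@le_trans _ _ (((x - c) / L) ^+ 2)); last by rewrite lerDr.
rewrite -(real_normK (num_real ((x - c) / L))) normrM [`|L^-1|]gtr0_norm ?invr_gt0//.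
by apply: lerXn2r; [rewrite nnegrE exprn_ge0|rewrite nnegrE divr_ge0// ltW|exact: ltW].
Qed.

(** A Poisson average is dominated by averages over dilated intervals with
    geometric weights; in this form it can use what is known of intervals. *)
Lemma int_pois_le c L (k : R -> R) : 0 < L -> measurable_fun setT k -> (forall x, 0 <= k x) ->
  (\int[leb]_x (k x * pois c L x)%:E <=
   \sum_(n <oo) (4 / 4 ^+ n)%:E * \int[leb]_(x in sym c (2 ^+ n * L)) (k x)%:E)%E.
Proof.
move=> L0 mk k0.
pose F n x : R := 4 / 4 ^+ n * (\1_(sym c (2 ^+ n * L)) x * k x).
have F0 n x : 0 <= F n x by rewrite !mulr_ge0// invr_ge0 exprn_ge0.
have mI n : measurable_fun setT (fun x => \1_(sym c (2 ^+ n * L)) x * k x).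
  by apply: measurable_funM => //; apply: measurable_indic; exact: meas_sym.
have mF n : measurable_fun setT (F n) by apply: measurable_funM.
apply: (@le_trans _ _ (\int[leb]_x \sum_(n <oo) (F n x)%:E)%E).
  apply: ge0_le_integral => //.
  - by move=> x _; rewrite lee_fin mulr_ge0// ltW// pois_gt0.
  - apply/measurable_EFinP; apply: measurable_funM => //; exact: meas_pois.
  - apply: ge0_emeasurable_sum => // [n x _ _|n _]; first by rewrite lee_fin.
    exact/measurable_EFinP.
  - move=> x _; have [n [hn xn]] := pois_cover c x L0.
    apply: (@le_trans _ _ (F n x)%:E).
      by rewrite lee_fin /F indicE xn mul1r mulrC ler_wpM2r.
    rewrite (nneseries_split 0 n.+1)//; last by move=> i _; rewrite lee_fin.
    rewrite add0n big_nat_recr//= -addeA addeC -addeA leeDl//.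
    by rewrite adde_ge0//; [apply: nneseries_ge0 => i _ _|apply: sume_ge0 => i _]; rewrite lee_fin.
rewrite integral_nneseries//; last 2 first.
- by move=> n; exact/measurable_EFinP.
- by move=> n x _; rewrite lee_fin.
apply: lee_nneseries => [n _ _|n _]; first by apply: integral_ge0 => x _; rewrite lee_fin.
rewrite [in leRHS]int_restrict /F ge0_intZ//.
  exact: mI.
by move=> x; rewrite mulr_ge0.
Qed.

Lemma series_geo (a r : R) : 0 <= r -> r < 1 ->
  (\sum_(n <oo) (a * r ^+ n)%:E = (a / (1 - r))%:E)%E.
Proof.
move=> r0 r1; apply/(@cvg_lim (\bar R)) => //.
rewrite (_ : (fun n => _) = EFin \o series (geometric a r)); last first.
  by apply/funext => n; rewrite /series /= sumEFin.
apply: cvg_EFin; first by apply: nearW.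
by apply: cvg_geometric_series; rewrite ger0_norm.
Qed.

Lemma int_pois c L : 0 < L -> (\int[leb]_x (pois c L x)%:E <= (16 * L)%:E)%E.
Proof.
move=> L0; have := @int_pois_le c L (fun=> 1) L0 (measurable_cst _) (fun=> ler01).
under eq_integral do rewrite mul1r.
move/le_trans; apply.
rewrite (eq_eseriesr (g := fun n => (8 * L * 2^-1 ^+ n)%:E)); last first.
  move=> n _; rewrite integral_cst; last exact: meas_sym.
  rewrite mul1e /sym/= lebesgue_measure_itv/= lte_fin ltrD2l gtrN//; last first.
    by rewrite mulr_gt0// exprn_gt0.
  rewrite -EFinD -EFinM; congr EFin.
  rewrite (_ : 4 ^+ n = 2 ^+ n * 2 ^+ n :> R); last by rewrite -exprMn; congr (_ ^+ _); ring.
  by rewrite exprVn; field; rewrite expf_neq0.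
by rewrite series_geo ?invf_lt1 ?ltr1n// (_ : 8 * L / (1 - 2^-1) = 16 * L)//; field.
Qed.

End Poisson.

(** * Decay of Schwartz functions and affine changes of variable *)

Section Decay.
Variable R : realType.

(** The bounds of g and of x^4 g suffice, because (1 + x^2)^2 <= 2 + 2 x^4. *)
Lemma decay4 (g : R -> R) : (forall m : nat, exists C : R, forall x, `|x ^+ m * g x| <= C) ->
  exists2 K : R, 0 < K & forall x, (g x) ^+ 2 * (1 + x ^+ 2) ^+ 4 <= K.
Proof.
move=> gP; have [C0 h0] := gP 0; have [C4 h4] := gP 4.
have C00 : 0 <= C0 by apply: le_trans (h0 0).
have C40 : 0 <= C4 by apply: le_trans (h4 0).
exists ((2 * C0 + 2 * C4) ^+ 2 + 1); first by rewrite ltr_wpDl// sqr_ge0.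
move=> x; apply: (@le_trans _ _ ((2 * C0 + 2 * C4) ^+ 2)); last by rewrite lerDl.
rewrite (_ : _ * _ = (g x * (1 + x ^+ 2) ^+ 2) ^+ 2); last by ring.
rewrite -[leLHS]real_normK ?num_real// lerXn2r ?nnegrE//.
  by rewrite addr_ge0// mulr_ge0.
rewrite normrM (ger0_norm (sqr_ge0 (1 + x ^+ 2))).
have := h0 x; have := h4 x; rewrite expr0 mul1r normrM => k4 k0.
rewrite ger0_norm in k4; last by rewrite exprn_even_ge0.
apply: (@le_trans _ _ (2 * `|g x| + 2 * (x ^+ 4 * `|g x|))); last first.
  by rewrite lerD// ler_pM2l.
rewrite -subr_ge0 (_ : _ - _ = `|g x| * (1 - x ^+ 2) ^+ 2); last by ring.
by rewrite mulr_ge0// sqr_ge0.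
Qed.

Lemma mvt_abs (f : R -> R) (a b : R) : (forall x, derivable f x 1) ->
  exists2 c, `|c - a| <= `|b - a| & f b - f a = derive1 f c * (b - a).
Proof.
move=> df.
have cf u v : {within `[u, v], continuous f}.
  by apply: derivable_within_continuous => x _; exact: df.
have isd (x : R) : is_derive x 1 f (derive1 f x).
  by apply: DeriveDef => //; rewrite derive1E.
have [ab|ba] := leP a b.
  have [c] := MVT_segment ab (fun x _ => isd x) (cf a b).
  rewrite in_itv /= => /andP[ac cb] e; exists c => //.
  by rewrite !ger0_norm ?subr_ge0// ?lerD2r.
have [c] := MVT_segment (ltW ba) (fun x _ => isd x) (cf b a).
rewrite in_itv /= => /andP[bc ca] e; exists c; last first.
  by rewrite -opprB e -mulrN opprB.
by rewrite !ler0_norm ?subr_le0 ?(ltW ba)// ?lerN2 ?lerD2r.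
Qed.

(** The quantitative content of the Schwartz condition for the estimates below:
    decay, a global Lipschitz bound, and a local Lipschitz bound with decay.
    The last two come from the mean value theorem. *)
Lemma schwartz_bounds (w : R -> R[i]) : schwartz w -> cmeasurable w /\
  exists K : R, [/\ 0 < K,
    forall y, sq (w y) <= K / (1 + y ^+ 2) ^+ 4,
    forall y t, `|y - t| <= 1 -> sq (w y - w t) <= K * (y - t) ^+ 2 / (1 + t ^+ 2) ^+ 2 &
    forall y t, sq (w y - w t) <= K * (y - t) ^+ 2].
Proof.
move=> [hr hi].
have meas f : rschwartz f -> measurable_fun [set: R] f.
  move=> /(_ 0%N)[df _]; apply: continuous_measurable_fun => x.
  exact/differentiable_continuous/derivable1_diffP/df.
split; first by split; exact: meas.
have real_bounds f : rschwartz f -> exists K : R, [/\ 0 < K,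
    forall y, (f y) ^+ 2 <= K / (1 + y ^+ 2) ^+ 4,
    forall y t, `|y - t| <= 1 -> (f y - f t) ^+ 2 <= K * (y - t) ^+ 2 / (1 + t ^+ 2) ^+ 2 &
    forall y t, (f y - f t) ^+ 2 <= K * (y - t) ^+ 2].
  move=> hf; have [K0 K0p h0] := decay4 (hf 0%N).2.
  have [K1 K1p h1] := decay4 (hf 1%N).2; rewrite /= in h0 h1.
  have df x : derivable f x 1 by have [] := hf 0%N.
  have p1 (y : R) : 0 < 1 + y ^+ 2 by rewrite ltr_pwDl// sqr_ge0.
  have p11 (y : R) : 1 <= 1 + y ^+ 2 by rewrite lerDl sqr_ge0.
  exists (K0 + 9 * K1); split.
  - by rewrite addr_gt0// mulr_gt0.
  - move=> y; rewrite ler_pdivlMr ?exprn_gt0//.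
    by rewrite (le_trans (h0 y))// lerDl mulr_ge0// ltW.
  - move=> y t yt; have [c ct e] := mvt_abs t y df.
    rewrite e exprMn [leRHS]mulrAC ler_wpM2r ?sqr_ge0//.
    rewrite ler_pdivlMr ?exprn_gt0//.
    apply: (@le_trans _ _ (9 * K1)); last by rewrite lerDr ltW.
    have q : (1 + t ^+ 2) <= 3 * (1 + c ^+ 2).
      have : (t - c) ^+ 2 <= 1.
        rewrite -[leLHS]real_normK ?num_real// expr_le1// distrC.
        exact: le_trans ct yt.
      have := sqr_ge0 (t - 2 * c); rewrite !expr2 => *; nra.
    apply: (@le_trans _ _ (9 * (derive1 f c ^+ 2 * (1 + c ^+ 2) ^+ 4))); last first.
      by rewrite ler_pM2l.
    apply: (@le_trans _ _ (derive1 f c ^+ 2 * (3 * (1 + c ^+ 2)) ^+ 2)).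
      by rewrite ler_wpM2l ?sqr_ge0// lerXn2r ?nnegrE// ?ltW// mulr_gt0.
    rewrite exprMn mulrCA (_ : 3 ^+ 2 = 9); last by ring.
    rewrite ler_pM2l// ler_wpM2l ?sqr_ge0//.
    by apply: ler_weXn2l => //; exact: p11.
  - move=> y t; have [c ct e] := mvt_abs t y df.
    rewrite e exprMn ler_wpM2r ?sqr_ge0//.
    apply: (@le_trans _ _ (derive1 f c ^+ 2 * (1 + c ^+ 2) ^+ 4)).
      by rewrite ler_peMr ?sqr_ge0// exprn_ege1.
    by rewrite (le_trans (h1 c))// (le_trans (y := 9 * K1))// ?lerDr ?ltW//; lra.
have [Kr [r0 r1 r2 r3]] := real_bounds _ hr.
have [Ki [i0 i1 i2 i3]] := real_bounds _ hi.
have sqBE u v : sq (u - v : R[i]) = (complex.Re u - complex.Re v) ^+ 2 + (complex.Im u - complex.Im v) ^+ 2.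
  by case: u v => a b [].
exists (Kr + Ki); split.
- exact: addr_gt0.
- by move=> y; rewrite mulrDl /sq lerD.
- by move=> y t yt; rewrite sqBE !mulrDl lerD// ?r2 ?i2.
- by move=> y t; rewrite sqBE mulrDl lerD.
Qed.

End Decay.

Section AffineChange.
Variable R : realType.
Local Notation leb := (@lebesgue_measure R).
Variables (c L : R).
Hypothesis L0 : 0 < L.

Let phi (x : measurableTypeR R) : measurableTypeR R := (x - c) / L.

Let mphi : measurable_fun setT phi.
Proof.
suff : measurable_fun [set: R] (fun x : R => (x - c) / L) by [].
apply: measurable_funM => //.
by apply: measurable_funB => //; exact: measurable_id.
Qed.

(** Lebesgue measure is L^-1 times its image under x |-> (x - c) / L, since both
    measures agree on half-open intervals. *)
Lemma ge0_int_affine (h : R -> \bar R) : measurable_fun setT h -> (forall x, 0 <= h x)%E ->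
  (\int[leb]_x h ((x - c) / L)%R = L%:E * \int[leb]_x h x)%E.
Proof.
move=> mh h0.
have L0' : 0 <= L by exact: ltW.
have iL0 : 0 <= L^-1 by rewrite invr_ge0.
pose pf : {measure set (measurableTypeR R) -> \bar R} :=
  measure_function_pushforward__canonical__measure_function_Measure leb mphi.
pose mu : {measure set (measurableTypeR R) -> \bar R} := mscale (NngNum iL0) pf.
have E A : measurable A -> leb A = mu A.
  apply: lebesgue_measure_unique => /= _ [[a b]] _ <-.
  rewrite /mu /mscale /= /pushforward.
  have -> : phi @^-1` `]a, b] = `]a * L + c, b * L + c]%classic.
    apply/seteqP; split => x /=; rewrite /phi !in_itv /= ltr_pdivlMr// ler_pdivrMr//;
    by rewrite ltrBrDr lerBlDr.
  rewrite !lebesgue_measure_itv/= !lte_fin ltrD2r ltr_pM2r//.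
  case: ltP => ab; last by rewrite mule0.
  by rewrite -!EFinD -EFinM; congr EFin; field; rewrite gt_eqF.
have -> : (\int[leb]_x h x = \int[mu]_x h x)%E.
  by apply: eq_measure_integral => /= A mA _; exact: E.
rewrite /mu ge0_integral_mscale//= (ge0_integral_pushforward mphi)//=.
by rewrite preimage_setT muleA -EFinM divff ?gt_eqF// mul1e.
Qed.

Lemma int_affine (k : R -> R) : leb.-integrable setT (EFin \o k) ->
  \int[leb]_x k ((x - c) / L) = L * \int[leb]_x k x.
Proof.
move=> ik; rewrite /Rintegral.
have mE : measurable_fun [set: R] (EFin \o k) by apply: measurable_int ik.
have -> : (\int[leb]_x (k x)%:E = \int[leb]_x (EFin \o k)^\+%E x - \int[leb]_x (EFin \o k)^\-%E x)%E.
  exact: integralE.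
have -> : (\int[leb]_x (k ((x - c) / L))%:E = \int[leb]_x (EFin \o k)^\+%E ((x - c) / L)%R -
    \int[leb]_x (EFin \o k)^\-%E ((x - c) / L)%R)%E.
  rewrite [LHS]integralE; congr (_ - _)%E; apply: eq_integral => x _.
    by rewrite !funeposE.
  by rewrite !funenegE.
rewrite !ge0_int_affine//; try exact: measurable_funepos; try exact: measurable_funeneg.
have fp : (\int[leb]_x (EFin \o k)^\+%E x)%E \is a fin_num.
  by apply: integrable_fin_num => //; exact: integrable_funepos.
have fn : (\int[leb]_x (EFin \o k)^\-%E x)%E \is a fin_num.
  by apply: integrable_fin_num => //; exact: integrable_funeneg.
rewrite -(fineK fp) -(fineK fn) -!EFinM -!EFinD /=.
by rewrite mulrBr.
Qed.

Lemma cint_affine (f : R -> R[i]) : cintegrable setT f ->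
  cint setT (fun x => f ((x - c) / L)) = L%:C * cint setT f.
Proof.
move=> [rf jf]; rewrite /cint (int_affine rf) (int_affine jf).
by apply/eqP; rewrite eq_complex /= !mul0r subr0 addr0 !eqxx.
Qed.

End AffineChange.

(** * Size, integrability and mean of the wavelets *)

Section Wavelet.
Variable R : realType.
Local Notation leb := (@lebesgue_measure R).
Variables (w : R -> R[i]) (K : R).
Hypothesis mw : cmeasurable w.
Hypothesis K0 : 0 < K.
Hypothesis wdecay : forall y, sq (w y) <= K / (1 + y ^+ 2) ^+ 4.
Hypothesis wlip : forall y t, sq (w y - w t) <= K * (y - t) ^+ 2.
Hypothesis worth : forall I J : int * int,
  cint setT (fun x => wavelet w I x * (wavelet w J x)^*) = (I == J)%:R.

Lemma dlen_gt0 I : 0 < dlen R I.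
Proof. by rewrite /dlen exprz_gt0. Qed.

Lemma dlen_ge0 I : 0 <= dlen R I.
Proof. exact: ltW (dlen_gt0 I). Qed.

Let K_ge0 : 0 <= K. Proof. exact: ltW. Qed.

Local Notation wav := (wavelet w).

Lemma sq_wav I x : sq (wav I x) = (dlen R I)^-1 * sq (w ((x - dcenter R I) / dlen R I)).
Proof.
by rewrite /wavelet sqM sqr exprVn sqr_sqrtr// ltW// dlen_gt0.
Qed.

Lemma wav_le I x : sq (wav I x) <= K / dlen R I * pois (dcenter R I) (dlen R I) x ^+ 4.
Proof.
rewrite sq_wav [K / _]mulrC -mulrA ler_wpM2l ?invr_ge0 ?dlen_ge0//.
by rewrite /pois exprVn; exact: wdecay.
Qed.

Lemma meas_affine (c L : R) (f : R -> R[i]) : cmeasurable f -> cmeasurable (fun x => f ((x - c) / L)).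
Proof.
have ma : measurable_fun [set: R] (fun x : R => (x - c) / L).
  by apply: measurable_funM => //; apply: measurable_funB => //; exact: measurable_id.
by move=> [rf jf]; split; [exact: (measurableT_comp rf ma)|exact: (measurableT_comp jf ma)].
Qed.

Lemma meas_wav I : cmeasurable (wav I).
Proof. by apply: cmeasZ; exact: meas_affine. Qed.

Lemma pois_exp c L (x : R) n : pois c L x ^+ n.+1 <= pois c L x.
Proof. by rewrite exprS ler_piMr ?exprn_ile1 ?(ltW (pois_gt0 _ _ _))// pois_le1. Qed.

Lemma int_le_pois (k : R -> R) (C c L : R) : 0 <= C -> 0 < L -> measurable_fun setT k ->
  (forall x, 0 <= k x) -> (forall x, k x <= C * pois c L x) ->
  (\int[leb]_x (k x)%:E <= (C * (16 * L))%:E)%E.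
Proof.
move=> C0 L0 mk k0 kC; apply: (@le_trans _ _ (\int[leb]_x (C * pois c L x)%:E)%E).
  by apply: ge0_le_int => //; apply: measurable_funM => //; exact: meas_pois.
rewrite ge0_intZ//; first by rewrite EFinM lee_wpmul2l// ?lee_fin// int_pois.
  exact: meas_pois.
by move=> x; exact: ltW (pois_gt0 _ _ _).
Qed.

Lemma L2_wav I : L2f (wav I).
Proof.
split; first exact: meas_wav.
apply: (@le_lt_trans _ _ (K / dlen R I * (16 * dlen R I))%:E); last exact: ltry.
apply: (@int_le_pois _ _ (dcenter R I)); rewrite ?dlen_gt0//.
- by rewrite divr_ge0 ?dlen_ge0.
- exact: meas_sq (meas_wav I).
- by move=> x; exact: sq_ge0.
- move=> x; apply: (le_trans (wav_le I x)).
  by rewrite ler_wpM2l ?pois_exp// divr_ge0 ?dlen_ge0.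
Qed.

Lemma wav_orth I J : ip (wav I) (wav J) = (I == J)%:R.
Proof. exact: worth. Qed.

Lemma cintegrable_pois (f : R -> R[i]) (C c L : R) : 0 <= C -> 0 < L -> cmeasurable f ->
  (forall x, sq (f x) <= C * pois c L x ^+ 2) -> cintegrable setT f.
Proof.
move=> C0 L0 mf fC.
have p0 x : 0 < pois c L x by exact: pois_gt0.
have le2 (a b x : R) : a ^+ 2 + b ^+ 2 <= C * pois c L x ^+ 2 -> `|a| <= (C + 1) * pois c L x.
  move=> h; rewrite -(@ler_pXn2r _ 2) ?nnegrE//; last by rewrite mulr_ge0 ?ltW ?ltr_wpDl.
  rewrite real_normK ?num_real// exprMn; apply: (@le_trans _ _ (C * pois c L x ^+ 2)).
    by apply: le_trans h; rewrite lerDl sqr_ge0.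
  rewrite ler_wpM2r ?sqr_ge0// expr2; nra.
apply: (@cintegrable_le _ _ (fun x => (C + 1) * pois c L x)) => //.
- by apply: measurable_funM => //; exact: meas_pois.
- by move=> x; apply: (le2 _ (complex.Im (f x))); exact: fC.
- by move=> x; apply: (le2 _ (complex.Re (f x))); rewrite addrC; exact: fC.
- rewrite ge0_intZ//; last 3 first.
  + by rewrite addr_ge0.
  + exact: meas_pois.
  + by move=> x; exact: ltW.
  rewrite lte_mul_pinfty ?lee_fin ?addr_ge0//.
  by apply: le_lt_trans (int_pois c L0) _; exact: ltry.
Qed.

Lemma wav_integrable I : cintegrable setT (wav I).
Proof.
apply: (@cintegrable_pois _ (K / dlen R I) (dcenter R I) (dlen R I)).
- by rewrite divr_ge0 ?dlen_ge0.
- exact: dlen_gt0.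
- exact: meas_wav.
- move=> x; apply: (le_trans (wav_le I x)); rewrite ler_wpM2l//.
    by rewrite divr_ge0 ?dlen_ge0.
  rewrite (_ : 4 = 2 + 2)%N// exprD ler_piMr ?sqr_ge0// exprn_ile1 ?pois_le1//.
  exact: ltW (pois_gt0 _ _ _).
Qed.

Lemma w_integrable : cintegrable setT w.
Proof.
apply: (@cintegrable_pois _ K 0 1) => //.
move=> x; apply: (le_trans (wdecay x)); rewrite /pois subr0 divr1 ler_wpM2l//.
have p : 1 <= 1 + x ^+ 2 by rewrite lerDl sqr_ge0.
have p' : 0 < 1 + x ^+ 2 by rewrite (lt_le_trans ltr01).
by rewrite exprVn lef_pV2 ?posrE ?exprn_gt0// ler_weXn2l.
Qed.

Lemma sq_cint_wav I : sq (cint setT (wav I)) = dlen R I * sq (cint setT w).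
Proof.
have d0 := dlen_gt0 I.
have iw : cintegrable setT (fun x => w ((x - dcenter R I) / dlen R I)).
  apply: (@cintegrable_pois _ K (dcenter R I) (dlen R I)) => //.
    exact: meas_affine.
  move=> x; apply: (le_trans (wdecay _)); rewrite /pois ler_wpM2l//.
  set y := (_ / _); have p : 1 <= 1 + y ^+ 2 by rewrite lerDl sqr_ge0.
  have p' : 0 < 1 + y ^+ 2 by rewrite (lt_le_trans ltr01).
  by rewrite exprVn lef_pV2 ?posrE ?exprn_gt0// ler_weXn2l.
rewrite /wavelet cintZ// cint_affine//; last exact: w_integrable.
rewrite !sqM !sqr exprVn sqr_sqrtr ?ltW//; field; exact: lt0r_neq0.
Qed.

(** Suppose that the integral of w is not 0, and let x0 be a point where the
    wavelet v of length 1 does not vanish.  Pair v with a wavelet of length d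
    centred at c near x0.  Replacing v by the constant v c makes the pairing
    v c times the integral of the small wavelet, whose square is of order d; the
    error has square of order d^3 by the Lipschitz bound.  Orthogonality forces
    the two to be equal, which is absurd as d tends to 0. *)
Lemma mean_w : cint setT w = 0.
Proof.
apply: sq_eq0; apply/eqP; rewrite eq_le sq_ge0 andbT leNgt; apply/negP => W0.
set W := sq (cint setT w) in W0.
pose v := wav (0, 0).
have vE x : v x = w (x - dcenter R (0,0)).
  have d1 : dlen R (0, 0) = 1 by rewrite /dlen expr0z.
  by rewrite /v /wavelet d1 sqrtr1 invr1 mulr1 (_ : 1%:C = 1)// mul1r.
have vlip x y : sq (v x - v y) <= K * (x - y) ^+ 2.
  by rewrite !vE; apply: (le_trans (wlip _ _)); rewrite (_ : _ - _ = x - y)//; ring.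
have [x0 vx0] : exists x0, 0 < sq (v x0).
  apply: contrapT => /forallNP h.
  have v0 x : v x = 0.
    apply: sq_eq0; apply/eqP; rewrite eq_le sq_ge0 andbT leNgt; apply/negP; exact: h.
  have := wav_orth (0,0) (0,0); rewrite eqxx /ip (eq_cint (g := fun=> 0)).
    by rewrite cint0 => /eqP; rewrite eq_sym oner_eq0.
  by move=> x _; rewrite -/v v0 mul0r.
have key n : let d := (2 ^+ n.+1)^-1 : R in sq (v x0) * W <= (512 * K ^+ 2 + 2 * K * W) * d ^+ 2.
  move=> d; have d0 : 0 < d by rewrite invr_gt0 exprn_gt0.
  pose I : int * int := (- (n.+1)%:Z, Num.floor (x0 / d)).
  have dE : dlen R I = d by rewrite /dlen /I /d /= -exprnN.
  pose c := dcenter R I.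
  have cx : (x0 - c) ^+ 2 <= d ^+ 2.
    rewrite -(real_normK (num_real (x0 - c))) lerXn2r ?nnegrE// ltW//.
    have := Num.Theory.floor_itv (x0 / d); rewrite /c /dcenter dE /I /= => /andP[].
    rewrite ler_pdivlMr// ltr_pdivrMr// intrD1 mulrDl mul1r => h1 h2.
    by rewrite ltr_norml mulrDl; apply/andP; split; lra.
  have I0 : (I == (0,0)) = false by apply/negbTE; rewrite /I xpair_eqE.
  have vc : sq (v x0) <= 2 * sq (v c) + 2 * (K * d ^+ 2).
    rewrite (_ : v x0 = v c + (v x0 - v c)); last by rewrite addrC subrK.
    apply: (le_trans (sqD_le _ _)); rewrite lerD2l ler_pM2l//.
    by apply: (le_trans (vlip _ _)); rewrite ler_pM2l.
  have p0 x : 0 < pois c d x by exact: pois_gt0.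
  (* The weight moves part of the decay of wav I onto the growth of v x - v c. *)
  pose F x := (pois c d x)^-1%:C * wav I x.
  pose G x := (pois c d x)%:C * (v x - v c).
  have mG : cmeasurable G.
    apply: cmeasM; first by apply: cmeas_real; exact: meas_pois.
    by apply: cmeasB; [exact: meas_wav|exact: cmeas_cst].
  have mF : cmeasurable F.
    apply: cmeasM; last exact: meas_wav.
    apply: cmeas_real; rewrite (_ : (fun x => _) = fun x => 1 + ((x - c) / d) ^+ 2); last first.
      by apply/funext => x; rewrite /pois invrK.
    apply: measurable_funD => //; apply: measurable_funX; apply: measurable_funM => //.
    by apply: measurable_funB => //; exact: measurable_id.
  have F2 : (int2 F <= (16 * K)%:E)%E.
    rewrite (_ : 16 * K = K / d * (16 * d)); last by field; rewrite gt_eqF.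
    apply: (@int_le_pois _ _ c d) => //.
    - by rewrite divr_ge0// ltW.
    - exact: meas_sq.
    - by move=> x; exact: sq_ge0.
    move=> x; rewrite /F sqM sqr exprVn mulrC ler_pdivrMr ?exprn_gt0//.
    apply: (le_trans (wav_le I x)); rewrite dE -/c -[leRHS]mulrA ler_wpM2l//.
      by rewrite divr_ge0// ltW.
    by rewrite -exprS; apply: ler_wiXn2l => //; rewrite ?pois_le1// ltW.
  have G2 : (int2 G <= (K * d ^+ 2 * (16 * d))%:E)%E.
    apply: (@int_le_pois _ _ c d) => //.
    - by rewrite mulr_ge0 ?sqr_ge0// ltW.
    - exact: meas_sq.
    - by move=> x; exact: sq_ge0.
    move=> x; rewrite /G sqM sqr.
    apply: (@le_trans _ _ (pois c d x ^+ 2 * (K * (x - c) ^+ 2))).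
      by rewrite ler_wpM2l ?sqr_ge0.
    have -> : (x - c) ^+ 2 = d ^+ 2 * ((pois c d x)^-1 - 1).
      by rewrite /pois invrK; field; rewrite gt_eqF.
    rewrite -subr_ge0.
    have -> : K * d ^+ 2 * pois c d x - pois c d x ^+ 2 * (K * (d ^+ 2 * ((pois c d x)^-1 - 1))) =
      K * d ^+ 2 * pois c d x ^+ 2 by field; rewrite gt_eqF.
    by rewrite !mulr_ge0 ?sqr_ge0// ltW.
  have LF : L2f F by split => //; apply: (le_lt_trans F2); exact: ltry.
  have LG : L2f G by split => //; apply: (le_lt_trans G2); exact: ltry.
  have := cauchy_schwarz LF LG F2 G2.
  have -> : ip F G = - ((v c)^* * cint setT (wav I)).
    apply/eqP; rewrite -addr_eq0; apply/eqP.
    rewrite /ip -cintZ//; last exact: wav_integrable.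
    rewrite -cintD//; [|exact: ip_integrable|by apply: cintegrableZ => //; exact: wav_integrable].
    have <- : ip (wav I) v = 0 by rewrite wav_orth I0.
    apply: eq_cint => x _; rewrite /F.
    have -> : Num.conj (G x) = (pois c d x)%:C * ((v x)^* - (v c)^*).
      rewrite /G; case: (v x) (v c) => a b [a' b'].
      by apply/eqP; rewrite eq_complex /=; apply/andP; split; apply/eqP; ring.
    have e : (pois c d x)^-1%:C * (pois c d x)%:C = 1 :> R[i].
      by rewrite -rmorphM /= mulVf// gt_eqF.
    rewrite (_ : _ * wav I x * _ = (((pois c d x)^-1)%:C * (pois c d x)%:C) * (wav I x * ((v x)^* - (v c)^*))); last by ring.
    rewrite e mul1r; ring.
  rewrite sqN sqM sq_conj sq_cint_wav dE -/W => h.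
  have h' : sq (v c) * W <= 256 * K ^+ 2 * d ^+ 2.
    by rewrite -(ler_pM2r d0); apply: le_trans (le_trans h _); rewrite le_eqVlt; apply/orP; left; apply/eqP; ring.
  have := ler_wpM2r (ltW W0) vc; nra.
have C0 : 0 < 512 * K ^+ 2 + 2 * K * W by rewrite addr_gt0 ?mulr_gt0 ?exprn_gt0 ?ltr0n.
pose m := Num.truncn ((512 * K ^+ 2 + 2 * K * W) / (sq (v x0) * W)).
have := key m; apply/negP; rewrite -ltNge.
have pos : 0 < sq (v x0) * W by rewrite mulr_gt0.
have : (512 * K ^+ 2 + 2 * K * W) / (sq (v x0) * W) < m.+1%:R by exact: truncnS_gt.
rewrite ltr_pdivrMr// => h.
have d1 : (2 ^+ m.+1)^-1 <= (m.+1%:R)^-1 :> R.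
  by rewrite lef_pV2 ?posrE ?exprn_gt0// -natrX ler_nat; apply/ltnW/ltn_expl.
have d2 : ((2 ^+ m.+1)^-1) ^+ 2 <= (m.+1%:R)^-1 :> R.
  apply: le_trans d1; rewrite expr2 ler_piMl ?invr_ge0 ?exprn_ge0//.
  by rewrite invf_le1 ?exprn_gt0// exprn_ege1// ler1n.
apply: (le_lt_trans (ler_wpM2l (ltW C0) d2)).
by rewrite ltr_pdivrMr ?ltr0n// [ltRHS]mulrC.
Qed.

Lemma mean_wav I : cint setT (wav I) = 0.
Proof. by apply: sq_eq0; rewrite sq_cint_wav mean_w sq0 mulr0. Qed.

End Wavelet.

(** * Sums over dyadic intervals *)

Section ExtendedSums.
Variables (R : realType) (T : choiceType).
Implicit Types (D : set T) (a : T -> \bar R).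

Lemma esumZ D (c : R) a : 0 <= c -> (forall i, 0 <= a i)%E ->
  (\esum_(i in D) (c%:E * a i) = c%:E * \esum_(i in D) a i)%E.
Proof.
have le (b : T -> \bar R) (d : R) : 0 <= d -> (forall i, 0 <= b i)%E ->
    (\esum_(i in D) (d%:E * b i) <= d%:E * \esum_(i in D) b i)%E.
  move=> d0 b0; apply: ge_ereal_sup => _ [X [finX XD] <-].
  rewrite -ge0_mule_fsumr// lee_wpmul2l ?lee_fin//.
  by apply: ereal_sup_ubound; exists X.
move=> c0 a0; apply/eqP; rewrite eq_le le//=.
have [->|cn0] := eqVneq c 0.
  by rewrite mul0e esum_ge0// => i _; rewrite mul0e.
have := le (fun i => c%:E * a i)%E c^-1; rewrite invr_ge0 => /(_ c0).
have -> : (fun i => c^-1%:E * (c%:E * a i))%E = a.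
  by apply/funext => i; rewrite muleA -EFinM mulVf// mul1e.
have cE0 : (0 <= c%:E)%E by rewrite lee_fin.
move=> /(_ _)/(lee_wpmul2l cE0); rewrite muleA -EFinM divff// mul1e; apply => i.
by rewrite mule_ge0.
Qed.

Lemma esum_sub D D' a : (forall i, 0 <= a i)%E -> D `<=` D' ->
  (\esum_(i in D) a i <= \esum_(i in D') a i)%E.
Proof.
move=> a0 DD'; apply: ge_ereal_sup => _ [X [finX XD] <-].
by apply: ereal_sup_ubound; exists X => //; split => //; exact: subset_trans DD'.
Qed.

Lemma le_esum1 D a i : (forall j, 0 <= a j)%E -> D i -> (a i <= \esum_(j in D) a j)%E.
Proof.
move=> a0 Di; rewrite -(esum_set1 (t := i))//; apply: esum_sub => //.
by move=> j ->.
Qed.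

End ExtendedSums.

Section DyadicSums.
Variable R : realType.

(** The telescoping majorant 4 - 4 / (n + 1) closes the induction. *)
Lemma nat_sum_sqr (n : nat) :
  \sum_(i < n) (1 + (i%:R : R) ^+ 2)^-1 <= 4 - 4 / n.+1%:R.
Proof.
elim: n => [|n IH]; first by rewrite big_ord0 divr1 subrr.
rewrite big_ord_recr /=; apply: (le_trans (lerD IH (lexx _))).
have n0 : 0 <= n%:R :> R by [].
rewrite -[n.+2%:R]natr1 -[n.+1%:R]natr1.
set x := n%:R : R in n0 *.
have p1 : 0 < x + 1 by rewrite ltr_wpDl.
have p2 : 0 < x + 1 + 1 by rewrite ltr_wpDl ?addr_ge0.
have p3 : 0 < 1 + x ^+ 2 by rewrite ltr_pwDl ?sqr_ge0.
rewrite -subr_ge0 (_ : _ - _ = (4 * (1 + x ^+ 2) - (x + 1) * (x + 1 + 1)) /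
   ((x + 1) * (x + 1 + 1) * (1 + x ^+ 2))); last first.
  by field; rewrite !gt_eqF.
rewrite divr_ge0 ?mulr_ge0 ?(ltW p1) ?(ltW p2) ?(ltW p3)//.
have := sqr_ge0 (x - 1 / 2); rewrite !expr2; nra.
Qed.

Lemma int_sum_sqr : (\esum_(k in [set: int]) ((1 + (k%:~R : R) ^+ 2)^-1)%:E <= 8%:E)%E.
Proof.
have f0 (k : int) : (0%:E <= ((1 + (k%:~R : R) ^+ 2)^-1)%:E)%E.
  by rewrite lee_fin invr_ge0 addr_ge0// sqr_ge0.
have half (e : nat -> int) : injective e -> (forall n, (n%:R : R) ^+ 2 <= ((e n)%:~R) ^+ 2) ->
    (\esum_(k in range e) ((1 + (k%:~R : R) ^+ 2)^-1)%:E <= 4%:E)%E.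
  move=> ie ge; rewrite esum_image; last by move=> x y _ _; exact: ie.
  rewrite -nneseries_esumT; last by move=> n; exact: f0.
  apply: lime_le; first by apply: is_cvg_nneseries => n _ _; exact: f0.
  apply: nearW => n; rewrite sumEFin lee_fin big_mkord.
  apply: (@le_trans _ _ (\sum_(i < n) (1 + (i%:R : R) ^+ 2)^-1)).
    apply: ler_sum => i _; rewrite lef_pV2 ?posrE ?ltr_pwDl ?sqr_ge0//.
    by rewrite lerD2l ge.
  by apply: (le_trans (nat_sum_sqr n)); rewrite gerBl divr_ge0.
rewrite (esumID (range Posz))//.
rewrite (_ : 8%:E = (4%:E + 4%:E)%E); last by rewrite -EFinD; congr EFin; ring.
rewrite setTI; apply: leeD; first by apply: half => [x y []|n].
apply: (@le_trans _ _ (\esum_(k in range Negz) ((1 + (k%:~R : R) ^+ 2)^-1)%:E)).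
  apply: esum_sub => //; rewrite setTI => -[n|n] /= h; last by exists n.
  by exfalso; apply: h; exists n.
apply: half => [x y []//|n].
by rewrite NegzE mulrNz sqrrN lerXn2r ?nnegrE//= -pmulrn ler_nat.
Qed.

(** Up to the factor 3, the shift may be rounded to an integer. *)
Lemma int_sum_shift (s : R) :
  (\esum_(k in [set: int]) ((1 + (k%:~R - s) ^+ 2)^-1)%:E <= 24%:E)%E.
Proof.
pose m := Num.floor s.
have /andP[ms sm] := Num.Theory.floor_itv s; rewrite -/m intrD1 in ms sm.
rewrite (@reindex_esum _ _ _ setT setT (fun k => k + m)); last first.
  split => //; first by move=> x y _ _; exact: addIr.
  by move=> k _; exists (k - m) => //; rewrite subrK.
apply: (@le_trans _ _ (\esum_(k in [set: int]) (3%:E * ((1 + (k%:~R : R) ^+ 2)^-1)%:E))%E).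
  apply: le_esum => k _; rewrite -EFinM lee_fin intrD.
  set x := k%:~R; set y := m%:~R in ms sm *.
  have p1 : 0 < 1 + x ^+ 2 by rewrite ltr_pwDl ?sqr_ge0.
  have p2 : 0 < 1 + (x + y - s) ^+ 2 by rewrite ltr_pwDl ?sqr_ge0.
  rewrite ler_pdivlMr// mulrC ler_pdivrMr//.
  have := sqr_ge0 (2 * x - 3 * (s - y)); rewrite !expr2 => h; nra.
rewrite esumZ//; last by move=> k; rewrite lee_fin invr_ge0 addr_ge0// sqr_ge0.
rewrite (_ : 24%:E = (3%:E * 8%:E)%E); last by rewrite -EFinM; congr EFin; ring.
by rewrite lee_wpmul2l ?lee_fin// int_sum_sqr.
Qed.

(** Halving the step doubles the sum: the even and the odd positions are two
    copies of the coarser sum. *)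
Lemma int_sum_scaled (n : nat) (s : R) :
  (\esum_(k in [set: int]) ((1 + ((k%:~R - s) / 2 ^+ n) ^+ 2)^-1)%:E <= (24 * 2 ^+ n)%:E)%E.
Proof.
elim: n s => [|n IH] s.
  rewrite expr0 mulr1; apply: le_trans (int_sum_shift s).
  by apply: le_esum => k _; rewrite divr1.
have f0 (k : int) : (0%:E <= ((1 + ((k%:~R - s) / 2 ^+ n.+1) ^+ 2)^-1)%:E)%E.
  by rewrite lee_fin invr_ge0 addr_ge0// sqr_ge0.
pose e (r m : int) : int := m + m + r.
have part (r : int) (t : R) : t = (s - r%:~R) / 2 ->
    (\esum_(k in range (e r)) ((1 + ((k%:~R - s) / 2 ^+ n.+1) ^+ 2)^-1)%:E
      <= (24 * 2 ^+ n)%:E)%E.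
  move=> tE; rewrite esum_image; last by move=> x y _ _; rewrite /e; lia.
  apply: le_trans (IH t); apply: le_esum => m _; rewrite /e !intrD tE [2 ^+ n.+1]exprS lee_fin.
  rewrite (_ : (_ + _ + _ - s) / _ = (m%:~R - (s - r%:~R) / 2) / 2 ^+ n)//.
  by field; rewrite expf_neq0.
rewrite (esumID (range (e 0)))//.
rewrite (_ : 24 * 2 ^+ n.+1 = 24 * 2 ^+ n + 24 * 2 ^+ n); last by rewrite exprS; ring.
rewrite EFinD; apply: leeD.
  by rewrite setTI; exact: (part 0 _ erefl).
apply: le_trans (part 1 _ erefl); apply: esum_sub => //.
rewrite setTI => k /= h; exists (k %/ 2)%Z => //; rewrite /e.
have : (k %% 2)%Z <> 0 by move=> h0; apply: h; exists (k %/ 2)%Z => //; rewrite /e; lia.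
lia.
Qed.

Lemma esum_scales (e : nat -> int) (b : int * int -> R) (g : nat -> R) (C : R) :
  injective e -> (forall I, 0 <= b I) ->
  (forall n, (\esum_(k in [set: int]) (b (e n, k))%:E <= (g n)%:E)%E) ->
  (\sum_(n <oo) (g n)%:E <= C%:E)%E ->
  (\esum_(I in [set I | exists n, I.1 = e n]) (b I)%:E <= C%:E)%E.
Proof.
move=> ie b0 bg gC; apply: le_trans gC.
have g0 n : 0 <= g n.
  by rewrite -lee_fin; apply: le_trans (bg n); apply: esum_ge0 => k _; rewrite lee_fin.
rewrite (@reindex_esum _ _ _ ([set: nat] `*`` (fun=> [set: int])) _
  (fun nk => (e nk.1, nk.2))); last first.
  split.
  - by move=> [n k] _ /=; exists n.
  - by move=> [n k] [n' k'] _ _ /= [] /ie -> ->.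
  - by move=> [i k] /= [n ->]; exists (n, k).
rewrite -(esum_esum (a := fun n k => (b (e n, k))%:E))//; last by move=> *; rewrite lee_fin.
by rewrite nneseries_esumT; [exact: le_esum|move=> n; rewrite lee_fin].
Qed.

Lemma dlenB (j : int) (n : nat) k : dlen R (j - n%:Z, k) = 2 ^ j / 2 ^+ n.
Proof. by rewrite /dlen /= expfzDr// -exprnN. Qed.

Lemma dlenD (j : int) (n : nat) k : dlen R (j + n%:Z, k) = 2 ^ j * 2 ^+ n.
Proof. by rewrite /dlen /= expfzDr// -exprnP. Qed.

Let two_gt0 (j : int) : 0 < 2 ^ j :> R. Proof. by rewrite exprz_gt0. Qed.

(** At length 2^(j - n) the weight sees about 2^n positions, each counted with
    the factor 4^-n, so the scales sum geometrically. *)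
Lemma esum_small (j : int) (p : R) :
  (\esum_(I in [set I : int * int | (I.1 <= j)%R])
     ((dlen R I / 2 ^ j) ^+ 2 * pois p (2 ^ j) (dcenter R I))%:E <= 48%:E)%E.
Proof.
pose e (n : nat) : int := j - n%:Z.
rewrite (_ : [set I : int * int | (I.1 <= j)%R] = [set I | exists n, I.1 = e n]); last first.
  apply/seteqP; split => -[i k] /=; last by move=> [n ->]; rewrite /e gerBl.
  move=> ij; exists `|j - i|%N; rewrite /e gez0_abs ?subr_ge0//; ring.
have L0 := two_gt0 j; set L : R := 2 ^ j in L0 *.
apply: (@esum_scales e _ (fun n => 24 * 2^-1 ^+ n)).
- by move=> x y /addrI /oppr_inj [].
- move=> I; rewrite mulr_ge0 ?exprn_ge0 ?divr_ge0 ?dlen_ge0 ?(ltW L0)//.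
  exact: ltW (pois_gt0 _ _ _).
- move=> n; have t0 : 0 < 2 ^+ n :> R by rewrite exprn_gt0.
  pose s := p / (L / 2 ^+ n) - 2^-1.
  have E k : (dlen R (e n, k) / L) ^+ 2 * pois p L (dcenter R (e n, k)) =
      (2^-1 ^+ n) ^+ 2 * (1 + ((k%:~R - s) / 2 ^+ n) ^+ 2)^-1.
    rewrite /dcenter dlenB -/L /pois exprVn.
    have -> : L / 2 ^+ n / L = (2 ^+ n)^-1 by field; rewrite !gt_eqF.
    have -> // : ((k%:~R + 2^-1) * (L / 2 ^+ n) - p) / L = (k%:~R - s) / 2 ^+ n.
    by rewrite /s; field; rewrite !gt_eqF.
  rewrite (eq_esum (b := fun k : int => (((2^-1 ^+ n) ^+ 2)%:E * ((1 + ((k%:~R - s) / 2 ^+ n) ^+ 2)^-1)%:E)%E)); last first.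
    by move=> k _; rewrite E EFinM.
  rewrite esumZ ?sqr_ge0//; last by move=> k; rewrite lee_fin invr_ge0 addr_ge0// sqr_ge0.
  apply: (@le_trans _ _ (((2^-1 ^+ n) ^+ 2)%:E * (24 * 2 ^+ n)%:E)%E).
    by rewrite lee_wpmul2l ?lee_fin ?sqr_ge0// int_sum_scaled.
  rewrite -EFinM lee_fin le_eqVlt; apply/orP; left; apply/eqP.
  by rewrite exprVn; field; rewrite gt_eqF.
by rewrite series_geo ?invf_lt1 ?ltr1n// (_ : 24 / (1 - 2^-1) = 48)//; field.
Qed.

(** At lengths above 2^j the weight sees boundedly many positions, and the factor
    r makes the scales summable. *)
Lemma esum_big (j : int) (p r : R) : 0 <= r -> r < 1 ->
  (\esum_(I in [set I : int * int | (j < I.1)%R])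
     (r ^+ `|I.1 - j|%N * pois p (dlen R I) (dcenter R I))%:E <= (24 / (1 - r))%:E)%E.
Proof.
move=> r0 r1.
pose e (n : nat) : int := j + (n.+1)%:Z.
rewrite (_ : [set I : int * int | (j < I.1)%R] = [set I | exists n, I.1 = e n]); last first.
  apply/seteqP; split => -[i k] /=; last by move=> [n ->]; rewrite /e ltrDl.
  move=> ij; exists (`|i - j|%N.-1); rewrite /e prednK ?absz_gt0 ?subr_eq0 ?gt_eqF//.
  rewrite gez0_abs ?subr_ge0 ?ltW//; ring.
have L0 := two_gt0 j; set L : R := 2 ^ j in L0 *.
apply: (@esum_scales e _ (fun n => 24 * r ^+ n)).
- by move=> x y /addrI [].
- move=> I; rewrite mulr_ge0 ?exprn_ge0//; exact: ltW (pois_gt0 _ _ _).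
- move=> n; have t0 : 0 < 2 ^+ n.+1 :> R by rewrite exprn_gt0.
  pose s := p / (L * 2 ^+ n.+1) - 2^-1.
  have E k : r ^+ `|(e n, k).1 - j|%N * pois p (dlen R (e n, k)) (dcenter R (e n, k)) =
      r ^+ n.+1 * (1 + (k%:~R - s) ^+ 2)^-1.
    rewrite /dcenter dlenD -/L /pois /e /= addrAC subrr add0r absz_nat.
    have -> // : ((k%:~R + 2^-1) * (L * 2 ^+ n.+1) - p) / (L * 2 ^+ n.+1) = k%:~R - s.
    by rewrite /s; field; rewrite !gt_eqF.
  rewrite (eq_esum (b := fun k : int => ((r ^+ n.+1)%:E * ((1 + (k%:~R - s) ^+ 2)^-1)%:E)%E)); last first.
    by move=> k _; rewrite E EFinM.
  rewrite esumZ ?exprn_ge0//; last by move=> k; rewrite lee_fin invr_ge0 addr_ge0// sqr_ge0.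
  apply: (@le_trans _ _ ((r ^+ n.+1)%:E * 24%:E)%E).
    by rewrite lee_wpmul2l ?lee_fin ?exprn_ge0// int_sum_shift.
  by rewrite -EFinM lee_fin mulrC ler_pM2l// exprS ler_piMl ?exprn_ge0// ltW.
by rewrite (@series_geo _ 24 r).
Qed.

End DyadicSums.

(** * The weighted space and the coefficient bound *)

Section WeightedL2.
Variable R : realType.
Local Notation leb := (@lebesgue_measure R).
Implicit Types (f g : R -> R[i]).

(** The scalar version of the ambient space; its weight 1 / (1 + x^2) is the
    Poisson weight of centre 0 and width 1. *)
Definition wL2 f := cmeasurable f /\ (\int[leb]_x (sq (f x) * pois 0 1 x)%:E < +oo)%E.

(** All Poisson weights are comparable, so the weighted space may be tested
    against the weight adapted to any given interval. *)
Lemma pois_comp (c L c' L' x : R) : 0 < L -> 0 < L' ->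
  pois c L x <= (1 + 2 * (L / L') ^+ 2 + 2 * ((c - c') / L') ^+ 2) * pois c' L' x.
Proof.
move=> L0 L0'; rewrite /pois.
set y := (x - c) / L; have -> : (x - c') / L' = y * (L / L') + (c - c') / L'.
  by rewrite /y; field; rewrite !gt_eqF.
set a := L / L'; set b := (c - c') / L'.
have p1 : 0 < 1 + y ^+ 2 by rewrite ltr_pwDl ?sqr_ge0.
have p2 : 0 < 1 + (y * a + b) ^+ 2 by rewrite ltr_pwDl ?sqr_ge0.
rewrite ler_pdivlMr// mulrC ler_pdivrMr// -subr_ge0.
have -> : (1 + 2 * a ^+ 2 + 2 * b ^+ 2) * (1 + y ^+ 2) - (1 + (y * a + b) ^+ 2) =
  (y * a - b) ^+ 2 + y ^+ 2 + 2 * a ^+ 2 + 2 * (b ^+ 2 * y ^+ 2) by ring.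
have h1 := sqr_ge0 (y * a - b); have h2 := sqr_ge0 y; have h3 := sqr_ge0 a.
have h4 : 0 <= b ^+ 2 * y ^+ 2 by rewrite mulr_ge0 ?sqr_ge0.
by lra.
Qed.

Let quad_ge0 (a b : R) : 0 <= 1 + 2 * a ^+ 2 + 2 * b ^+ 2.
Proof. by have := sqr_ge0 a; have := sqr_ge0 b; lra. Qed.

Lemma pois_ge0 (c L x : R) : 0 <= pois c L x.
Proof. exact: ltW (pois_gt0 c L x). Qed.

Lemma meas_sq_pois f (c L : R) : cmeasurable f ->
  measurable_fun setT (fun x => sq (f x) * pois c L x).
Proof. by move=> mf; apply: measurable_funM; [exact: meas_sq|exact: meas_pois]. Qed.

Lemma sq_pois_ge0 f (c L x : R) : 0 <= sq (f x) * pois c L x.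
Proof. by rewrite mulr_ge0 ?sq_ge0 ?pois_ge0. Qed.

Lemma wL2_pois f (c L : R) : 0 < L -> wL2 f ->
  (\int[leb]_x (sq (f x) * pois c L x)%:E < +oo)%E.
Proof.
move=> L0 [mf f2].
pose C : R := 1 + 2 * (L / 1) ^+ 2 + 2 * ((c - 0) / 1) ^+ 2.
have C0 : 0 <= C by exact: quad_ge0.
apply: (@le_lt_trans _ _ (\int[leb]_x (C * (sq (f x) * pois 0 1 x))%:E)%E).
  apply: ge0_le_int.
  - exact: meas_sq_pois.
  - by apply: measurable_funM => //; exact: meas_sq_pois.
  - by move=> x; exact: sq_pois_ge0.
  - move=> x; rewrite mulrCA ler_wpM2l ?sq_ge0//; exact: pois_comp.
rewrite ge0_intZ//; [|exact: meas_sq_pois|by move=> x; exact: sq_pois_ge0].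
by rewrite lte_mul_pinfty// lee_fin.
Qed.

Lemma wL2_D f g : wL2 f -> wL2 g -> wL2 (fun x => f x + g x).
Proof.
move=> [mf f2] [mg g2]; split; first exact: cmeasD.
apply: (@le_lt_trans _ _ (\int[leb]_x (2 * (sq (f x) * pois 0 1 x) + 2 * (sq (g x) * pois 0 1 x))%:E)%E).
  apply: ge0_le_int.
  - exact: meas_sq_pois (cmeasD mf mg).
  - by apply: measurable_funD; apply: measurable_funM => //; exact: meas_sq_pois.
  - by move=> x; exact: (@sq_pois_ge0 (fun x => f x + g x)).
  - by move=> x; rewrite !mulrA -mulrDl ler_wpM2r ?pois_ge0// sqD_le.
have mfp := meas_sq_pois 0 1 mf; have mgp := meas_sq_pois 0 1 mg.
rewrite ge0_intD; [|exact: measurable_funM|exact: measurable_funM| |];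
  try by move=> x; rewrite mulr_ge0// sq_pois_ge0.
rewrite !ge0_intZ//; try (by move=> x; exact: sq_pois_ge0).
by rewrite lte_add_pinfty// lte_mul_pinfty// lee_fin.
Qed.

Lemma wL2_cst (z : R[i]) : wL2 (fun=> z).
Proof.
split; first exact: cmeas_cst.
rewrite ge0_intZ ?sq_ge0//; last 2 first.
- exact: meas_pois.
- by move=> x; exact: pois_ge0.
rewrite lte_mul_pinfty ?lee_fin ?sq_ge0//.
by apply: (le_lt_trans (int_pois _ ltr01)); exact: ltry.
Qed.

Lemma wL2_le f g : cmeasurable g -> (forall x, sq (g x) <= sq (f x)) -> wL2 f -> wL2 g.
Proof.
move=> mg gf [mf f2]; split => //; apply: le_lt_trans f2; apply: ge0_le_int.
- exact: meas_sq_pois.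
- exact: meas_sq_pois.
- by move=> x; exact: sq_pois_ge0.
- by move=> x; rewrite ler_wpM2r ?pois_ge0.
Qed.

Lemma wL2_B f g : wL2 f -> wL2 g -> wL2 (fun x => f x - g x).
Proof.
move=> wf wg; apply: wL2_D => //.
apply: (wL2_le _ _ wg); last by move=> x; rewrite sqN.
have -> : (fun x => - g x) = (fun x => -1 * g x) by apply/funext => x; rewrite mulN1r.
exact: cmeasZ wg.1.
Qed.

Lemma wL2_if f (D : set (measurableTypeR R)) : measurable D -> wL2 f ->
  wL2 (fun x => if x \in D then f x else 0).
Proof.
move=> mD wf; apply: (wL2_le _ _ wf); first by apply: cmeas_if => //; case: wf.
by move=> x; case: ifP => // _; rewrite sq0 sq_ge0.
Qed.

(** Cauchy-Schwarz for q f and q^-1 g.  It gives a meaning to the pairing of a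
    function of the weighted space with a rapidly decreasing one. *)
Lemma weighted_cs f g (q : R -> R) (A B : R) : cmeasurable f -> cmeasurable g ->
  measurable_fun setT q -> measurable_fun setT (fun x => (q x)^-1) ->
  (forall x, 0 < q x) ->
  (\int[leb]_x (sq (f x) * q x ^+ 2)%:E <= A%:E)%E ->
  (\int[leb]_x (sq (g x) / q x ^+ 2)%:E <= B%:E)%E ->
  cintegrable setT (fun x => f x * (g x)^*) /\ sq (ip f g) <= A * B.
Proof.
move=> mf mg mq mq' q0 fA gB.
pose F x := (q x)%:C * f x; pose G x := (q x)^-1%:C * g x.
have mF : cmeasurable F by apply: cmeasM => //; exact: cmeas_real.
have mG : cmeasurable G by apply: cmeasM => //; exact: cmeas_real.
have FA : (int2 F <= A%:E)%E.
  by rewrite /int2; under eq_integral do rewrite sqM sqr mulrC.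
have GB : (int2 G <= B%:E)%E.
  by rewrite /int2; under eq_integral do rewrite sqM sqr exprVn mulrC.
have LF : L2f F by split => //; apply: (le_lt_trans FA); exact: ltry.
have LG : L2f G by split => //; apply: (le_lt_trans GB); exact: ltry.
have E x : F x * (G x)^* = f x * (g x)^*.
  rewrite /F /G; have : q x * (q x)^-1 = 1 by rewrite divff// gt_eqF.
  move: (q x) (q x)^-1 => u v uv.
  have uv1 : u%:C * v%:C = 1 :> R[i] by rewrite -rmorphM /= uv.
  have -> : Num.conj (v%:C * g x) = v%:C * (g x)^*.
    case: (g x) => a b.
    by apply/eqP; rewrite eq_complex /=; apply/andP; split; apply/eqP; ring.
  by rewrite mulrACA uv1 mul1r.
have -> : (fun x => f x * (g x)^*) = (fun x => F x * (G x)^*).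
  by apply/funext => x; rewrite E.
split; first exact: ip_integrable.
have := cauchy_schwarz LF LG FA GB.
by rewrite /ip (eq_cint (g := fun x => f x * (g x)^*)).
Qed.

Lemma meas_poisV (c L : R) : measurable_fun [set: R] (fun x => (pois c L x)^-1).
Proof.
rewrite (_ : (fun x => _) = fun x => 1 + ((x - c) / L) ^+ 2); last first.
  by apply/funext => x; rewrite /pois invrK.
apply: measurable_funD => //; apply: measurable_funX; apply: measurable_funM => //.
by apply: measurable_funB => //; exact: measurable_id.
Qed.

End WeightedL2.

Section DyadicInclusion.
Variable R : realType.

Lemma dyadic_sub (I J : int * int) : dyadic I `<=` (dyadic J : set R) ->
  [/\ I.1 <= J.1,
      J.2%:~R * dlen R J <= I.2%:~R * dlen R I &
      (I.2%:~R + 1) * dlen R I <= (J.2%:~R + 1) * dlen R J].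
Proof.
move=> IJ; have dI := dlen_gt0 R I; have dJ := dlen_gt0 R J.
have := IJ (I.2%:~R * dlen R I); rewrite /dyadic /= !in_itv /= lexx /=.
rewrite ltr_pM2r// ltrDl ltr01 => /(_ isT) /andP[h1 h2].
have h3 : (I.2%:~R + 1) * dlen R I <= (J.2%:~R + 1) * dlen R J.
  rewrite leNgt; apply/negP => h3.
  have := IJ ((J.2%:~R + 1) * dlen R J); rewrite /dyadic /= !in_itv /= ltxx andbF.
  by rewrite h3 (ltW h2) /= => /(_ isT).
split => //.
have : dlen R I <= dlen R J by lra.
by rewrite /dlen leNgt; apply: contraNle => h; rewrite ltr_eXz2l// ltr1n.
Qed.

Lemma dyadic_center (I J : int * int) : dyadic I `<=` (dyadic J : set R) ->
  `|dcenter R I - dcenter R J| <= dlen R J / 2.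
Proof.
move=> /dyadic_sub[_ h1 h2]; have dI := dlen_gt0 R I.
by rewrite /dcenter ler_norml; apply/andP; split; lra.
Qed.

End DyadicInclusion.

Section CoefBound.
Variable R : realType.
Local Notation leb := (@lebesgue_measure R).
Variables (w : R -> R[i]) (K : R).
Hypothesis mw : cmeasurable w.
Hypothesis K0 : 0 < K.
Hypothesis wdecay : forall y, sq (w y) <= K / (1 + y ^+ 2) ^+ 4.
Hypothesis wlip : forall y t, sq (w y - w t) <= K * (y - t) ^+ 2.
Hypothesis worth : forall I J : int * int,
  cint setT (fun x => wavelet w I x * (wavelet w J x)^*) = (I == J)%:R.
Local Notation wav := (wavelet w).

Let K_ge0 : 0 <= K. Proof. exact: ltW. Qed.

(** Makes [weighted_cs] applicable to wavelets and functions of the weighted space. *)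
Lemma wav_over_pois (I : int * int) (c L : R) : 0 < L ->
  exists B : R, (\int[leb]_x (sq (wav I x) / pois c L x ^+ 2)%:E <= B%:E)%E.
Proof.
move=> L0; have d0 := dlen_gt0 R I.
pose c0 := dcenter R I; pose d := dlen R I.
pose C : R := 1 + 2 * (d / L) ^+ 2 + 2 * ((c0 - c) / L) ^+ 2.
have C0 : 0 <= C.
  by rewrite /C; have := sqr_ge0 (d / L); have := sqr_ge0 ((c0 - c) / L); lra.
exists (K / d * C ^+ 2 * (16 * d)).
apply: (@int_le_pois _ _ _ c0 d) => //.
- by rewrite !mulr_ge0 ?exprn_ge0 ?invr_ge0 ?(ltW d0).
- apply: measurable_funM; first exact: meas_sq (meas_wav mw I).
  under eq_fun do rewrite -exprVn.
  by apply: measurable_funX; exact: meas_poisV.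
- by move=> x; rewrite divr_ge0 ?sq_ge0 ?sqr_ge0.
move=> x; rewrite ler_pdivrMr ?exprn_gt0 ?pois_gt0//.
apply: (le_trans (wav_le wdecay I x)); rewrite -/c0 -/d -!mulrA ler_wpM2l//.
rewrite ler_wpM2l ?invr_ge0 ?(ltW d0)//.
rewrite [leRHS](_ : _ = pois c0 d x * (C * pois c L x) ^+ 2); last by ring.
have h := pois_comp c0 c x d0 L0; rewrite -/d -/C in h.
apply: (@le_trans _ _ (pois c0 d x * pois c0 d x ^+ 2)).
  by rewrite -exprS; apply: ler_wiXn2l => //; rewrite ?pois_ge0 ?pois_le1.
by rewrite ler_wpM2l ?pois_ge0// lerXn2r ?nnegrE ?pois_ge0// mulr_ge0// pois_ge0.
Qed.

Lemma wL2_wav_integrable f I : wL2 f ->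
  cintegrable setT (fun x => f x * (wav I x)^*).
Proof.
move=> wf; have [B HB] := wav_over_pois I 0 (@ltr01 R).
have fA := wL2_pois 0 ltr01 wf.
have [] // := @weighted_cs R f (wav I) (pois 0 1)
  (fine (\int[leb]_x (sq (f x) * pois 0 1 x)%:E)%E) B wf.1 (meas_wav mw I)
  (meas_pois 0 1) (meas_poisV 0 1) (pois_gt0 0 1).
rewrite fineK ?ge0_fin_numE//; last by apply: integral_ge0 => x _; rewrite lee_fin sq_pois_ge0.
apply: ge0_le_int => [||x|x].
- apply: measurable_funM; first exact: meas_sq wf.1.
  by apply: measurable_funX; exact: meas_pois.
- exact: meas_sq_pois wf.1.
- by rewrite mulr_ge0 ?sq_ge0// sqr_ge0.
- by rewrite ler_wpM2l ?sq_ge0// pois_exp.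
Qed.

Lemma coef_sub_cst f (m : R[i]) I : wL2 f ->
  ip (fun x => f x - m) (wav I) = ip f (wav I).
Proof.
move=> wf; rewrite /ip.
have im := wL2_wav_integrable I (wL2_cst (- m)).
transitivity (cint setT (fun x => f x * (wav I x)^* + - m * (wav I x)^*)).
  by apply: eq_cint => x _; rewrite mulrDl.
rewrite cintD//; last exact: wL2_wav_integrable.
have -> : cint setT (fun x => - m * (wav I x)^*) = 0; last by rewrite addr0.
rewrite cintZ//; last exact: (cintegrable_conj _ (wav_integrable mw K0 wdecay I)).
rewrite (_ : cint _ _ = (cint setT (wav I))^*); last first.
  exact: (cint_conj _ (wav_integrable mw K0 wdecay I)).
by rewrite (mean_wav mw K0)// conjc0 mulr0.
Qed.

(** The term 4 comes from Bessel's inequality near J, the other from the tails of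
    the wavelets, summed by [esum_small]. *)
Definition poissonC : R := 4 + 192 * (8 ^+ 4 * 16 * K).

(** Wavelets have mean zero, so f may be replaced by g = f - m.  The part g1 of g
    near J is square integrable and Bessel's inequality applies.  The part g2
    away from J meets only the tails of the wavelets: Cauchy-Schwarz with the
    Poisson weight bounds each coefficient with a gain (|I| / |J|)^2, and the
    gains are summable. *)
Theorem coef_le_poisson f (m : R[i]) J : wL2 f ->
  (\esum_(I in [set I | dyadic I `<=` (dyadic J : set R)]) (sq (ip f (wav I)))%:E <=
   poissonC%:E * \int[leb]_x (sq (f x - m) * pois (dcenter R J) (dlen R J) x)%:E)%E.
Proof.
move=> wf; set c := dcenter R J; set L := dlen R J.
have L0 : 0 < L := dlen_gt0 R J.
pose g x := f x - m.
have wg : wL2 g by apply: wL2_B => //; exact: wL2_cst.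
set P := (\int[leb]_x _)%E.
have P0 : (0 <= P)%E by apply: integral_ge0 => x _; rewrite lee_fin (@sq_pois_ge0 _ g).
have Pfin : P \is a fin_num by rewrite ge0_fin_numE// (wL2_pois c L0 wg).
pose Q := sym c L.
pose g1 x := if x \in Q then g x else 0.
pose g2 x := if x \in ~` Q then g x else 0.
have mQ : measurable Q := meas_sym c L.
have wg1 : wL2 g1 by apply: wL2_if.
have wg2 : wL2 g2 by apply: wL2_if => //; exact: measurableC.
have E I : ip f (wav I) = ip g1 (wav I) + ip g2 (wav I).
  rewrite -(coef_sub_cst m)// /ip -cintD//; try exact: wL2_wav_integrable.
  apply: eq_cint => x _; rewrite -mulrDl /g1 /g2 in_setC.
  by case: (x \in Q); rewrite ?addr0 ?add0r.
have g1P : (int2 g1 <= 2%:E * P)%E.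
  rewrite -ge0_intZ//; last 2 first.
  - exact: meas_sq_pois wg.1.
  - by move=> x; exact: (@sq_pois_ge0 _ g).
  apply: ge0_le_int.
  - exact: meas_sq wg1.1.
  - by apply: measurable_funM => //; exact: meas_sq_pois wg.1.
  - by move=> x; exact: sq_ge0.
  move=> x; rewrite /g1; case: ifPn => [|_]; last by rewrite sq0 mulr_ge0// (@sq_pois_ge0 _ g).
  rewrite symP => xQ; rewrite -/(g x) mulrCA ler_peMr ?sq_ge0//.
  rewrite /pois ler_pdivlMr ?ltr_pwDl ?sqr_ge0// mul1r.
  rewrite -[leRHS]/(1 + 1) lerD2l -real_normK ?num_real// exprn_ile1//.
  by rewrite normrM [`|L^-1|]gtr0_norm ?invr_gt0// ler_pdivrMr// mul1r.
have L1 : L2f g1.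
  split; first exact: wg1.1.
  by apply: (le_lt_trans g1P); rewrite lte_mul_pinfty ?lee_fin// ltey_eq Pfin.
pose D : R := 8 ^+ 4 * 16 * K.
have D0 : 0 <= D by rewrite !mulr_ge0 ?exprn_ge0.
have g2P I : dyadic I `<=` (dyadic J : set R) ->
    ((sq (ip g2 (wav I)))%:E <= (D * (dlen R I / L) ^+ 2)%:E * P)%E.
  move=> IJ; have dI := dlen_gt0 R I; set d := dlen R I in dI *; set cI := dcenter R I.
  have cc : `|cI - c| <= L / 2 := dyadic_center IJ.
  have dL : d <= L by have [_ h1 h2] := dyadic_sub IJ; rewrite /d /L; lra.
  pose v x := if x \in ~` Q then wav I x else 0.
  have mv : cmeasurable v by apply: cmeas_if; [exact: measurableC|exact: meas_wav].
  have -> : ip g2 (wav I) = ip g2 v.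
    by apply: eq_cint => x _; rewrite /g2 /v; case: ifP => // _; rewrite !mul0r.
  (* Away from J the distances to the centres of I and J are comparable, which
     changes the weight of I into that of J with a gain. *)
  have far x : x \in ~` Q -> pois cI d x <= 8 * (d / L) ^+ 2 * pois c L x.
    rewrite in_setC symP -ltNge => xQ.
    have y1 : L ^+ 2 <= (x - c) ^+ 2.
      rewrite -[leRHS]real_normK ?num_real// lerXn2r ?nnegrE ?(ltW L0)//.
      exact: ltW.
    have y2 : (x - c) ^+ 2 <= 4 * (x - cI) ^+ 2.
      rewrite (_ : 4 * _ = (2 * `|x - cI|) ^+ 2); last by rewrite exprMn real_normK ?num_real//; ring.
      rewrite -[leLHS]real_normK ?num_real// lerXn2r ?nnegrE ?mulr_ge0//.
      have := ler_normD (x - cI) (cI - c); rewrite addrA subrK; lra.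
    have z1 : 0 < (x - cI) ^+ 2.
      have : 0 < L ^+ 2 by rewrite exprn_gt0.
      lra.
    have z2 : 0 < (x - c) ^+ 2.
      have : 0 < L ^+ 2 by rewrite exprn_gt0.
      lra.
    apply: (@le_trans _ _ (d ^+ 2 / (x - cI) ^+ 2)).
      have q0 : 0 < d ^+ 2 / (x - cI) ^+ 2 by rewrite divr_gt0// exprn_gt0.
      rewrite /pois -[leRHS]invrK lef_pV2 ?posrE ?ltr_pwDl ?sqr_ge0 ?invr_gt0//.
      rewrite invf_div exprMn exprVn; lra.
    apply: (@le_trans _ _ (4 * d ^+ 2 / (x - c) ^+ 2)).
      by rewrite ler_pdivrMr// mulrAC ler_pdivlMr//; have d2 := sqr_ge0 d; nra.
    have -> : 8 * (d / L) ^+ 2 * pois c L x = 8 * d ^+ 2 / (L ^+ 2 + (x - c) ^+ 2).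
      rewrite /pois; field; rewrite !gt_eqF//=.
      by rewrite addr_gt0// exprn_gt0.
    rewrite ler_pdivrMr// mulrAC ler_pdivlMr; last by rewrite addr_gt0// exprn_gt0.
    have d2 := sqr_ge0 d; nra.
  pose B := D * (d / L) ^+ 2.
  have := @weighted_cs R g2 v (pois c L) (fine P) B wg2.1 mv (meas_pois c L) (meas_poisV c L) (pois_gt0 c L).
  move=> /(_ _ _)[||_].
  - rewrite fineK//; apply: ge0_le_int.
    + apply: measurable_funM; first exact: meas_sq wg2.1.
      by apply: measurable_funX; exact: meas_pois.
    + exact: meas_sq_pois wg.1.
    + by move=> x; rewrite mulr_ge0 ?sq_ge0// sqr_ge0.
    + move=> x; rewrite /g2; case: ifP => _; last by rewrite sq0 mul0r (@sq_pois_ge0 _ g).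
      by rewrite ler_wpM2l ?sq_ge0// pois_exp.
  - have r0 : 0 <= d / L by rewrite divr_ge0 ?ltW.
    have r1 : d / L <= 1 by rewrite ler_pdivrMr// mul1r.
    apply: (@le_trans _ _ (8 ^+ 4 * (K / d) * (d / L) ^+ 8 * (16 * L))%:E).
      apply: (@int_le_pois _ _ _ c L) => //.
      + by rewrite !mulr_ge0 ?exprn_ge0 ?r0 ?invr_ge0 ?(ltW dI) ?(ltW L0).
      + apply: measurable_funM; first exact: meas_sq mv.
        under eq_fun do rewrite -exprVn.
        by apply: measurable_funX; exact: meas_poisV.
      + by move=> x; rewrite divr_ge0 ?sq_ge0 ?sqr_ge0.
      move=> x; rewrite /v; case: ifPn => [xQ|_]; last first.
        by rewrite sq0 mul0r !mulr_ge0 ?exprn_ge0 ?pois_ge0 ?r0 ?invr_ge0 ?(ltW dI) ?(ltW L0).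
      rewrite ler_pdivrMr ?exprn_gt0 ?pois_gt0//.
      apply: (le_trans (wav_le wdecay I x)); rewrite -/d -/cI.
      rewrite [leRHS](_ : _ = K / d * ((8 * (d / L) ^+ 2) ^+ 4 * pois c L x ^+ 3)); last by ring.
      rewrite ler_wpM2l ?divr_ge0 ?(ltW dI)//.
      apply: (@le_trans _ _ ((8 * (d / L) ^+ 2 * pois c L x) ^+ 4)).
        rewrite lerXn2r ?nnegrE ?pois_ge0// ?far//.
        by rewrite mulr_ge0 ?pois_ge0// mulr_ge0 ?sqr_ge0 ?ler0n.
      rewrite exprMn ler_wpM2l//; first by rewrite exprn_ge0// mulr_ge0// sqr_ge0.
      by rewrite exprSr ler_piMr ?exprn_ge0 ?pois_ge0// pois_le1.
    rewrite lee_fin /B /D.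
    rewrite [leLHS](_ : _ = 8 ^+ 4 * 16 * K * ((d / L) ^+ 2 * (d / L) ^+ 5)); last first.
      by field; rewrite !gt_eqF.
    rewrite ler_wpM2l ?mulr_ge0 ?exprn_ge0//.
    by rewrite ler_piMr ?exprn_ge0// exprn_ile1.
  - rewrite -lee_fin EFinM fineK//; rewrite muleC; exact.
set S := [set I | _].
apply: (@le_trans _ _ (\esum_(I in S) (2%:E * (sq (ip g1 (wav I)))%:E + 2%:E * (sq (ip g2 (wav I)))%:E))%E).
  by apply: le_esum => I _; rewrite E -!EFinM -EFinD lee_fin sqD_le.
rewrite esumD; try by move=> I _; rewrite mule_ge0// lee_fin sq_ge0.
rewrite !esumZ//; try by move=> I; rewrite lee_fin sq_ge0.
rewrite /poissonC -/D.
have -> : ((4 + 192 * D)%:E * P = 4%:E * P + (192 * D)%:E * P)%E.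
  by rewrite EFinD ge0_muleDl// lee_fin ?mulr_ge0 ?ler0n.
apply: leeD.
  rewrite (_ : 4%:E = (2%:E * 2%:E)%E); last by rewrite -EFinM; congr EFin; ring.
  rewrite -muleA lee_wpmul2l ?lee_fin//; apply: le_trans g1P.
  apply: (le_trans _ (bessel_esum (L2_wav mw K0 wdecay) (wav_orth worth) L1)).
  by apply: esum_sub => // I; rewrite lee_fin sq_ge0.
apply: (@le_trans _ _ (2%:E * ((2 * D * 48)%:E * P))%E); last first.
  by rewrite muleA -EFinM lee_wpmul2r// lee_fin; lra.
rewrite lee_wpmul2l ?lee_fin//.
pose t I := (dlen R I / L) ^+ 2 * pois c L (dcenter R I).
apply: (@le_trans _ _ (\esum_(I in S) ((2 * D * fine P)%:E * (t I)%:E))%E).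
  apply: le_esum => I IJ; apply: (le_trans (g2P I IJ)).
  rewrite -(fineK Pfin) -!EFinM lee_fin /t.
  have cc := dyadic_center IJ; rewrite -/c -/L in cc.
  have p1 : 1 <= 2 * pois c L (dcenter R I).
    rewrite /pois ler_pdivlMr ?ltr_pwDl ?sqr_ge0// mul1r.
    rewrite -[leRHS]/(1 + 1) lerD2l -real_normK ?num_real// exprn_ile1//.
    rewrite normrM [`|L^-1|]gtr0_norm ?invr_gt0// ler_pdivrMr// mul1r; lra.
  have X0 : 0 <= D * fine P * (dlen R I / L) ^+ 2.
    by rewrite mulr_ge0 ?exprn_ge0 ?divr_ge0 ?dlen_ge0 ?(ltW L0)// mulr_ge0// fine_ge0.
  have := ler_wpM2l X0 p1; lra.
rewrite esumZ; last 2 first.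
- by rewrite mulr_ge0 ?fine_ge0// mulr_ge0.
- move=> I; by rewrite lee_fin /t mulr_ge0 ?pois_ge0// exprn_ge0// divr_ge0 ?dlen_ge0//.
rewrite (_ : (2 * D * 48)%:E * P = (2 * D * fine P)%:E * 48%:E)%E; last first.
  by rewrite -{1}(fineK Pfin) -!EFinM; congr EFin; ring.
rewrite lee_wpmul2l ?lee_fin//; first by rewrite mulr_ge0 ?fine_ge0// mulr_ge0.
apply: le_trans (esum_small J.1 c); apply: esum_sub => [I|I IJ].
  by rewrite lee_fin mulr_ge0 ?pois_ge0// exprn_ge0// divr_ge0 ?dlen_ge0//.
by have [] := dyadic_sub IJ.
Qed.

End CoefBound.

(** * Completeness of weighted spaces *)

Section CauchySum.
Variable R : realType.

(** The cross term of the square is at most 2 sqrt (P Q al be) <= P be + Q al. *)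
Lemma sqD_AM (A x : R[i]) (P Q al be : R) : 0 <= P -> 0 <= Q -> 0 <= al -> 0 <= be ->
  sq A <= P * Q -> sq x <= al * be -> sq (A + x) <= (P + al) * (Q + be).
Proof.
move=> P0 Q0 a0 b0 AP xa.
pose r := complex.Re (A * x^*).
have r2 : r ^+ 2 <= (P * Q) * (al * be).
  apply: le_trans (ler_pM (sq_ge0 A) (sq_ge0 x) AP xa).
  by rewrite -(sq_conj x) -sqM /sq /r lerDl sqr_ge0.
have -> : sq (A + x) = sq A + sq x + 2 * r.
  by rewrite /r /sq; case: (A) (x) => a b [c d] /=; ring.
have k : `|2 * r| <= `|P * be + Q * al|.
  rewrite -ler_sqr ?nnegrE// !real_normK ?num_real//.
  have := sqr_ge0 (P * be - Q * al); lra.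
rewrite [leRHS]ger0_norm ?addr_ge0 ?mulr_ge0// in k.
have := ler_norm (2 * r); lra.
Qed.

(** Cauchy-Schwarz for finite sums, stated with majorants of the terms so that the
    factors need not be square roots. *)
Lemma sq_sum_le (T : Type) (s : seq T) (z : T -> R[i]) (al be : T -> R) :
  (forall i, 0 <= al i) -> (forall i, 0 <= be i) -> (forall i, sq (z i) <= al i * be i) ->
  sq (\sum_(i <- s) z i) <= (\sum_(i <- s) al i) * (\sum_(i <- s) be i).
Proof.
move=> a0 b0 zab; elim: s => [|i s IH]; first by rewrite !big_nil sq0 mul0r.
rewrite !big_cons addrC [_ + \sum_(j <- s) al j]addrC [_ + \sum_(j <- s) be j]addrC.
by apply: sqD_AM => //; apply: sumr_ge0.
Qed.

End CauchySum.

Lemma cauchy_seq_cvg (K : numFieldType) (V : completeNormedModType K) (u : nat -> V) :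
  (forall e : K, 0 < e -> exists N, forall n, (N <= n)%N -> `|u N - u n| < e) -> cvgn u.
Proof.
move=> h; apply/cauchy_cvgP/cauchy_exP => e e0.
have [N HN] := h e e0; exists (u N); exists N => // n Nn.
by rewrite -ball_normE; exact: HN.
Qed.

Section GeometricLimits.
Variable R : realType.

Lemma expr_half_lt (C e : R) : 0 < e -> exists N : nat, C / 2 ^+ N < e.
Proof.
move=> e0; pose N := Num.truncn (C / e); exists N.+1.
rewrite ltr_pdivrMr ?exprn_gt0// mulrC -ltr_pdivrMr//.
apply: (@lt_le_trans _ _ N.+1%:R); first exact: truncnS_gt.
by rewrite -natrX ler_nat; apply/ltnW/ltn_expl.
Qed.

Lemma le_half_zero (x C : R) : (forall n, x <= C / 2 ^+ n) -> x <= 0.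
Proof.
move=> h; rewrite leNgt; apply/negP => /(expr_half_lt C)[N]; rewrite ltNge => /negP; exact.
Qed.

Lemma le_half_le (x y C : R) : (forall n, x <= y + C / 2 ^+ n) -> x <= y.
Proof.
move=> h; rewrite -subr_le0; apply: (@le_half_zero _ C) => n.
by rewrite lerBlDl.
Qed.

Lemma geometric_cauchy (u : nat -> R) (B : R) :
  (forall n m, (n <= m)%N -> (u m - u n) ^+ 2 <= B / 2 ^+ n) -> cvgn u.
Proof.
move=> uB; apply: cauchy_seq_cvg => e e0.
have [N HN] := @expr_half_lt B (e ^+ 2) ltac:(by rewrite exprn_gt0).
exists N => n Nn; rewrite -ltr_sqr ?nnegrE ?(ltW e0)// real_normK ?num_real//.
by apply: le_lt_trans HN; rewrite -sqrrN opprB; exact: uB.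
Qed.

Lemma sq_cvg_le (u v : nat -> R) (a b c d B : R) : u @ \oo --> a -> v @ \oo --> b ->
  (forall m, (u m - c) ^+ 2 + (v m - d) ^+ 2 <= B) -> (a - c) ^+ 2 + (b - d) ^+ 2 <= B.
Proof.
move=> ua vb h.
have cv : (fun m => (u m - c) ^+ 2 + (v m - d) ^+ 2) @ \oo --> (a - c) ^+ 2 + (b - d) ^+ 2.
  rewrite !expr2; under eq_fun do rewrite !expr2.
  by apply: cvgD; apply: cvgM; apply: cvgB => //; exact: cvg_cst.
rewrite -(cvg_lim _ cv)//; apply: limr_le; first by apply/cvg_ex; eexists; exact: cv.
by apply: nearW => m; exact: h.
Qed.

Lemma geo_sum (n k : nat) :
  \sum_(n <= i < n + k) (2^-1 : R) ^+ i = 2 / 2 ^+ n - 2 / 2 ^+ (n + k).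
Proof.
elim: k => [|k IH]; first by rewrite addn0 big_geq// subrr.
rewrite addnS big_nat_recr/= ?leq_addr// IH exprVn exprS.
by field; rewrite !expf_neq0.
Qed.

End GeometricLimits.

Section RieszFischer.
Variable R : realType.
Local Notation leb := (@lebesgue_measure R).
Variables (g : nat -> R -> R[i]) (om : R -> R) (A : R).
Hypothesis mg : forall n, cmeasurable (g n).
Hypothesis mom : measurable_fun [set: R] om.
Hypothesis om0 : forall x, 0 < om x.
Hypothesis gA : forall n,
  (\int[leb]_x (sq (g n.+1 x - g n x) * om x)%:E <= (A / 4 ^+ n)%:E)%E.

Let dl n x := sq (g n.+1 x - g n x).
Let G (x : R) : \bar R := (\sum_(n <oo) (2 ^+ n * dl n x)%:E)%E.

Let dl0 n x : 0 <= dl n x. Proof. exact: sq_ge0. Qed.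

Let mdl n : measurable_fun [set: R] (dl n).
Proof. by apply: meas_sq; apply: cmeasB. Qed.

Let G0 x : (0 <= G x)%E.
Proof. by apply: nneseries_ge0 => n _ _; rewrite lee_fin mulr_ge0// exprn_ge0. Qed.

Let mG : measurable_fun [set: R] G.
Proof.
apply: ge0_emeasurable_sum => [n x _ _|n _]; first by rewrite lee_fin mulr_ge0// exprn_ge0.
by apply/measurable_EFinP; apply: measurable_funM.
Qed.

Let intG : (\int[leb]_x (G x * (om x)%:E) <= (2 * A)%:E)%E.
Proof.
have E x : (G x * (om x)%:E = \sum_(n <oo) (2 ^+ n * (dl n x * om x))%:E)%E.
  rewrite muleC /G -nneseriesZl//; last by move=> n _; rewrite lee_fin mulr_ge0// exprn_ge0.
  by apply: eq_eseriesr => n _; rewrite -EFinM; congr EFin; ring.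
under eq_integral do rewrite E.
rewrite integral_nneseries//; last 2 first.
- move=> n; apply/measurable_EFinP; apply: measurable_funM => //; exact: (measurable_funM (mdl n) mom).
- by move=> n x _; rewrite lee_fin mulr_ge0 ?exprn_ge0// mulr_ge0// ltW.
rewrite (_ : 2 * A = A / (1 - 2^-1)); last by field.
rewrite -series_geo ?invf_lt1 ?ltr1n//; apply: lee_nneseries => [n _ _|n _].
  by apply: integral_ge0 => x _; rewrite lee_fin mulr_ge0 ?exprn_ge0// mulr_ge0// ltW.
rewrite ge0_intZ ?exprn_ge0//; last 2 first.
- exact: measurable_funM.
- by move=> x; rewrite mulr_ge0// ltW.
apply: (@le_trans _ _ ((2 ^+ n)%:E * (A / 4 ^+ n)%:E)%E).
  by rewrite lee_wpmul2l ?lee_fin ?exprn_ge0//; exact: gA.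
rewrite -EFinM lee_fin le_eqVlt; apply/orP; left; apply/eqP.
rewrite (_ : 4 ^+ n = 2 ^+ n * 2 ^+ n :> R); last by rewrite -exprMn; congr (_ ^+ _); ring.
by rewrite exprVn; field; rewrite expf_neq0.
Qed.

Let E : set (measurableTypeR R) := [set x | G x < +oo]%E.

Let mE : measurable E.
Proof.
have := emeasurable_fun_infty_o (@measurableT _ R) mG +oo%E.
by rewrite setTI.
Qed.

Let aeE : {ae leb, forall x, E x}.
Proof.
have : leb.-integrable setT (fun x => G x * (om x)%:E)%E.
  apply/integrableP; split.
    by apply: emeasurable_funM => //; exact/measurable_EFinP.
  under eq_integral => x _ do rewrite gee0_abs ?mule_ge0 ?lee_fin ?(ltW (om0 x))//.
  by apply: (le_lt_trans intG); exact: ltry.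
move=> /integrable_ae -/(_ measurableT); apply: filterS => x /(_ I).
rewrite /E /=; have := G0 x; case: (G x) => [r||] //=.
  by rewrite ltry.
by move=> _; rewrite gt0_mulye ?lte_fin.
Qed.

Let telescope n m x : (n <= m)%N -> E x ->
  sq (g m x - g n x) <= 2 * fine (G x) / 2 ^+ n.
Proof.
move=> nm Ex.
have -> : g m x - g n x = \sum_(n <= i < m) (g i.+1 x - g i x).
  by rewrite telescope_sumr.
have Gx : (fine (G x))%:E = G x by rewrite fineK// ge0_fin_numE.
apply: (le_trans (@sq_sum_le _ _ _ _ (fun i => 2^-1 ^+ i) (fun i => 2 ^+ i * dl i x) _ _ _)).
- by move=> i; rewrite exprn_ge0 ?invr_ge0.
- by move=> i; rewrite mulr_ge0 ?exprn_ge0.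
- move=> i; rewrite mulrA exprVn mulVf ?mul1r// ?expf_neq0//.
rewrite -mulrA mulrC [leRHS](_ : _ = fine (G x) * (2 / 2 ^+ n)); last by ring.
apply: ler_pM.
- by apply: sumr_ge0 => i _; rewrite mulr_ge0 ?exprn_ge0.
- by apply: sumr_ge0 => i _; rewrite exprn_ge0 ?invr_ge0.
- rewrite -lee_fin Gx -sumEFin.
  apply: (@le_trans _ _ (\sum_(0 <= i < m) (2 ^+ i * dl i x)%:E)%E).
    rewrite [leRHS](@big_cat_nat _ _ _ n)//= leeDr//.
    by apply: sume_ge0 => i _; rewrite lee_fin mulr_ge0 ?exprn_ge0.
  by apply: nneseries_lim_ge => i _ _; rewrite lee_fin mulr_ge0 ?exprn_ge0.
- rewrite -(subnKC nm) geo_sum gerBl divr_ge0// exprn_ge0//.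
Qed.

Let lim_re x := limn (fun n => if x \in E then complex.Re (g n x) else 0).
Let lim_im x := limn (fun n => if x \in E then complex.Im (g n x) else 0).

Let cvg_re x : (fun n => if x \in E then complex.Re (g n x) else 0) @ \oo --> lim_re x.
Proof.
case: (boolP (x \in E)) => [xE|xE]; last first.
  by rewrite /lim_re (negbTE xE); rewrite lim_cst//; exact: cvg_cst.
have Ex : E x by rewrite inE in xE.
suff : cvgn (fun n => complex.Re (g n x)) by rewrite /lim_re xE.
apply: (@geometric_cauchy _ _ (2 * fine (G x))) => n m nm.
apply: le_trans (telescope nm Ex); rewrite /sq.
by case: (g m x) (g n x) => a b [c d] /=; rewrite lerDl sqr_ge0.
Qed.

Let cvg_im x : (fun n => if x \in E then complex.Im (g n x) else 0) @ \oo --> lim_im x.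
Proof.
case: (boolP (x \in E)) => [xE|xE]; last first.
  by rewrite /lim_im (negbTE xE); rewrite lim_cst//; exact: cvg_cst.
have Ex : E x by rewrite inE in xE.
suff : cvgn (fun n => complex.Im (g n x)) by rewrite /lim_im xE.
apply: (@geometric_cauchy _ _ (2 * fine (G x))) => n m nm.
apply: le_trans (telescope nm Ex); rewrite /sq.
by case: (g m x) (g n x) => a b [c d] /=; rewrite lerDr sqr_ge0.
Qed.

(** The series G of the squared differences weighted by 2^n is integrable against
    om, hence finite almost everywhere.  Where it is finite, Cauchy-Schwarz makes
    g n a Cauchy sequence, with a rate that survives integration. *)
Theorem riesz_fischer : exists2 h : R -> R[i], cmeasurable h &
  forall n, (\int[leb]_x (sq (h x - g n x) * om x)%:E <= (4 * A / 2 ^+ n)%:E)%E.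
Proof.
pose h x : R[i] := lim_re x +i* lim_im x.
have mif (f : R -> R) : measurable_fun [set: R] f -> measurable_fun [set: R] (fun x : R => if x \in E then f x else 0).
  move=> mf; have -> : (fun x => if x \in E then f x else 0) = (fun x => \1_E x * f x).
    by apply/funext => x; rewrite indicE; case: (x \in E); rewrite ?mul1r ?mul0r.
  by apply: measurable_funM => //; exact: measurable_indic.
have mh : cmeasurable h.
  split => /=.
  - apply: (measurable_fun_cvg (h := fun n x => if x \in E then complex.Re (g n x) else 0)).
      by move=> n; apply: mif; exact: (mg n).1.
    by move=> x _; exact: cvg_re.
  - apply: (measurable_fun_cvg (h := fun n x => if x \in E then complex.Im (g n x) else 0)).
      by move=> n; apply: mif; exact: (mg n).2.
    by move=> x _; exact: cvg_im.
exists h => // n.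
have bound x : E x -> sq (h x - g n x) <= 2 * fine (G x) / 2 ^+ n.
  move=> Ex; have xE : x \in E by rewrite inE.
  have hr := @cvg_re x; have hi := @cvg_im x; rewrite xE in hr hi.
  have -> : sq (h x - g n x) = (lim_re x - complex.Re (g n x)) ^+ 2 + (lim_im x - complex.Im (g n x)) ^+ 2.
    by rewrite /sq /h; case: (g n x).
  have hr' : (fun m => complex.Re (g (m + n)%N x)) @ \oo --> lim_re x.
    by move: hr; rewrite -(cvg_shiftn n).
  have hi' : (fun m => complex.Im (g (m + n)%N x)) @ \oo --> lim_im x.
    by move: hi; rewrite -(cvg_shiftn n).
  apply: (sq_cvg_le hr' hi') => m.
  have := telescope (leq_addl m n) Ex; rewrite /sq.
  by case: (g (m + n)%N x) (g n x) => a b [].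
have C0 : 0 <= 2 / 2 ^+ n :> R by rewrite divr_ge0// exprn_ge0.
apply: (@le_trans _ _ (\int[leb]_x ((2 / 2 ^+ n)%:E * (G x * (om x)%:E)))%E).
  apply: ae_ge0_le_integral => //.
  - by move=> x _; rewrite lee_fin mulr_ge0 ?sq_ge0// ltW.
  - apply/measurable_EFinP; apply: measurable_funM => //; apply: meas_sq; exact: cmeasB.
  - by move=> x _; rewrite mule_ge0 ?lee_fin// mule_ge0 ?lee_fin// ltW.
  - apply: emeasurable_funM; first exact: measurable_cst.
    by apply: emeasurable_funM => //; exact/measurable_EFinP.
  - apply: filterS aeE => x Ex _.
    have Gx : (fine (G x))%:E = G x by rewrite fineK// ge0_fin_numE.
    rewrite -Gx -!EFinM lee_fin mulrA ler_wpM2r ?(ltW (om0 x))//.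
    by apply: (le_trans (bound x Ex)); rewrite mulrAC.
rewrite ge0_integralZl_EFin//; last 2 first.
- by move=> x _; rewrite mule_ge0 ?lee_fin// ltW.
- by apply: emeasurable_funM => //; exact/measurable_EFinP.
apply: (@le_trans _ _ ((2 / 2 ^+ n)%:E * (2 * A)%:E)%E).
  by rewrite lee_wpmul2l ?lee_fin//; exact: intG.
by rewrite -EFinM lee_fin le_eqVlt; apply/orP; left; apply/eqP; ring.
Qed.

End RieszFischer.

(** * Wavelet coefficients of atoms *)

Section Atoms.
Variable R : realType.
Local Notation leb := (@lebesgue_measure R).
Variables (w : R -> R[i]) (K : R).
Hypothesis mw : cmeasurable w.
Hypothesis K0 : 0 < K.
Hypothesis wdecay : forall y, sq (w y) <= K / (1 + y ^+ 2) ^+ 4.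
Hypothesis wnear : forall y t, `|y - t| <= 1 ->
  sq (w y - w t) <= K * (y - t) ^+ 2 / (1 + t ^+ 2) ^+ 2.
Hypothesis worth : forall I J : int * int,
  cint setT (fun x => wavelet w I x * (wavelet w J x)^*) = (I == J)%:R.
Local Notation wav := (wavelet w).
Local Notation dlen := (dlen R).
Local Notation dcenter := (dcenter R).

(** The weight of I relative to an interval of length 2^j starting at p.  It grows
    quadratically with the distance, measured in units of the longer of the two
    intervals, and by a factor 6 per scale above 2^j.  That factor lies between
    the 4 that [scale_wt_summable] needs and the 8 that the cancellation of an
    atom provides in [atom_big]. *)
Definition scale_wt (j : int) (p : R) (I : int * int) : R :=
  if (I.1 <= j)%R then (pois p (2 ^ j) (dcenter I))^-1
  else 6 ^+ `|I.1 - j|%N / pois p (dlen I) (dcenter I).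

Variables (j : int) (p : R).
Local Notation om := (scale_wt j p).
Let L : R := 2 ^ j.

Let L0 : 0 < L. Proof. by rewrite exprz_gt0. Qed.

Lemma dlen_big I : (I.1 <= j)%R = false -> dlen I = L * 2 ^+ `|I.1 - j|%N.
Proof.
move=> /negbT; rewrite -ltNge => jI; rewrite /L /dlen exprnP gez0_abs ?subr_ge0 ?ltW//.
by rewrite -expfzDr//; congr (_ ^ _); ring.
Qed.

Lemma dlen_small I : (I.1 <= j)%R -> dlen I <= L.
Proof. by move=> h; rewrite /L /dlen ler_weXz2l// ler1n. Qed.

Lemma scale_wt_ge I : 1 + ((dcenter I - p) / L) ^+ 2 <= om I.
Proof.
rewrite /scale_wt; case: ifPn => h; first by rewrite /pois invrK.
rewrite /pois invrK (dlen_big (negbTE h)); set n := `|_|%N.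
have e6 : (2 ^+ n) ^+ 2 <= 6 ^+ n :> R.
  by rewrite -exprM mulnC exprM lerXn2r ?nnegrE ?exprn_ge0// expr2; lra.
have e1 : 1 <= 6 ^+ n :> R by rewrite exprn_ege1// ler1n.
rewrite (_ : (dcenter I - p) / L = 2 ^+ n * ((dcenter I - p) / (L * 2 ^+ n))); last first.
  by field; rewrite !gt_eqF.
set y := _ / _; have y0 := sqr_ge0 y; rewrite exprMn mulrDr mulr1.
by rewrite lerD// ler_wpM2r.
Qed.

Lemma scale_wt_ge1 I : 1 <= om I.
Proof. by apply: le_trans (scale_wt_ge I); rewrite lerDl sqr_ge0. Qed.

Lemma scale_wt_gt0 I : 0 < om I.
Proof. exact: lt_le_trans ltr01 (scale_wt_ge1 I). Qed.

Lemma esum_split (b : int * int -> R) (A B : R) : (forall I, 0 <= b I) ->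
  (\esum_(I in [set I : int * int | (I.1 <= j)%R]) (b I)%:E <= A%:E)%E ->
  (\esum_(I in [set I : int * int | (j < I.1)%R]) (b I)%:E <= B%:E)%E ->
  (\esum_(I in setT) (b I)%:E <= (A + B)%:E)%E.
Proof.
move=> b0 hA hB; rewrite (esumID [set I : int * int | (I.1 <= j)%R]); last first.
  by move=> I _; rewrite lee_fin.
rewrite setTI EFinD; apply: leeD => //; apply: le_trans hB; apply: esum_sub.
  by move=> I; rewrite lee_fin.
by move=> I [_ /=] /negP; rewrite -ltNge.
Qed.

Lemma scale_wt_summable : (\esum_(I in setT) ((dlen I / L) ^+ 2 / om I)%:E <= 120%:E)%E.
Proof.
rewrite (_ : 120 = 48 + 24 / (1 - 2 / 3)); last by field.
apply: esum_split => [I||].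
- by rewrite divr_ge0 ?sqr_ge0// ltW// scale_wt_gt0.
- apply: le_trans (esum_small j p); apply: le_esum => I /= h.
  by rewrite /scale_wt h invrK.
- apply: le_trans (esum_big j p _ _); last 2 first.
  + by rewrite divr_ge0.
  + by rewrite ltr_pdivrMr// mul1r ltr_nat.
  apply: le_esum => I /=; rewrite ltNge => /negbTE h.
  rewrite /scale_wt h invf_div (dlen_big h); set n := `|_|%N.
  rewrite lee_fin (_ : L * 2 ^+ n / L = 2 ^+ n); last by field; rewrite gt_eqF.
  have e6 : 6 ^+ n = 2 ^+ n * 3 ^+ n :> R by rewrite -exprMn; congr (_ ^+ _); ring.
  rewrite e6 exprMn exprVn le_eqVlt; apply/orP; left; apply/eqP.
  by field; rewrite !expf_neq0.
Qed.

Variable a : R -> R[i].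
Hypothesis La : L2f a.
Hypothesis supp : forall x, L < `|x - p| -> a x = 0.
Hypothesis mean_a : cint setT a = 0.

Let A := fine (int2 a).

Let A0 : 0 <= A. Proof. by rewrite fine_ge0// int2_ge0. Qed.

Let AE : int2 a = A%:E. Proof. exact: int2_fin. Qed.

(** Cauchy-Schwarz, where only the values of g on the support of a matter. *)
Lemma atom_cs (g : R -> R[i]) (B : R) : cmeasurable g -> 0 <= B ->
  (forall x, `|x - p| <= L -> sq (g x) <= B) ->
  sq (cint setT (fun x => a x * (g x)^*)) <= A * (32 * B * L).
Proof.
move=> mg B0 gB; have mS := meas_sym p L.
pose g' x := if x \in sym p L then g x else 0.
have mg' : cmeasurable g' by exact: cmeas_if.
have -> : cint setT (fun x => a x * (g x)^*) = ip a g'.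
  apply: eq_cint => x _; rewrite /g' symP; case: ifPn => //.
  by rewrite -ltNge => /supp ->; rewrite !mul0r.
have g2 : (int2 g' <= (32 * B * L)%:E)%E.
  rewrite (_ : 32 * B * L = 2 * B * (16 * L)); last by ring.
  apply: (@int_le_pois _ _ _ p L) => //; first by rewrite mulr_ge0.
  - exact: meas_sq.
  - by move=> x; exact: sq_ge0.
  move=> x; rewrite /g'; case: ifPn => [|_]; last by rewrite sq0 mulr_ge0 ?pois_ge0// mulr_ge0.
  rewrite symP => h; apply: (le_trans (gB x h)); rewrite mulrAC mulrC ler_peMr//.
  rewrite /pois ler_pdivlMr ?ltr_pwDl ?sqr_ge0// mul1r.
  rewrite -[leRHS]/(1 + 1) lerD2l -real_normK ?num_real// exprn_ile1//.
  by rewrite normrM [`|L^-1|]gtr0_norm ?invr_gt0// ler_pdivrMr// mul1r.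
apply: cauchy_schwarz => //; last by rewrite AE.
by split => //; apply: (le_lt_trans g2); exact: ltry.
Qed.

Let n81 : R := 3 ^+ 4.

Let n81K0 : 0 <= 32 * n81.
Proof. by apply: mulr_ge0 => //; exact: exprn_ge0. Qed.

(** Away from the support of the atom the wavelet is in its tail, and the fourth
    power of its decay leaves room for the weight and for the sum over I. *)
Lemma atom_far I : (I.1 <= j)%R -> 4 * L < `|dcenter I - p| ->
  om I * sq (ip a (wav I)) <= 32 * n81 * K * A * ((dlen I / L) ^+ 2 * pois p L (dcenter I)).
Proof.
move=> hI far; rewrite /scale_wt hI -/L; set pi := pois p L _.
set d := dlen I; set c := dcenter I in far pi *.
have d0 : 0 < d := dlen_gt0 R I.
have dL : d <= L := dlen_small hI.
have pi0 : 0 < pi := pois_gt0 _ _ _.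
pose q := 3 * (d / L) ^+ 2 * pi.
have q0 : 0 <= q by rewrite mulr_ge0 ?(ltW pi0)// mulr_ge0// sqr_ge0.
have B0 : 0 <= K / d * q ^+ 4 by rewrite mulr_ge0 ?exprn_ge0// divr_ge0// ltW.
have b x : `|x - p| <= L -> sq (wav I x) <= K / d * q ^+ 4.
  move=> xp; apply: (le_trans (wav_le wdecay I x)); rewrite -/d -/c.
  rewrite ler_wpM2l ?divr_ge0 ?(ltW K0) ?(ltW d0)//.
  rewrite lerXn2r ?nnegrE ?pois_ge0//.
  have z1 : 16 * L ^+ 2 <= (c - p) ^+ 2.
    rewrite -[leRHS]real_normK ?num_real//.
    by rewrite (_ : 16 * _ = (4 * L) ^+ 2); [rewrite lerXn2r ?nnegrE ?mulr_ge0 ?(ltW L0)// ltW|ring].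
  have z2 : 9 * (c - p) ^+ 2 <= 16 * (x - c) ^+ 2.
    have h : 3 * `|c - p| <= 4 * `|x - c|.
      have := ler_normD (c - x) (x - p); rewrite addrA subrK (distrC c x); lra.
    have : (3 * `|c - p|) ^+ 2 <= (4 * `|x - c|) ^+ 2.
      by rewrite lerXn2r ?nnegrE ?mulr_ge0.
    by rewrite !exprMn !real_normK ?num_real// !expr2; lra.
  have L2 : 0 < L ^+ 2 by rewrite exprn_gt0.
  have z3 : 0 < (c - p) ^+ 2 by lra.
  have z4 : 0 < (x - c) ^+ 2 by lra.
  have qE : q = 3 * d ^+ 2 / (L ^+ 2 + (c - p) ^+ 2).
    by rewrite /q /pi /pois; field; rewrite !gt_eqF ?addr_gt0.
  rewrite qE /pois.
  have q1 : 0 < d ^+ 2 / (x - c) ^+ 2 by rewrite divr_gt0// exprn_gt0.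
  apply: (@le_trans _ _ (d ^+ 2 / (x - c) ^+ 2)).
    rewrite -[leRHS]invrK lef_pV2 ?posrE ?ltr_pwDl ?sqr_ge0 ?invr_gt0//.
    rewrite invf_div exprMn exprVn; lra.
  rewrite ler_pdivrMr// mulrAC ler_pdivlMr ?addr_gt0//.
  have d2 := sqr_ge0 d; nra.
have := atom_cs (meas_wav mw I) B0 b; rewrite -/(ip a (wav I)) => h.
rewrite mulrC ler_pdivrMr//; apply: (le_trans h).
(* Of the four factors pi in q ^+ 4 one pays for the weight and one stays for the
   sum over I; the remaining powers of pi and of d / L are at most 1. *)
have -> : A * (32 * (K / d * q ^+ 4) * L) =
    32 * n81 * K * A * ((d / L) ^+ 2 * pi) * pi * ((d / L) ^+ 5 * pi ^+ 2).
  by rewrite /q /n81; field; rewrite !gt_eqF.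
rewrite ler_piMr//.
  apply: mulr_ge0 (ltW pi0); apply: mulr_ge0; last by rewrite mulr_ge0 ?sqr_ge0 ?(ltW pi0).
  exact: mulr_ge0 (mulr_ge0 n81K0 (ltW K0)) A0.
rewrite mulr_ile1 ?exprn_ge0 ?(ltW pi0) ?divr_ge0 ?(ltW d0) ?(ltW L0)//.
  by rewrite exprn_ile1 ?divr_ge0 ?(ltW d0) ?(ltW L0)// ler_pdivrMr// mul1r.
by rewrite exprn_ile1 ?(ltW pi0)// pois_le1.
Qed.

(** At distance at most 4 L the weight is at most 1 + 4^2. *)
Lemma atom_near I : (I.1 <= j)%R -> `|dcenter I - p| <= 4 * L ->
  om I * sq (ip a (wav I)) <= 17 * sq (ip a (wav I)).
Proof.
move=> hI near; rewrite ler_wpM2r ?sq_ge0// /scale_wt hI /pois invrK -/L.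
rewrite (_ : 17 = 1 + 4 ^+ 2); last by rewrite expr2; ring.
rewrite lerD2l -real_normK ?num_real// lerXn2r ?nnegrE//.
by rewrite normrM [`|L^-1|]gtr0_norm ?invr_gt0// ler_pdivrMr.
Qed.

(** A wavelet much longer than the support of a is nearly constant on it.  As a
    has mean zero the value at p can be subtracted from the wavelet, and the local
    Lipschitz bound yields an additional factor (L / |I|)^2. *)
Lemma atom_big I : (I.1 <= j)%R = false ->
  om I * sq (ip a (wav I)) <=
  32 * K * A * ((3 / 4) ^+ `|I.1 - j|%N * pois p (dlen I) (dcenter I)).
Proof.
move=> hI; rewrite /scale_wt hI; have dE := dlen_big hI.
set n := `|_|%N in dE *; set d := dlen I in dE *; set c := dcenter I.
set pi := pois p d c.
have d0 : 0 < d := dlen_gt0 R I.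
have pi0 : 0 < pi := pois_gt0 _ _ _.
have Ld : L <= d by rewrite dE ler_peMr ?(ltW L0)// exprn_ege1// ler1n.
pose B := K / d * (L / d) ^+ 2 * pi ^+ 2.
have B0 : 0 <= B by rewrite mulr_ge0 ?sqr_ge0// mulr_ge0 ?sqr_ge0// divr_ge0 ?ltW.
have b x : `|x - p| <= L -> sq (wav I x - wav I p) <= B.
  move=> xp; rewrite /wavelet -mulrBr sqM sqr exprVn sqr_sqrtr ?(ltW d0)//.
  set y := (x - _) / _; set t := (p - _) / _.
  have yt : y - t = (x - p) / d by rewrite /y /t -mulrBl; congr (_ / _); rewrite -/c; ring.
  have yt1 : `|y - t| <= L / d.
    by rewrite yt normrM [`|d^-1|]gtr0_norm ?invr_gt0// ler_wpM2r// invr_ge0 ltW.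
  have yt2 : `|y - t| <= 1 by rewrite (le_trans yt1)// ler_pdivrMr// mul1r.
  have piE : pi = (1 + t ^+ 2)^-1 by rewrite /pi /pois /t -/c -/d; congr (_^-1); congr (_ + _); field; rewrite gt_eqF.
  rewrite -/d /B piE exprVn mulrAC [K / d]mulrC -!mulrA ler_wpM2l ?invr_ge0 ?(ltW d0)//.
  apply: (le_trans (wnear yt2)); rewrite -mulrA ler_wpM2l ?(ltW K0)// mulrC.
  rewrite ler_wpM2l ?invr_ge0 ?exprn_ge0 ?addr_ge0 ?sqr_ge0//.
  by rewrite -real_normK ?num_real// lerXn2r ?nnegrE ?divr_ge0 ?(ltW L0) ?(ltW d0).
have mg : cmeasurable (fun x => wav I x - wav I p).
  by apply: cmeasB; [exact: meas_wav|exact: cmeas_cst].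
have := atom_cs mg B0 b.
have -> : cint setT (fun x => a x * (wav I x - wav I p)^*) = ip a (wav I).
  have ia : cintegrable setT a.
    have Ls : L2f (fun x => if x \in sym p L then 1 else 0 : R[i]).
      have mS := meas_sym p L.
      split; first by apply: cmeas_if => //; exact: cmeas_cst.
      apply: (@le_lt_trans _ _ (2 * (16 * L))%:E); last exact: ltry.
      apply: (@int_le_pois _ _ _ p L) => //.
      - by apply: meas_sq; apply: cmeas_if => //; exact: cmeas_cst.
      - by move=> x; exact: sq_ge0.
      move=> x; case: ifPn => [|_]; last by rewrite sq0 mulr_ge0 ?pois_ge0.
      rewrite symP (_ : sq (1 : R[i]) = 1); last by rewrite /sq /= expr0n addr0 expr1n.
      move=> h; rewrite /pois ler_pdivlMr ?ltr_pwDl ?sqr_ge0// mul1r.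
      rewrite -[leRHS]/(1 + 1) lerD2l -real_normK ?num_real// exprn_ile1//.
      by rewrite normrM [`|L^-1|]gtr0_norm ?invr_gt0// ler_pdivrMr// mul1r.
    have := ip_integrable La Ls; congr cintegrable; apply/funext => x.
    rewrite symP; case: ifPn => [_|]; first by rewrite conjC1 mulr1.
    by rewrite -ltNge => /supp ->; rewrite mul0r.
  have h := cintegrableZ (- (wav I p)^*) (@measurableT _ (measurableTypeR R)) ia.
  transitivity (cint setT (fun x => a x * (wav I x)^* + - (wav I p)^* * a x)).
    by apply: eq_cint => x _; rewrite rmorphB mulrBr mulNr [_ * a x]mulrC.
  rewrite cintD//; last exact: (ip_integrable La (L2_wav mw K0 wdecay I)).
  by rewrite cintZ// mean_a mulr0 addr0.
move=> h; apply: (@le_trans _ _ (6 ^+ n / pi * (A * (32 * B * L)))).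
  by rewrite ler_wpM2l// divr_ge0 ?exprn_ge0 ?(ltW pi0).
rewrite /B le_eqVlt; apply/orP; left; apply/eqP.
have e6 : 6 ^+ n = 2 ^+ n * 3 ^+ n :> R by rewrite -exprMn; congr (_ ^+ _); ring.
have e4 : 4 ^+ n = 2 ^+ n * 2 ^+ n :> R by rewrite -exprMn; congr (_ ^+ _); ring.
have e34 : (3 / 4) ^+ n = 3 ^+ n / (2 ^+ n * 2 ^+ n) :> R by rewrite exprMn exprVn e4.
rewrite dE e6 e34; field.
by rewrite !gt_eqF.
Qed.

(** 17 is the constant of [atom_near]; 48 and 96 are the sums given by
    [esum_small] and [esum_big]. *)
Definition atomC : R := (17 + 48 * (32 * n81 * K)) + 96 * (32 * K).

(** Bessel's inequality for short intervals near the support, where the weight is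
    bounded, and the pointwise bounds elsewhere. *)
Lemma atom_weighted :
  (\esum_(I in setT) (om I * sq (ip a (wav I)))%:E <= (atomC * A)%:E)%E.
Proof.
have n0 : 0 <= 32 * n81 * K by exact: mulr_ge0 n81K0 (ltW K0).
have n1 : 0 <= 32 * K by rewrite mulr_ge0 ?(ltW K0).
rewrite /atomC [_ * A]mulrDl; apply: esum_split => [I||].
- by rewrite mulr_ge0 ?sq_ge0// ltW// scale_wt_gt0.
- apply: (@le_trans _ _ (\esum_(I in [set I : int * int | (I.1 <= j)%R])
     (17%:E * (sq (ip a (wav I)))%:E + (32 * n81 * K * A)%:E * ((dlen I / L) ^+ 2 * pois p L (dcenter I))%:E))%E).
    apply: le_esum => I /= hI; rewrite -!EFinM -EFinD lee_fin.
    have [near|far] := leP `|dcenter I - p| (4 * L).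
      apply: (le_trans (atom_near hI near)); rewrite lerDl.
      by rewrite mulr_ge0 ?(mulr_ge0 n0 A0)// mulr_ge0 ?sqr_ge0 ?pois_ge0.
    apply: (le_trans (atom_far hI far)); rewrite lerDr.
    by rewrite mulr_ge0 ?sq_ge0.
  rewrite esumD; last 2 first.
  - by move=> I _; rewrite mule_ge0 ?lee_fin ?sq_ge0.
  - by move=> I _; rewrite -EFinM lee_fin mulr_ge0 ?(mulr_ge0 n0 A0)// mulr_ge0 ?sqr_ge0 ?pois_ge0.
  have -> : ((17 + 48 * (32 * n81 * K)) * A)%:E = ((17 * A)%:E + (48 * (32 * n81 * K) * A)%:E)%E.
    by rewrite -EFinD -mulrDl.
  apply: leeD.
    rewrite esumZ//; last by move=> I; rewrite lee_fin sq_ge0.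
    rewrite EFinM lee_wpmul2l ?lee_fin//.
    rewrite -AE; apply: (le_trans _ (bessel_esum (L2_wav mw K0 wdecay) (wav_orth worth) La)).
    by apply: esum_sub => // I; rewrite lee_fin sq_ge0.
  rewrite esumZ ?(mulr_ge0 n0 A0)//; last by move=> I; rewrite lee_fin mulr_ge0 ?sqr_ge0 ?pois_ge0.
  rewrite (_ : 48 * _ * A = (32 * n81 * K * A) * 48); last by ring.
  by rewrite [leRHS]EFinM lee_wpmul2l ?lee_fin ?(mulr_ge0 n0 A0)//; exact: esum_small.
- apply: (@le_trans _ _ (\esum_(I in [set I : int * int | (j < I.1)%R])
     ((32 * K * A)%:E * ((3 / 4) ^+ `|I.1 - j|%N * pois p (dlen I) (dcenter I))%:E))%E).
    by apply: le_esum => I /=; rewrite ltNge => /negbTE hI; rewrite -EFinM lee_fin; exact: atom_big.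
  rewrite esumZ ?(mulr_ge0 n1 A0)//; last first.
    by move=> I; rewrite lee_fin mulr_ge0 ?pois_ge0// exprn_ge0// divr_ge0.
  rewrite (_ : 96 * _ * A = (32 * K * A) * (24 / (1 - 3 / 4))); last by field.
  rewrite [leRHS]EFinM lee_wpmul2l ?lee_fin ?(mulr_ge0 n1 A0)//; apply: esum_big.
  + by rewrite divr_ge0.
  + by rewrite ltr_pdivrMr// mul1r ltr_nat.
Qed.

End Atoms.

(** * Synthesis in the weighted space *)

Section FiniteSums.
Variables (R : realType) (T : choiceType).

Lemma fin_le_esum (s : seq T) (a : T -> R) : uniq s -> (forall i, 0 <= a i) ->
  ((\sum_(i <- s) a i)%:E <= \esum_(i in setT) (a i)%:E)%E.
Proof.
move=> us a0; apply: ereal_sup_ubound; exists [set` s].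
  by split => //; exact: finite_seq.
by rewrite -fsbig_seq//= sumEFin.
Qed.

(** A convergent sum is exhausted by an increasing sequence of finite sets, with
    tails as small as desired. *)
Lemma esum_exhaust (a : T -> R) : (forall i, 0 <= a i) ->
  (\esum_(i in setT) (a i)%:E < +oo)%E ->
  exists S : nat -> seq T, [/\ forall n, uniq (S n),
    forall n, {subset S n <= S n.+1} &
    forall n s, uniq s -> {in s, forall i, i \notin S n} -> \sum_(i <- s) a i <= (4 ^+ n)^-1].
Proof.
move=> a0 fin; set X := (\esum_(i in _) _)%E in fin.
have X0 : (0 <= X)%E by apply: esum_ge0 => i _; rewrite lee_fin.
have Xfin : X \is a fin_num by rewrite ge0_fin_numE.
have pick n : exists s : seq T, uniq s /\ fine X - (4 ^+ n)^-1 <= \sum_(i <- s) a i.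
  have e0 : 0 < (4 ^+ n)^-1 :> R by rewrite invr_gt0 exprn_gt0.
  have [_ [Y [finY _] <-] h] := ub_ereal_sup_adherent e0 Xfin.
  have {}h : (X - (4 ^+ n)^-1%:E < \sum_(x \in Y) (a x)%:E)%E := h.
  exists (finmap.enum_fset (fset_set Y)); split; first exact: finmap.fset_uniq.
  move: h; rewrite fsbig_finite// sumEFin -(fineK Xfin) -EFinB lte_fin => h.
  exact: ltW.
have [s0 s0P] := choice pick.
pose S := fix S n := if n is m.+1 then undup (S m ++ s0 n) else s0 0%N.
have uS n : uniq (S n) by case: n => [|n]; [exact: (s0P 0%N).1|exact: undup_uniq].
have sS n : {subset s0 n <= S n}.
  by case: n => [|n] i //= si; rewrite mem_undup mem_cat si orbT.
exists S; split => // [n i si|n s us sn].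
  by rewrite /= mem_undup mem_cat si.
have u2 : uniq (s0 n ++ s).
  rewrite cat_uniq us (s0P n).1 andbT /=; apply/hasPn => i si.
  by apply/negP => /sS; exact/negP/sn.
have := fin_le_esum u2 a0; rewrite -/X -(fineK Xfin) lee_fin big_cat /=.
have := (s0P n).2; lra.
Qed.

End FiniteSums.

Section Synthesis.
Variable R : realType.
Local Notation leb := (@lebesgue_measure R).
Variables (w : R -> R[i]) (K : R).
Hypothesis mw : cmeasurable w.
Hypothesis K0 : 0 < K.
Hypothesis wdecay : forall y, sq (w y) <= K / (1 + y ^+ 2) ^+ 4.
Hypothesis worth : forall I J : int * int,
  cint setT (fun x => wavelet w I x * (wavelet w J x)^*) = (I == J)%:R.
Local Notation wav := (wavelet w).
Local Notation dlen := (dlen R).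
Local Notation dcenter := (dcenter R).
Variables (j : int) (p : R).
Local Notation om := (scale_wt j p).
Let L : R := 2 ^ j.
Let L0 : 0 < L. Proof. by rewrite exprz_gt0. Qed.

Definition synthC : R := 2 + 240 * (16 * K).

Let moment (I : int * int) (x : R) : R[i] := ((x - dcenter I) / dlen I)%:C * wav I x.

Let mmoment I : cmeasurable (moment I).
Proof.
apply: cmeasM; last exact: meas_wav.
apply: cmeas_real; apply: measurable_funM => //.
by apply: measurable_funB => //; exact: measurable_id.
Qed.

Let int_moment I : (\int[leb]_x (sq (moment I x))%:E <= (16 * K)%:E)%E.
Proof.
have d0 := dlen_gt0 R I.
rewrite (_ : 16 * K = K / dlen I * (16 * dlen I)); last by field; rewrite gt_eqF.
apply: (@int_le_pois _ _ _ (dcenter I) (dlen I)) => //.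
- by rewrite divr_ge0 ?(ltW K0) ?(ltW d0).
- exact: meas_sq.
- by move=> x; exact: sq_ge0.
move=> x; rewrite /moment sqM sqr.
have pi0 := pois_gt0 (dcenter I) (dlen I) x.
have -> : ((x - dcenter I) / dlen I) ^+ 2 = (pois (dcenter I) (dlen I) x)^-1 - 1.
  by rewrite /pois invrK addrAC subrr add0r.
apply: (@le_trans _ _ ((pois (dcenter I) (dlen I) x)^-1 * sq (wav I x))).
  by rewrite ler_wpM2r ?sq_ge0// gerBl.
rewrite mulrC ler_pdivrMr//; apply: (le_trans (wav_le wdecay I x)).
rewrite -[leRHS]mulrA ler_wpM2l ?divr_ge0 ?(ltW K0) ?(ltW d0)// -expr2.
by apply: ler_wiXn2l; rewrite ?(ltW pi0) ?pois_le1.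
Qed.

(** Multiplication by (x - p) / L maps wav I to a combination of wav I and its
    first moment, with coefficients controlled by the weight; orthonormality
    deals with the first part and summability of the weights with the second. *)
Lemma synthesis_weighted (s : seq (int * int)) (b : int * int -> R[i]) : uniq s ->
  (\int[leb]_x (sq (\sum_(I <- s) b I * wav I x) * (pois p L x)^-1)%:E <=
   (synthC * \sum_(I <- s) om I * sq (b I))%:E)%E.
Proof.
move=> us; set W := \sum_(I <- s) om I * sq (b I).
have om0 I : 0 < om I := scale_wt_gt0 j p I.
have W0 : 0 <= W by apply: sumr_ge0 => I _; rewrite mulr_ge0 ?sq_ge0 ?(ltW (om0 I)).
pose r I := (dcenter I - p) / L.
pose S x := \sum_(I <- s) b I * wav I x.
pose S1 x := \sum_(I <- s) ((r I)%:C * b I) * wav I x.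
pose be I x := (dlen I / L) ^+ 2 / om I * sq (moment I x).
have be0 I x : 0 <= be I x by rewrite mulr_ge0 ?sq_ge0// divr_ge0 ?sqr_ge0// ltW.
have mbe I : measurable_fun [set: R] (be I) by apply: measurable_funM => //; exact: meas_sq.
have mS : cmeasurable S by apply: cmeas_sum => I; apply: cmeasZ; exact: meas_wav.
have mS1 : cmeasurable S1 by apply: cmeas_sum => I; apply: cmeasZ; exact: meas_wav.
have msum : measurable_fun [set: R] (fun x => \sum_(I <- s) be I x) by exact: measurable_sum.
have m1 : measurable_fun [set: R] (fun x => 2 * sq (S1 x)).
  by apply: measurable_funM => //; exact: meas_sq.
have m2 : measurable_fun [set: R] (fun x => 2 * W * \sum_(I <- s) be I x) by exact: measurable_funM.
have m12 := measurable_funD m1 m2.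
have sum0 x : 0 <= \sum_(I <- s) be I x by apply: sumr_ge0.
have pw x : sq (S x) * (pois p L x)^-1 <= sq (S x) + (2 * sq (S1 x) + 2 * W * \sum_(I <- s) be I x).
  rewrite /pois invrK mulrDr mulr1 lerD2l mulrC -sqr -sqM.
  have -> : ((x - p) / L)%:C * S x = S1 x + \sum_(I <- s) ((dlen I / L)%:C * b I) * moment I x.
    rewrite /S /S1 mulr_sumr -big_split /=; apply: eq_bigr => I _; rewrite /moment.
    have -> : ((x - p) / L)%:C = (r I)%:C + (dlen I / L)%:C * ((x - dcenter I) / dlen I)%:C :> R[i].
      rewrite -rmorphM -rmorphD /=; congr (_%:C); rewrite /r.
      by have d0 := dlen_gt0 R I; field; rewrite !gt_eqF.
    ring.
  apply: (le_trans (sqD_le _ _)); rewrite lerD2l -mulrA ler_pM2l//.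
  apply: sq_sum_le => I //; first by rewrite mulr_ge0 ?sq_ge0 ?(ltW (om0 I)).
  rewrite /be !sqM sqr le_eqVlt; apply/orP; left; apply/eqP.
  by have o0 := om0 I; field; rewrite !gt_eqF.
apply: (@le_trans _ _ (\int[leb]_x (sq (S x) + (2 * sq (S1 x) + 2 * W * \sum_(I <- s) be I x))%:E)%E).
  apply: ge0_le_int => //.
  - apply: measurable_funM; first exact: meas_sq.
    exact: meas_poisV.
  - by apply: measurable_funD => //; exact: meas_sq.
  - by move=> x; rewrite mulr_ge0 ?sq_ge0// invr_ge0 pois_ge0.
have W20 : 0 <= 2 * W by rewrite mulr_ge0.
have i1 : (\int[leb]_x (sq (S x))%:E = (\sum_(I <- s) sq (b I))%:E)%E.
  exact: (int2_comb (L2_wav mw K0 wdecay) (wav_orth worth)).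
have i2 : (\int[leb]_x (sq (S1 x))%:E = (\sum_(I <- s) sq ((r I)%:C * b I))%:E)%E.
  exact: (int2_comb (L2_wav mw K0 wdecay) (wav_orth worth)).
have i3 : (\int[leb]_x (\sum_(I <- s) be I x)%:E <= (120 * (16 * K))%:E)%E.
  under eq_integral do rewrite -sumEFin.
  rewrite ge0_integral_sum//; last 2 first.
  - move=> I; apply/measurable_EFinP; exact: mbe.
  - by move=> I x _; rewrite lee_fin be0.
  apply: (@le_trans _ _ ((\sum_(I <- s) (dlen I / L) ^+ 2 / om I * (16 * K))%:E)).
    rewrite -sumEFin; apply: lee_sum => I _.
    have c0 : 0 <= (dlen I / L) ^+ 2 / om I by rewrite divr_ge0 ?sqr_ge0// ltW.
    rewrite /be ge0_intZ//; last 2 first.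
    - exact: meas_sq.
    - by move=> x; exact: sq_ge0.
    by rewrite [leRHS]EFinM lee_wpmul2l ?lee_fin//; exact: int_moment.
  rewrite -mulr_suml lee_fin ler_wpM2r ?mulr_ge0 ?(ltW K0)//.
  rewrite -lee_fin; apply: le_trans (scale_wt_summable j p).
  by apply: fin_le_esum => // I; rewrite divr_ge0 ?sqr_ge0// ltW.
rewrite (ge0_intD (meas_sq mS) m12); last 2 first.
- by move=> x; exact: sq_ge0.
- by move=> x; rewrite addr_ge0 ?mulr_ge0 ?sq_ge0.
rewrite (ge0_intD m1 m2); last 2 first.
- by move=> x; rewrite mulr_ge0 ?sq_ge0.
- by move=> x; rewrite mulr_ge0.
rewrite ge0_intZ//; last 2 first.
- exact: meas_sq.
- by move=> x; exact: sq_ge0.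
rewrite ge0_intZ// i1 i2.
apply: (@le_trans _ _ ((\sum_(I <- s) sq (b I))%:E + (2%:E * (\sum_(I <- s) sq ((r I)%:C * b I))%:E +
   (2 * W)%:E * (120 * (16 * K))%:E))%E).
  by rewrite leeD2l// leeD2l// lee_wpmul2l ?lee_fin.
rewrite -!EFinM -!EFinD lee_fin.
have h : \sum_(I <- s) sq (b I) + \sum_(I <- s) sq ((r I)%:C * b I) <= W.
  rewrite -big_split /=; apply: ler_sum => I _; rewrite sqM sqr -[X in X + _]mul1r -mulrDl.
  by rewrite ler_wpM2r ?sq_ge0//; exact: scale_wt_ge.
have h0 : 0 <= \sum_(I <- s) sq (b I) by apply: sumr_ge0 => I _; exact: sq_ge0.
rewrite /synthC; lra.
Qed.

End Synthesis.

(** * Duality between atoms and functions of the weighted space *)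

Section AlmostEverywhere.
Variable R : realType.
Local Notation leb := (@lebesgue_measure R).

Lemma ae_mono (P Q : R -> Prop) : (forall x, P x -> Q x) ->
  {ae leb, forall x, P x} -> {ae leb, forall x, Q x}.
Proof.
by move=> PQ; apply: (@filterS _ _ (ae_filter_ringOfSetsType (@lebesgue_measure R))).
Qed.

Lemma ae_and (P Q : R -> Prop) :
  {ae leb, forall x, P x} -> {ae leb, forall x, Q x} -> {ae leb, forall x, P x /\ Q x}.
Proof. exact: (@filterI _ _ (ae_filter_ringOfSetsType (@lebesgue_measure R))). Qed.

Lemma ae_all (P : nat -> R -> Prop) :
  (forall n, {ae leb, forall x, P n x}) -> {ae leb, forall x, forall n, P n x}.
Proof. exact: ae_foralln. Qed.
End AlmostEverywhere.

Section Duality.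
Variable R : realType.
Local Notation leb := (@lebesgue_measure R).
Variables (w : R -> R[i]) (K : R).
Hypothesis mw : cmeasurable w.
Hypothesis K0 : 0 < K.
Hypothesis wdecay : forall y, sq (w y) <= K / (1 + y ^+ 2) ^+ 4.
Hypothesis wnear : forall y t, `|y - t| <= 1 ->
  sq (w y - w t) <= K * (y - t) ^+ 2 / (1 + t ^+ 2) ^+ 2.
Hypothesis wwav : complete_orthonormal_wavelets w.
Local Notation wav := (wavelet w).
Local Notation dlen := (dlen R).
Local Notation dcenter := (dcenter R).
Variables (j : int) (p : R).
Local Notation om := (scale_wt j p).
Let L : R := 2 ^ j.
Let L0 : 0 < L. Proof. by rewrite exprz_gt0. Qed.
Let worth := wwav.1.
Let Lw := L2_wav mw K0 wdecay.
Let ow := wav_orth worth.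
Let K_ge0 : 0 <= K. Proof. exact: ltW. Qed.

Variable a : R -> R[i].
Hypothesis La : L2f a.
Hypothesis supp : forall x, L < `|x - p| -> a x = 0.
Hypothesis mean_a : cint setT a = 0.

Let A := fine (int2 a).
Let A0 : 0 <= A. Proof. by rewrite fine_ge0// int2_ge0. Qed.
Let c I := ip a (wav I).
Let W := atomC K * A.

Let om0 I : 0 < om I := scale_wt_gt0 j p I.
Let t0 I : 0 <= om I * sq (c I). Proof. by rewrite mulr_ge0 ?sq_ge0 ?(ltW (om0 I)). Qed.

Let fin_le s : uniq s -> \sum_(I <- s) om I * sq (c I) <= W.
Proof.
move=> us; rewrite -lee_fin.
exact: (le_trans (fin_le_esum us t0) (atom_weighted mw K0 wdecay wnear worth La supp mean_a)).
Qed.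

Let CT := synthC K.
Let CT0 : 0 <= CT.
Proof. by rewrite /CT /synthC addr_ge0 ?mulr_ge0 ?ler0n. Qed.

(** Along an exhaustion of the coefficients the partial sums are Cauchy in the
    weighted space, by [synthesis_weighted].  Their limit has the coefficients of
    a, so it is a because the system is complete.  Convergence in this space,
    rather than in L_2, is what allows pairing with f. *)
Lemma atom_expansion : exists S : nat -> seq (int * int),
  (forall n, uniq (S n)) /\
  forall n, (\int[leb]_x (sq (a x - \sum_(I <- S n) c I * wav I x) * (pois p L x)^-1)%:E
     <= (4 * CT / 2 ^+ n)%:E)%E.
Proof.
have [S [uS sS tS]] := esum_exhaust t0 (le_lt_trans
  (atom_weighted mw K0 wdecay wnear worth La supp mean_a) (ltry _)).
exists S; split => //.
pose g n x := \sum_(I <- S n) c I * wav I x.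
have Lg n : L2f (g n) by apply: L2_sum => I; exact: L2Z.
have mg n : cmeasurable (g n) := (Lg n).1.
have mV := meas_poisV p L.
have V0 x : 0 < (pois p L x)^-1 by rewrite invr_gt0 pois_gt0.
have step n : (\int[leb]_x (sq (g n.+1 x - g n x) * (pois p L x)^-1)%:E <= (CT / 4 ^+ n)%:E)%E.
  pose s := [seq I <- S n.+1 | I \notin S n].
  have us : uniq s by exact: filter_uniq.
  have E x : g n.+1 x - g n x = \sum_(I <- s) c I * wav I x.
    rewrite /g /s big_filter (bigID (fun I => I \in S n))/= addrAC -[RHS]add0r; congr (_ + _).
    apply/eqP; rewrite subr_eq0; apply/eqP; rewrite -big_filter; apply: perm_big.
    apply: uniq_perm => //; first exact: filter_uniq.
    move=> I; rewrite mem_filter; case: (boolP (I \in S n)) => //= si.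
    exact: sS.
  under eq_integral do rewrite E.
  apply: (le_trans (synthesis_weighted mw K0 wdecay worth j p c us)).
  rewrite lee_fin ler_wpM2l//; apply: tS => // I.
  by rewrite mem_filter => /andP[].
have [h mh hg] := riesz_fischer mg mV V0 step.
have mhg n : cmeasurable (fun x => h x - g n x) by exact: cmeasB.
have int_hg n : (int2 (fun x => h x - g n x)%R <= (4 * CT / 2 ^+ n)%:E)%E.
  apply: le_trans (hg n); apply: ge0_le_int.
  - exact: meas_sq (mhg n).
  - by apply: measurable_funM => //; exact: meas_sq (mhg n).
  - by move=> x; exact: sq_ge0.
  - by move=> x; rewrite ler_peMr ?sq_ge0// invf_ge1 ?pois_le1 ?pois_gt0.
have Lhg n : L2f (fun x => h x - g n x).
  by split => //; apply: le_lt_trans (int_hg n) _; exact: ltry.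
have Lh : L2f h.
  have -> : h = (fun x => (h x - g 0%N x) + g 0%N x) by apply/funext => x; rewrite subrK.
  exact: L2D.
have coef J : ip (fun x => h x - a x) (wav J) = 0.
  apply: sq_eq0; apply/eqP; rewrite eq_le sq_ge0 andbT.
  apply: (@le_half_zero _ _ (2 * (4 * CT * fine (int2 (wav J))) + 2)) => n.
  have -> : ip (fun x => h x - a x) (wav J) =
      ip (fun x => h x - g n x) (wav J) + (ip (g n) (wav J) - c J).
    by rewrite !ipBl// /c; ring.
  apply: (le_trans (sqD_le _ _)); rewrite [_ / 2 ^+ n]mulrDl; apply: lerD.
    rewrite -[leRHS]mulrA ler_pM2l//.
    have -> : 4 * CT * fine (int2 (wav J)) / 2 ^+ n = 4 * CT / 2 ^+ n * fine (int2 (wav J)) by ring.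
    by apply: cauchy_schwarz => //; rewrite -int2_fin.
  rewrite ler_pM2l//.
  have [JS|JS] := boolP (J \in S n).
    by rewrite (ip_comb Lw ow)// subrr sq0 invr_ge0 exprn_ge0.
  have -> : ip (g n) (wav J) = 0.
    rewrite ip_suml//; last by move=> I; exact: L2Z.
    rewrite big_seq big1// => I IS; rewrite ipZl// ow.
    by case: eqP IS JS => [->->//|_ _ _]; rewrite mulr0.
  rewrite sub0r sqN; apply: (@le_trans _ _ (om J * sq (c J))).
    by rewrite ler_peMl ?sq_ge0//; exact: scale_wt_ge1.
  have := tS n [:: J] isT; rewrite big_seq1 => /(_ _)/le_trans; apply.
    by move=> I; rewrite inE => /eqP ->.
  rewrite lef_pV2 ?posrE ?exprn_gt0// lerXn2r ?nnegrE// ler_nat//.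
have ae0 : {ae leb, forall x, h x - a x = 0}.
  by apply: wwav.2 => //; apply/in_L2P; exact: L2B.
move=> n; apply: le_trans (hg n); rewrite le_eqVlt; apply/orP; left; apply/eqP.
apply: ae_eq_integral => //.
- apply/measurable_EFinP; apply: measurable_funM => //; apply: meas_sq.
  exact: cmeasB La.1 (Lg n).1.
- by apply/measurable_EFinP; apply: measurable_funM => //; exact: meas_sq (mhg n).
- apply: (ae_mono _ ae0) => x /eqP; rewrite subr_eq0 => /eqP -> _.
  by [].
Qed.

Lemma conj_flip (u v : R -> R[i]) : cintegrable setT (fun x => v x * (u x)^*) ->
  cintegrable setT (fun x => u x * (v x)^*) /\ ip u v = (ip v u)^*.
Proof.
move=> iv; have E : (fun x => u x * (v x)^*) = (fun x => conjc (v x * (u x)^*)).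
  apply/funext => x; case: (u x) (v x) => a1 b1 [a2 b2].
  by apply/eqP; rewrite eq_complex /=; apply/andP; split; apply/eqP; ring.
rewrite /ip E; split; first exact: cintegrable_conj.
exact: cint_conj.
Qed.

(** The partial sums of a pair with f through the coefficients of both, and
    Cauchy-Schwarz with the weight applies; the remainder is small in the dual of
    the weighted space. *)
Theorem atom_duality f (F : R) : wL2 f ->
  (\esum_(I in setT) ((om I)^-1 * sq (ip f (wav I)))%:E <= F%:E)%E ->
  sq (ip a f) <= 2 * (W * F).
Proof.
move=> wf fF; have [S [uS hS]] := atom_expansion.
pose g n x := \sum_(I <- S n) c I * wav I x.
have Lg n : L2f (g n) by apply: L2_sum => I; exact: L2Z.
have mV := meas_poisV p L.
pose P := fine (\int[leb]_x (sq (f x) * pois p L x)%:E)%E.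
have PE : (\int[leb]_x (sq (f x) * pois p L x)%:E = P%:E)%E.
  rewrite fineK// ge0_fin_numE ?(wL2_pois p L0 wf)//.
  by apply: integral_ge0 => x _; rewrite lee_fin sq_pois_ge0.
pose q x := Num.sqrt (pois p L x)^-1.
have q0 x : 0 < q x by rewrite sqrtr_gt0 invr_gt0 pois_gt0.
have msqrt : measurable_fun [set: R] (@Num.sqrt R).
  by apply: continuous_measurable_fun; exact: sqrt_continuous.
have mq : measurable_fun [set: R] q by exact: (measurableT_comp msqrt mV).
have qV x : (q x)^-1 = Num.sqrt (pois p L x).
  have h0 : 0 <= (pois p L x)^-1 by rewrite invr_ge0 pois_ge0.
  by rewrite /q -sqrtrV// invrK.
have mqV : measurable_fun [set: R] (fun x => (q x)^-1).
  have -> : (fun x => (q x)^-1) = (fun x => Num.sqrt (pois p L x)) by apply/funext.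
  exact: (measurableT_comp msqrt (meas_pois p L)).
have q2 x : q x ^+ 2 = (pois p L x)^-1.
  by rewrite sqr_sqrtr// invr_ge0 pois_ge0.
have rest n := @weighted_cs R (fun x => a x - g n x) f q (4 * CT / 2 ^+ n) P
  (cmeasB La.1 (Lg n).1) wf.1 mq mqV q0.
have {}rest n : cintegrable setT (fun x => (a x - g n x) * (f x)^*) /\
    sq (ip (fun x => a x - g n x) f) <= 4 * CT / 2 ^+ n * P.
  apply: rest; first by under eq_integral do rewrite q2; exact: hS.
  by under eq_integral do rewrite q2 invrK; rewrite PE.
have wavf I : cintegrable setT (fun x => wav I x * (f x)^*) /\ ip (wav I) f = Num.conj (ip f (wav I)).
  by apply: conj_flip; exact: (wL2_wav_integrable mw K0 wdecay).
have comb s : cintegrable setT (fun x => (\sum_(I <- s) c I * wav I x) * (f x)^*) /\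
    ip (fun x => \sum_(I <- s) c I * wav I x) f = \sum_(I <- s) c I * (ip f (wav I))^*.
  elim: s => [|I s [IH1 IH2]].
    split; last by rewrite big_nil -[RHS](ip0l f); apply: eq_cint => x _; rewrite big_nil.
    rewrite (_ : (fun x => _) = fun=> 0); first exact: cintegrable0.
    by apply/funext => x; rewrite big_nil mul0r.
  have E : (fun x => (\sum_(J <- I :: s) c J * wav J x) * (f x)^*) =
      (fun x => c I * (wav I x * (f x)^*) + (\sum_(J <- s) c J * wav J x) * (f x)^*).
    by apply/funext => x; rewrite big_cons mulrDl -mulrA.
  have [i1 i2] := wavf I; have iZ := cintegrableZ (c I) (@measurableT _ (measurableTypeR R)) i1.
  rewrite /ip E; split; first exact: cintegrableD.
  by rewrite cintD// cintZ// big_cons -IH2 -i2.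
apply: (@le_half_le _ _ _ (2 * (4 * CT * P))) => n.
have [i1 i2] := comb (S n).
have -> : ip a f = ip (g n) f + ip (fun x => a x - g n x) f.
  rewrite /ip -cintD//; last exact: (rest n).1.
  by apply: eq_cint => x _; rewrite -mulrDl addrC subrK.
apply: (le_trans (sqD_le _ _)); apply: lerD; last first.
  rewrite -mulrA ler_pM2l//; apply: (le_trans (rest n).2).
  by rewrite le_eqVlt; apply/orP; left; apply/eqP; ring.
rewrite ler_pM2l// i2.
apply: (le_trans (@sq_sum_le _ _ _ _ (fun I => om I * sq (c I)) (fun I => (om I)^-1 * sq (ip f (wav I))) _ _ _)).
- exact: t0.
- by move=> I; rewrite mulr_ge0 ?sq_ge0// invr_ge0 ltW.
- move=> I; rewrite sqM [sq (Num.conj _)](sq_conj (ip f (wav I))) le_eqVlt; apply/orP; left; apply/eqP.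
  by have := om0 I => o; field; rewrite gt_eqF.
apply: ler_pM.
- by apply: sumr_ge0 => I _; exact: t0.
- by apply: sumr_ge0 => I _; rewrite mulr_ge0 ?sq_ge0// invr_ge0 ltW.
- exact: fin_le.
- rewrite -lee_fin; apply: le_trans fF; apply: fin_le_esum => // I.
  by rewrite mulr_ge0 ?sq_ge0// invr_ge0 ltW.
Qed.

End Duality.

(** * Oscillation bounded by wavelet coefficients *)

Section Oscillation.
Variable R : realType.
Local Notation leb := (@lebesgue_measure R).
Variables (w : R -> R[i]) (K : R).
Hypothesis mw : cmeasurable w.
Hypothesis K0 : 0 < K.
Hypothesis wdecay : forall y, sq (w y) <= K / (1 + y ^+ 2) ^+ 4.
Hypothesis wnear : forall y t, `|y - t| <= 1 ->
  sq (w y - w t) <= K * (y - t) ^+ 2 / (1 + t ^+ 2) ^+ 2.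
Hypothesis wwav : complete_orthonormal_wavelets w.
Local Notation wav := (wavelet w).

Lemma atomC_gt0 : 0 < atomC K.
Proof. by rewrite /atomC !addr_gt0 ?mulr_gt0 ?ltr0n// exprn_gt0. Qed.

(** The function a = (f - m) 1_[u, v] is an atom with <a, f> = |a|^2, so that
    [atom_duality] reads |a|^4 <= C |a|^2 X, with X the weighted sum of the
    coefficients of f. *)
Theorem osc_le_coef f (u v : R) (j : int) (m : R[i]) : wL2 f -> u < v -> v - u <= 2 ^ j ->
  m = cint `[u, v]%classic (fun x => f x * ((v - u)^-1)%:C) ->
  (\int[leb]_(x in `[u, v]%classic) (sq (f x - m))%:E <=
   (2 * atomC K)%:E * \esum_(I in setT) ((scale_wt j u I)^-1 * sq (ip f (wav I)))%:E)%E.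
Proof.
move=> wf uv vj m_def; set L : R := 2 ^ j in vj.
have L0 : 0 < L by rewrite exprz_gt0.
pose D : set (measurableTypeR R) := `[u, v]%classic.
have mD : measurable D by exact: measurable_itv.
have DP x : (x \in D) = (u <= x <= v) by rewrite mem_setE in_itv.
have Dpois x : x \in D -> 1 <= 2 * pois u L x.
  rewrite DP => /andP[ux xv]; rewrite /pois ler_pdivlMr ?ltr_pwDl ?sqr_ge0// mul1r.
  rewrite -[leRHS]/(1 + 1) lerD2l exprn_ile1 ?divr_ge0 ?subr_ge0 ?(ltW L0)//.
  by rewrite ler_pdivrMr// mul1r; lra.
have L2D g : wL2 g -> L2f (fun x => if x \in D then g x else 0).
  move=> wg; have mg : cmeasurable (fun x => if x \in D then g x else 0) by apply: cmeas_if => //; exact: wg.1.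
  split => //; apply: (@le_lt_trans _ _ (\int[leb]_x (2 * (sq (g x) * pois u L x))%:E)%E).
    apply: ge0_le_int.
    - exact: meas_sq.
    - by apply: measurable_funM => //; exact: meas_sq_pois wg.1.
    - by move=> x; exact: sq_ge0.
    - move=> x; case: ifPn => [/Dpois h|_]; last by rewrite sq0 mulr_ge0// sq_pois_ge0.
      by rewrite mulrCA ler_peMr ?sq_ge0.
  rewrite ge0_intZ//; last 2 first.
  - exact: meas_sq_pois wg.1.
  - by move=> x; exact: sq_pois_ge0.
  by rewrite lte_mul_pinfty ?lee_fin// wL2_pois.
pose fD x := if x \in D then f x else 0.
pose eD x : R[i] := if x \in D then 1 else 0.
have LeD : L2f eD by exact: (L2D (fun=> 1) (wL2_cst 1)).
have int_of g : wL2 g -> cintegrable setT (fun x => if x \in D then g x else 0).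
  move=> wg; have := ip_integrable (L2D _ wg) LeD; congr cintegrable; apply/funext => x.
  by rewrite /eD; case: ifP => _; rewrite ?conjC1 ?mulr1// mul0r.
have ifD := int_of _ wf.
have ieD : cintegrable setT eD by exact: (int_of (fun=> 1) (wL2_cst 1)).
have vu : v - u != 0 by rewrite gt_eqF// subr_gt0.
have ceD : cint setT eD = (v - u)%:C.
  rewrite /eD -(cint_mkcond D (fun=> 1)) /cint /= !Rintegral_cst// mul0r mul1r.
  rewrite /D /= lebesgue_measure_itv/= lte_fin uv -EFinB /=.
  by [].
have mE : m = ((v - u)^-1)%:C * cint setT fD.
  rewrite m_def (cint_mkcond D) -cintZ//; apply: eq_cint => x _.
  by rewrite /fD; case: ifP => _; rewrite ?mulr0// mulrC.
pose a x := if x \in D then f x - m else 0.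
have wfm : wL2 (fun x => f x - m) by apply: wL2_B => //; exact: wL2_cst.
have La : L2f a by exact: L2D.
have aE x : a x = fD x + - m * eD x.
  by rewrite /a /fD /eD; case: ifP => _; rewrite ?mulr1// mulr0 addr0.
have mean_a : cint setT a = 0.
  rewrite (eq_cint (g := fun x => fD x + - m * eD x)); last by move=> x _.
  rewrite cintD//; last exact: cintegrableZ.
  rewrite cintZ// ceD mE mulNr mulrAC -rmorphM /= mulVf//.
  by rewrite mul1r subrr.
have supp x : L < `|x - u| -> a x = 0.
  rewrite /a DP; case: ifPn => // /andP[ux xv]; rewrite ger0_norm ?subr_ge0// => h.
  exfalso; lra.
pose A := fine (int2 a).
have A0 : 0 <= A by rewrite fine_ge0// int2_ge0.
have -> : (\int[leb]_(x in `[u, v]%classic) (sq (f x - m))%:E = A%:E)%E.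
  rewrite -[RHS](int2_fin La) int_restrict; apply: eq_integral => x _; congr EFin.
  by rewrite indicE /a; case: (x \in D); rewrite ?mul1r// mul0r sq0.
set X := (\esum_(I in _) _)%E.
have X0 : (0 <= X)%E.
  by apply: esum_ge0 => I _; rewrite lee_fin mulr_ge0 ?sq_ge0// invr_ge0 ltW// scale_wt_gt0.
have C0 := atomC_gt0; have C20 : 0 < 2 * atomC K by rewrite mulr_gt0.
have [Xy|Xfin] := eqVneq X +oo%E.
  by rewrite Xy gt0_muley ?lte_fin// leey.
have XF : X = (fine X)%:E by rewrite fineK// ge0_fin_numE// ltey.
have F0 : 0 <= fine X by exact: fine_ge0.
have wdual := @atom_duality _ w K mw K0 wdecay wnear wwav j u a La supp mean_a f (fine X) wf.
have {wdual} : sq (ip a f) <= 2 * (atomC K * A * fine X) by apply: wdual; rewrite -XF.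
have -> : ip a f = A%:C.
  have ia2 := ip_integrable La La.
  have iaD := int_of _ wfm.
  rewrite -(ip_self La) -[RHS]addr0 /ip.
  have <- : cint setT (fun x => m^* * a x) = 0 by rewrite cintZ// mean_a mulr0.
  rewrite -cintD//; last exact: cintegrableZ.
  apply: eq_cint => x _; rewrite /a; case: ifP => _; last by rewrite !mul0r mulr0 addr0.
  by rewrite [m^* * _]mulrC -mulrDr -[X in _ + X^*]opprK; congr (_ * _); rewrite rmorphB /= opprK subrK.
rewrite sqr expr2 XF -EFinM lee_fin => h.
have [->|An] := eqVneq A 0; first by rewrite mulr_ge0 ?(ltW C20).
have Ap : 0 < A by rewrite lt_neqAle eq_sym An.
by rewrite -(ler_pM2r Ap) (le_trans h)// le_eqVlt; apply/orP; left; apply/eqP; ring.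
Qed.

End Oscillation.

(** * Riesz representation *)

Section HilbertSpace.
Variables (R : realType) (H : completeNormedModType R[i]).
Variable dot : {dot H for Num.conj}.
Hypothesis hdot : hilbert_norm dot.
Implicit Types (x y z h k : H) (c : R[i]) (t : R).

Lemma nrmE (V : normedZmodType R[i]) (v : V) : `|v| = (nrm v)%:C.
Proof.
rewrite /nrm; have := normr_ge0 v; rewrite lecE => /andP[/eqP /= h _].
by case: `|v| h => a b /= ->.
Qed.

Lemma nrm_ge0 (V : normedZmodType R[i]) (v : V) : 0 <= nrm v.
Proof. by have := normr_ge0 v; rewrite nrmE ler0c. Qed.

Lemma nrmD (V : normedZmodType R[i]) (u v : V) : nrm (u + v) <= nrm u + nrm v.
Proof. by have := ler_normD u v; rewrite !nrmE -rmorphD lecR. Qed.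

Lemma nrmN (V : normedZmodType R[i]) (v : V) : nrm (- v) = nrm v.
Proof. by rewrite /nrm normrN. Qed.

Lemma nrmB (V : normedZmodType R[i]) (u v : V) : nrm (u - v) = nrm (v - u).
Proof. by rewrite -nrmN opprB. Qed.

Lemma nrmZ c x : nrm (c *: x) = nrm c * nrm x.
Proof. by apply: (@complexI R); rewrite rmorphM /= -!nrmE normrZ. Qed.

Lemma nrm0_eq0 (V : normedZmodType R[i]) (v : V) : nrm v = 0 -> v = 0.
Proof. by move=> h; apply/eqP; rewrite -normr_eq0 nrmE h. Qed.

Lemma nrm0 (V : normedZmodType R[i]) : nrm (0 : V) = 0.
Proof. by rewrite /nrm normr0. Qed.

Lemma nrm2Z c x : nrm (c *: x) ^+ 2 = sq c * nrm x ^+ 2.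
Proof. by rewrite nrmZ exprMn nrm_sq. Qed.

Lemma dotDl x y z : dot (x + y) z = dot x z + dot y z.
Proof. by rewrite linearDl. Qed.

Lemma dotDr x y z : dot z (x + y) = dot z x + dot z y.
Proof. by rewrite linearDr. Qed.

Lemma dotZl c x z : dot (c *: x) z = c * dot x z.
Proof. by rewrite linearZl_LR. Qed.

Lemma dotZr c x z : dot z (c *: x) = c^* * dot z x.
Proof. by rewrite linearZr_LR. Qed.

Lemma dotC x y : dot y x = (dot x y)^*.
Proof. by rewrite hermC expr0 mul1r. Qed.

Lemma dotNl x z : dot (- x) z = - dot x z.
Proof. by rewrite -scaleN1r dotZl mulN1r. Qed.

Lemma dotBl x y z : dot (x - y) z = dot x z - dot y z.
Proof. by rewrite dotDl dotNl. Qed.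

Lemma dot0l z : dot 0 z = 0.
Proof. by rewrite -(scale0r 0) dotZl mul0r. Qed.

Lemma dotxx x : dot x x = (nrm x ^+ 2)%:C.
Proof. by rewrite -hdot nrmE rmorphXn. Qed.

(** The underlying real inner product, for which norms and convexity are linear algebra over R. *)
Definition rdot x y : R := complex.Re (dot x y).

Lemma rdotDl x y z : rdot (x + y) z = rdot x z + rdot y z.
Proof. by rewrite /rdot dotDl; case: (dot x z) (dot y z) => a b []. Qed.

Lemma rdotC x y : rdot x y = rdot y x.
Proof. by rewrite /rdot dotC; case: (dot y x). Qed.

Lemma rdotDr x y z : rdot z (x + y) = rdot z x + rdot z y.
Proof. by rewrite rdotC rdotDl !(rdotC z). Qed.

Lemma rdotZl t x z : rdot (t%:C *: x) z = t * rdot x z.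
Proof. by rewrite /rdot dotZl; case: (dot x z) => a b /=; rewrite mul0r subr0. Qed.

Lemma rdotZr t x z : rdot z (t%:C *: x) = t * rdot z x.
Proof. by rewrite rdotC rdotZl rdotC. Qed.

Lemma rdotNl x z : rdot (- x) z = - rdot x z.
Proof. by rewrite /rdot dotNl; case: (dot x z). Qed.

Lemma rdotBl x y z : rdot (x - y) z = rdot x z - rdot y z.
Proof. by rewrite rdotDl rdotNl. Qed.

Lemma rdotBr x y z : rdot z (x - y) = rdot z x - rdot z y.
Proof. by rewrite rdotC rdotBl !(rdotC z). Qed.

Lemma rdotxx x : rdot x x = nrm x ^+ 2.
Proof. by rewrite /rdot dotxx. Qed.

Lemma Im_dot x y : complex.Im (dot x y) = rdot x ('i%C *: y).
Proof. by rewrite /rdot dotZr; case: (dot x y) => a b /=; ring. Qed.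

Lemma rdot_i x y : rdot ('i%C *: x) y = - rdot x ('i%C *: y).
Proof. by rewrite /rdot dotZl dotZr; case: (dot x y) => a b /=; ring. Qed.

Lemma rdot_inj x y : (forall k, rdot x k = rdot y k) -> x = y.
Proof.
move=> h; apply/eqP; rewrite -subr_eq0; apply/eqP; apply: nrm0_eq0.
apply/eqP; rewrite -sqrf_eq0; apply/eqP.
by rewrite -rdotxx rdotBl h subrr.
Qed.

Lemma dot_inj x y : (forall k, dot x k = dot y k) -> x = y.
Proof. by move=> h; apply: rdot_inj => k; rewrite /rdot h. Qed.

Lemma nrm2D x y : nrm (x + y) ^+ 2 = nrm x ^+ 2 + nrm y ^+ 2 + 2 * rdot x y.
Proof. by rewrite -!rdotxx rdotDl !rdotDr (rdotC y x); ring. Qed.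

Lemma nrm2B x y : nrm (x - y) ^+ 2 = nrm x ^+ 2 + nrm y ^+ 2 - 2 * rdot x y.
Proof. by rewrite -!rdotxx rdotBl !rdotBr (rdotC y x); ring. Qed.

Lemma parallelogram x y :
  nrm (x + y) ^+ 2 + nrm (x - y) ^+ 2 = 2 * nrm x ^+ 2 + 2 * nrm y ^+ 2.
Proof. by rewrite nrm2D nrm2B; ring. Qed.

Lemma nrm2D_le x y : nrm (x + y) ^+ 2 <= 2 * nrm x ^+ 2 + 2 * nrm y ^+ 2.
Proof. by rewrite -parallelogram lerDl sqr_ge0. Qed.

Lemma rdot0l x : rdot 0 x = 0.
Proof. by rewrite /rdot dot0l. Qed.

(** The discriminant, in the form in which each Cauchy-Schwarz inequality below
    uses it. *)
Lemma nonneg_quadratic (a b c : R) :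
  (forall s, 0 <= a * s ^+ 2 + 2 * b * s + c) -> 0 <= a -> b ^+ 2 <= a * c.
Proof.
move=> h; rewrite le_eqVlt => /predU1P[a0|a0].
  rewrite -a0 mul0r; have [->|bn] := eqVneq b 0; first by rewrite expr0n.
  have := h (- (c + 1) / (2 * b)); rewrite -a0 mul0r add0r (_ : 2 * b * _ + c = -1).
    by rewrite oppr_ge0 leNgt ltr01.
  by field.
have := h (- b / a); rewrite (_ : _ + c = c - b ^+ 2 / a).
  by rewrite subr_ge0 ler_pdivrMr// mulrC.
by field; rewrite gt_eqF.
Qed.

Lemma rdot_cs x y : rdot x y ^+ 2 <= nrm x ^+ 2 * nrm y ^+ 2.
Proof.
apply: nonneg_quadratic (sqr_ge0 _) => s.
rewrite (_ : _ + _ = nrm (s%:C *: x + y) ^+ 2) ?sqr_ge0//.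
by rewrite nrm2D nrm2Z sqr rdotZl; ring.
Qed.

Lemma rdot_le x y : `|rdot x y| <= nrm x * nrm y.
Proof.
rewrite -ler_sqr ?nnegrE ?mulr_ge0 ?nrm_ge0// real_normK ?num_real// exprMn.
exact: rdot_cs.
Qed.

(** Completeness with a rate that the limit keeps. *)
Lemma hilbert_cauchy (u : nat -> H) (e : nat -> R) :
  (forall N n, (N <= n)%N -> nrm (u N - u n) <= e N) ->
  (forall d, 0 < d -> exists N, e N < d) ->
  exists v, forall N, nrm (u N - v) <= e N.
Proof.
move=> ue e0; have : cvgn u.
  apply: cauchy_seq_cvg => d d0.
  have dE : d = (complex.Re d)%:C.
    by have := ltW d0; rewrite lecE => /andP[/eqP /= h _]; case: d h d0 => a b /= ->.
  have d1 : 0 < complex.Re d by move: d0; rewrite dE ltcR.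
  have [N HN] := e0 _ d1; exists N => n Nn.
  by rewrite nrmE dE ltcR; exact: le_lt_trans (ue _ _ Nn) HN.
move=> cu; exists (lim (u @ \oo)) => N; apply/ler_addgt0Pl => d d0.
have /cvgrPdist_lt/(_ d%:C) := cu; rewrite ltcR => /(_ d0)[n _ Hn].
have := Hn (maxn n N) (leq_maxl _ _); rewrite /= nrmE ltcR => k.
rewrite -(subrK (u (maxn n N)) (u N)) -addrA.
apply: le_trans (nrmD _ _) _; rewrite [leRHS]addrC lerD ?ue ?leq_maxr//.
by rewrite nrmB; exact: ltW.
Qed.

(** Minimize F v = |v|^2 - 2 rho v.  The parallelogram law makes a minimizing
    sequence converge; perturbing it in the direction k gives a quadratic
    polynomial bounded below, whose discriminant bounds rdot v k - rho k. *)
Lemma real_riesz (rho : H -> R) (C : R) : 0 <= C ->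
  (forall x y, rho (x + y) = rho x + rho y) ->
  (forall t x, rho (t%:C *: x) = t * rho x) ->
  (forall x, rho x ^+ 2 <= C * nrm x ^+ 2) ->
  exists v, forall k, rdot v k = rho k.
Proof.
move=> C0 rD rZ rC.
have e4 n : (2 ^+ n) ^+ 2 = 4 ^+ n :> R.
  by rewrite exprAC; congr (_ ^+ n); ring.
pose F v := nrm v ^+ 2 - 2 * rho v.
have Fge v : - C <= F v.
  have k : `|2 * rho v| <= `|nrm v ^+ 2 + C|.
    rewrite -ler_sqr ?nnegrE// !real_normK ?num_real//.
    have := rC v; have := sqr_ge0 (nrm v ^+ 2 - C); lra.
  rewrite [leRHS]ger0_norm ?addr_ge0 ?sqr_ge0// in k.
  have := ler_norm (2 * rho v); rewrite /F; lra.
have hasF : has_inf (range F).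
  by split; [exists (F 0), 0 | exists (- C) => _ [v _ <-]].
pose m := inf (range F).
have mF v : m <= F v by apply: (ge_inf hasF.2); exists v.
have minseq n : exists v, F v < m + (4 ^+ n)^-1.
  have e0 : 0 < (4 ^+ n)^-1 :> R by rewrite invr_gt0 exprn_gt0.
  by have [_ [v _ <-] ?] := inf_adherent e0 hasF; exists v.
pose u n := sval (cid (minseq n)).
have uF n : F (u n) < m + (4 ^+ n)^-1 by exact: svalP (cid (minseq n)).
have Fpar x y : F x + F y = 2 * F ((2^-1)%:C *: (x + y)) + nrm (x - y) ^+ 2 / 2.
  rewrite /F rZ rD nrm2Z sqr.
  rewrite (_ : nrm (x - y) ^+ 2 = 2 * nrm x ^+ 2 + 2 * nrm y ^+ 2 - nrm (x + y) ^+ 2).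
    by field.
  by rewrite -parallelogram; ring.
have [v vu] : exists v, forall N, nrm (u N - v) <= 2 / 2 ^+ N.
  apply: hilbert_cauchy => [N n Nn|d d0]; last exact: expr_half_lt.
  rewrite -ler_sqr ?nnegrE ?nrm_ge0 ?divr_ge0 ?exprn_ge0//.
  have := Fpar (u N) (u n); have := mF ((2^-1)%:C *: (u N + u n)).
  have := uF N; have := uF n.
  have : (4 ^+ n)^-1 <= (4 ^+ N)^-1 :> R.
    by rewrite lef_pV2 ?posrE ?exprn_gt0// ler_weXn2l// ler1n.
  rewrite (_ : (2 / 2 ^+ N) ^+ 2 = 4 * (4 ^+ N)^-1); first lra.
  by rewrite expr_div_n e4; ring.
exists v => k.
have almost n : `|rdot (u n) k - rho k| <= nrm k / 2 ^+ n.
  rewrite -ler_sqr ?nnegrE ?divr_ge0 ?nrm_ge0 ?exprn_ge0// real_normK ?num_real//.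
  rewrite expr_div_n e4.
  apply: nonneg_quadratic (sqr_ge0 _) => s.
  have := mF (u n + s%:C *: k); have := uF n.
  by rewrite /F rD rZ nrm2D nrm2Z sqr rdotZr; lra.
apply/eqP; rewrite -subr_eq0 -normr_eq0 eq_le normr_ge0 andbT.
apply: (@le_half_zero _ _ (3 * nrm k)) => n.
rewrite (_ : _ - _ = (rdot (u n) k - rho k) - rdot (u n - v) k); last first.
  by rewrite rdotBl; ring.
apply: le_trans (ler_normB _ _) _.
rewrite (_ : 3 * nrm k / 2 ^+ n = nrm k / 2 ^+ n + 2 / 2 ^+ n * nrm k); last by ring.
apply: lerD => //; apply: le_trans (rdot_le _ _) _.
by rewrite ler_wpM2r ?nrm_ge0.
Qed.

Lemma riesz (l : H -> R[i]) (C : R) : 0 <= C ->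
  (forall x y, l (x + y) = l x + l y) ->
  (forall c x, l (c *: x) = c^* * l x) ->
  (forall x, sq (l x) <= C * nrm x ^+ 2) ->
  exists v, forall k, dot v k = l k.
Proof.
move=> C0 lD lZ lC.
have [x y|t x|x|v vl] := @real_riesz (fun x => complex.Re (l x)) C C0.
- by rewrite lD; case: (l x) (l y) => a b [].
- by rewrite lZ; case: (l x) => a b /=; ring.
- by apply: le_trans (lC x); rewrite /sq lerDl sqr_ge0.
exists v => k; have := Im_dot v k; rewrite vl lZ.
have := vl k; rewrite /rdot.
by case: (dot v k) (l k) => a b [c d] /= -> ->; congr (_ +i* _); ring.
Qed.

(** * Operators and square roots from quadratic forms *)

Section QuadraticForm.
Variable q : H -> R.
Hypothesis q0 : forall x, 0 <= q x.
Hypothesis qpar : forall x y, q (x + y) + q (x - y) = 2 * q x + 2 * q y.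
Hypothesis qZ : forall c x, q (c *: x) = sq c * q x.

(** The candidate for the bilinear form with diagonal q. *)
Definition polar x y : R := (q (x + y) - q (x - y)) / 4.

Lemma qN x : q (- x) = q x.
Proof. by rewrite -scaleN1r qZ sqN /sq /= expr1n expr0n addr0 mul1r. Qed.

Lemma polarC x y : polar x y = polar y x.
Proof. by rewrite /polar (addrC x) -(qN (x - y)) opprB. Qed.

Lemma polarxx x : polar x x = q x.
Proof.
have := qpar x x; have := qZ 0 0; rewrite scale0r sq0 mul0r /polar subrr => ->.
by rewrite addr0 => ->; field.
Qed.

(** Four instances of the parallelogram law (Jordan and von Neumann). *)
Lemma polarDl x y z : polar (x + y) z = polar x z + polar y z.
Proof.
have e1 := qpar (x + z) y; have e2 := qpar (x - z) y.
have e3 := qpar (y + z) x; have e4 := qpar (y - z) x.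
have e5 : x + z + y = x + y + z by rewrite addrAC.
have e6 : x - z + y = x + y - z by rewrite addrAC.
have e7 : y + z + x = x + y + z by rewrite addrC addrA.
have e8 : y - z + x = x + y - z by rewrite addrC addrA.
have e9 : q (y + z - x) = q (x - z - y) by rewrite -(qN (y + z - x)) !opprD opprK addrC addrA addrAC.
have e10 : q (y - z - x) = q (x + z - y).
  by rewrite -(qN (y - z - x)) !opprD !opprK [- y + z + x]addrC addrA addrAC.
move: e1 e2 e3 e4; rewrite e5 e6 e7 e8 e9 e10 /polar; lra.
Qed.

Lemma polar_bound x y : `|polar x y| <= (q x + q y) / 2.
Proof.
have := qpar x y; have := q0 (x + y); have := q0 (x - y); rewrite /polar.
by rewrite ler_norml => *; apply/andP; split; lra.
Qed.

(** The defect g t = f t - t f 1 is additive and vanishes on the integers, so it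
    is bounded on the line by its bound on [0, 1]; being additive it is then 0. *)
Lemma additive_bounded_linear (f : R -> R) (a b : R) : 0 <= a ->
  (forall s t, f (s + t) = f s + f t) ->
  (forall t, `|f t| <= a * t ^+ 2 + b) -> forall t, f t = t * f 1.
Proof.
move=> a0 fD fb t.
pose g t := f t - t * f 1.
have gD s r : g (s + r) = g s + g r by rewrite /g fD; ring.
have g0 : g 0 = 0 by have := gD 0 0; rewrite addr0; lra.
have gn n : g n%:R = 0.
  elim: n => [//|n IH]; rewrite -natr1 gD IH add0r /g; ring.
have gN r : g (- r) = - g r by have := gD r (- r); rewrite subrr g0; lra.
have gz (n : int) : g n%:~R = 0.
  by case: n => n; rewrite ?NegzE -?pmulrn ?gn// mulrNz gN -pmulrn gn oppr0.
have gB r : `|g r| <= a + b + `|f 1|.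
  have -> : g r = g (r - (Num.floor r)%:~R) by rewrite gD gN gz subr0.
  set s := r - _.
  have s0 : 0 <= s by rewrite subr_ge0 floor_le_tmp.
  have s1 : s <= 1 by rewrite lerBlDl; have := lt_succ_floor r; rewrite intrD => /ltW.
  rewrite /g; apply: le_trans (ler_normB _ _) _; rewrite normrM (ger0_norm s0).
  apply: lerD; last by rewrite -[leRHS]mul1r ler_wpM2r.
  apply: le_trans (fb s) _; rewrite lerD2r -[leRHS]mulr1 ler_wpM2l//.
  by rewrite expr_le1.
have g2 n : g (2 ^+ n * t) = 2 ^+ n * g t.
  elim: n => [|n IH]; first by rewrite !mul1r.
  by rewrite exprS -!mulrA mulr_natl mulr2n gD IH; ring.
apply/eqP; rewrite -subr_eq0 -/(g t) -normr_eq0 eq_le normr_ge0 andbT.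
apply: (@le_half_zero _ _ (a + b + `|f 1|)) => n.
rewrite ler_pdivlMr ?exprn_gt0// mulrC -[2 ^+ n]ger0_norm ?exprn_ge0//.
by rewrite -normrM -g2.
Qed.

Lemma polarZl t x y : polar (t%:C *: x) y = t * polar x y.
Proof.
rewrite (@additive_bounded_linear (fun t => polar (t%:C *: x) y) (q x / 2) (q y / 2)).
- by rewrite scale1r.
- by rewrite divr_ge0.
- by move=> s r; rewrite rmorphD scalerDl polarDl.
- by move=> s; apply: le_trans (polar_bound _ _) _; rewrite qZ sqr; lra.
Qed.

Lemma polar_cs x y : polar x y ^+ 2 <= q x * q y.
Proof.
apply: nonneg_quadratic (q0 _) => s.
rewrite (_ : _ + _ = q (s%:C *: x + y)) ?q0//.
rewrite -(polarxx (_ + _)) polarDl !(polarC _ (_ + _)) !polarDl !polarxx !polarZl qZ sqr.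
rewrite (polarC y) polarZl; ring.
Qed.

(** Invariance of q under multiplication by i makes the form compatible with the
    complex structure. *)
Lemma polar_i x y : polar ('i%C *: x) y = - polar x ('i%C *: y).
Proof.
have qi z : q ('i%C *: z) = q z by rewrite qZ /sq /= expr0n expr1n add0r mul1r.
rewrite /polar -(qi ('i%C *: x + y)) -(qi ('i%C *: x - y)).
rewrite !scalerDr scalerA -expr2 sqr_i scaleN1r scalerN.
rewrite -(qN (- x + _)) -(qN (- x - _)) !opprD !opprK; ring.
Qed.

Variable C : R.
Hypothesis C0 : 0 <= C.
Hypothesis qC : forall x, q x <= C * nrm x ^+ 2.

(** Riesz representation of polar x.  The last bound is Cauchy-Schwarz for polar
    applied to x and T x; it replaces a bound on the norm of T. *)
Lemma form_operator : exists T : H -> H,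
  [/\ forall c x y, T (c *: x + y) = c *: T x + T y,
      forall x y, rdot (T x) y = rdot x (T y),
      forall x, rdot (T x) x = q x &
      forall x, nrm (T x) ^+ 2 <= C * q x].
Proof.
have ex x : exists v, forall k, rdot v k = polar x k.
  apply: (@real_riesz (polar x) (q x * C)).
  - by rewrite mulr_ge0.
  - by move=> y z; rewrite !(polarC x) polarDl.
  - by move=> t y; rewrite !(polarC x) polarZl.
  - by move=> y; apply: le_trans (polar_cs _ _) _; rewrite -mulrA ler_wpM2l.
pose T x := sval (cid (ex x)).
have TE x k : rdot (T x) k = polar x k by exact: (svalP (cid (ex x))).
exists T; split => [c x y|x y|x|x].
- apply: rdot_inj => k; rewrite TE rdotDl polarDl TE; congr (_ + _).
  have -> : c = (complex.Re c)%:C + 'i%C * (complex.Im c)%:C.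
    by case: (c) => a b; simpc.
  rewrite !scalerDl -!scalerA rdotDl polarDl !rdotZl polarZl TE; congr (_ + _).
  by rewrite polar_i polarZl -TE rdot_i rdotZl.
- by rewrite TE polarC -TE rdotC.
- by rewrite TE polarxx.
- have [->|n0] := eqVneq (nrm (T x) ^+ 2) 0; first by rewrite mulr_ge0.
  have np : 0 < nrm (T x) ^+ 2 by rewrite lt_neqAle eq_sym n0 sqr_ge0.
  rewrite -(ler_pM2r np) -expr2 -{1}rdotxx TE; apply: le_trans (polar_cs _ _) _.
  by rewrite -mulrA mulrCA ler_wpM2l.
Qed.

End QuadraticForm.

(** The scalar counterpart of the operator iteration of [positive_sqrt], started
    at 0; it increases to 1. *)
Fixpoint newton (n : nat) : R := if n is m.+1 then (1 + newton m ^+ 2) / 2 else 0.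

Lemma newtonS n : newton n.+1 = (1 + newton n ^+ 2) / 2.
Proof. by []. Qed.

Lemma newton_bounds n : [/\ 0 <= newton n, newton n <= 1 & 1 - newton n <= 2 / n.+2%:R].
Proof.
elim: n => [|n [h0 h1 h2]] /=; first by rewrite subr0 divff ?ler01.
have q1 : newton n ^+ 2 <= 1 by rewrite expr_le1.
split; [have := sqr_ge0 (newton n); lra | lra |].
have n2 : 0 < n.+2%:R :> R by [].
rewrite ler_pdivlMr//; move: h2; rewrite ler_pdivlMr//.
have -> : n.+3%:R = n.+2%:R + 1 :> R by rewrite natr1.
move: n2; set m := n.+2%:R => m0; set y := newton n in h0 h1 q1 *; move=> h.
have := sqr_ge0 (1 - y); nra.
Qed.

Lemma newton_le m n : (m <= n)%N -> newton m <= newton n.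
Proof.
move=> /subnK <-; elim: (n - m)%N => [//|k IH]; apply: le_trans IH _.
rewrite addSn /=; have := sqr_ge0 (1 - newton (k + m)); lra.
Qed.

(** Iterate Y <- (X + Y^2) / 2 from 0.  Because
    A^2 - B^2 = A (A - B) + (A - B) B, the differences of consecutive iterates
    are dominated by those of the scalar iteration with X = 1, so the iteration
    converges pointwise.  The limit satisfies (1 - Y)^2 = 1 - X. *)
Lemma positive_sqrt (X : H -> H) :
  (forall c x y, X (c *: x + y) = c *: X x + X y) ->
  (forall x y, rdot (X x) y = rdot x (X y)) ->
  (forall x, nrm (X x) <= nrm x) ->
  exists Y : H -> H,
  [/\ forall c x y, Y (c *: x + y) = c *: Y x + Y y,
      forall x y, rdot (Y x) y = rdot x (Y y),
      forall x, nrm (Y x) <= nrm x &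
      forall x, Y x + Y x = X x + Y (Y x)].
Proof.
move=> XL Xs Xc.
pose Y := fix Y n x := if n is m.+1 then (2^-1)%:C *: (X x + Y m (Y m x)) else 0 : H.
have h2 (x : H) : nrm ((2^-1)%:C *: x) = nrm x / 2.
  apply/eqP; rewrite -(@eqrXn2 _ 2) ?divr_ge0 ?nrm_ge0//.
  by rewrite nrm2Z sqr; apply/eqP; field.
have YS n x : Y n.+1 x = (2^-1)%:C *: (X x + Y n (Y n x)) by [].
have YL n c x y : Y n (c *: x + y) = c *: Y n x + Y n y.
  elim: n c x y => [|n IH] c x y; first by rewrite /= scaler0 addr0.
  rewrite !YS XL !IH !scalerDr !scalerA (mulrC c) -!addrA; congr (_ + _).
  by rewrite addrCA.
have YB n x y : Y n (x - y) = Y n x - Y n y.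
  by rewrite -scaleN1r addrC YL scaleN1r addrC.
have Ys n x y : rdot (Y n x) y = rdot x (Y n y).
  elim: n x y => [|n IH] x y; first by rewrite /= (rdotC x) !rdot0l.
  by rewrite !YS rdotZl rdotZr rdotDl rdotDr Xs !IH.
have Yb n x : nrm (Y n x) <= newton n * nrm x.
  elim: n x => [|n IH] x; first by rewrite /= nrm0 mul0r.
  rewrite YS h2 /= mulrAC ler_pM2r// mulrDl mul1r.
  apply: le_trans (nrmD _ _) _; apply: lerD => //.
  apply: le_trans (IH _) _; rewrite expr2 -mulrA ler_wpM2l//.
  by have [] := newton_bounds n.
have Yd n x : nrm (Y n.+1 x - Y n x) <= (newton n.+1 - newton n) * nrm x.
  elim: n x => [|n IH] x; first by rewrite [Y 0 x]/(0 : H) !subr0 Yb.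
  have -> : Y n.+2 x - Y n.+1 x =
     (2^-1)%:C *: (Y n.+1 (Y n.+1 x - Y n x) + (Y n.+1 (Y n x) - Y n (Y n x))).
    rewrite YB [Y n.+2 x]YS [X in _ - X = _]YS; apply: rdot_inj => k.
    by rewrite !(rdotDl, rdotNl, rdotZl); ring.
  rewrite h2; have -> : newton n.+2 - newton n.+1 =
      (newton n.+1 + newton n) * (newton n.+1 - newton n) / 2.
    by rewrite (newtonS n.+1) [X in _ - X = _]newtonS; field.
  rewrite mulrAC ler_pM2r// -mulrA mulrDl.
  have [b0 _ _] := newton_bounds n; have [c0 _ _] := newton_bounds n.+1.
  apply: le_trans (nrmD _ _) _; apply: lerD.
    by apply: le_trans (Yb _ _) _; rewrite ler_wpM2l.
  apply: le_trans (IH _) _; rewrite mulrCA ler_wpM2l ?Yb// subr_ge0 newton_le//.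
have Ymn x N n : (N <= n)%N -> nrm (Y N x - Y n x) <= 2 / N.+2%:R * nrm x.
  move=> Nn; have [_ _ bN] := newton_bounds N; have [_ n1 _] := newton_bounds n.
  apply: (@le_trans _ _ ((newton n - newton N) * nrm x)); last first.
    by rewrite ler_wpM2r ?nrm_ge0//; apply: le_trans bN; rewrite lerD2r.
  rewrite nrmB -(subnK Nn); elim: (n - N)%N => [|k IH].
    by rewrite add0n !subrr nrm0 mul0r.
  rewrite addSn -(subrK (Y (k + N)%N x) (Y (k + N).+1 x)) -addrA.
  apply: le_trans (nrmD _ _) _; apply: le_trans (lerD (Yd _ _) IH) _.
  by rewrite -mulrDl addrA subrK.
have small (B d : R) : 0 < d -> exists N : nat, 2 / N.+2%:R * B < d.
  move=> d0; exists (Num.truncn (2 * B / d)).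
  rewrite mulrAC ltr_pdivrMr// (mulrC d) -ltr_pdivrMr//.
  by apply: (lt_trans (truncnS_gt _)); rewrite ltr_nat.
have lim x : exists v, forall N, nrm (Y N x - v) <= 2 / N.+2%:R * nrm x.
  exact: hilbert_cauchy (Ymn x) (small (nrm x)).
pose Z x := sval (cid (lim x)).
have ZE x N : nrm (Y N x - Z x) <= 2 / N.+2%:R * nrm x.
  exact: (svalP (cid (lim x))).
have squeeze (r B : R) : (forall N : nat, r <= 2 / N.+2%:R * B) -> r <= 0.
  by move=> h; rewrite leNgt; apply/negP => /(small B)[N]; rewrite ltNge h.
have eq_of_small (x y : H) B : (forall N : nat, nrm (x - y) <= 2 / N.+2%:R * B) -> x = y.
  move=> /squeeze h; apply/eqP; rewrite -subr_eq0; apply/eqP/nrm0_eq0/eqP.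
  by rewrite eq_le h nrm_ge0.
exists Z; split => [c x y|x y|x|x].
- apply: (@eq_of_small _ _ (nrm (c *: x + y) + nrm c * nrm x + nrm y)) => N.
  have -> : Z (c *: x + y) - (c *: Z x + Z y) = - (Y N (c *: x + y) - Z (c *: x + y))
     + (c *: (Y N x - Z x) + (Y N y - Z y)).
    by rewrite YL scalerBr; apply: rdot_inj => k; rewrite !(rdotDl, rdotNl); ring.
  apply: le_trans (nrmD _ _) _; rewrite nrmN -addrA [leRHS]mulrDr lerD ?ZE//.
  apply: le_trans (nrmD _ _) _; rewrite mulrDr lerD ?ZE// nrmZ.
  by rewrite mulrCA ler_wpM2l ?nrm_ge0.
- apply/eqP; rewrite -subr_eq0 -normr_eq0 eq_le normr_ge0 andbT.
  apply: (@squeeze _ (2 * nrm x * nrm y)) => N.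
  have -> : rdot (Z x) y - rdot x (Z y) = - rdot (Y N x - Z x) y + rdot x (Y N y - Z y).
    by rewrite rdotBl rdotBr Ys; ring.
  rewrite (_ : _ * (2 * _ * _) = 2 / N.+2%:R * nrm x * nrm y + nrm x * (2 / N.+2%:R * nrm y));
    last by ring.
  apply: le_trans (ler_normD _ _) _; rewrite normrN; apply: lerD.
    by apply: le_trans (rdot_le _ _) _; rewrite ler_wpM2r ?nrm_ge0.
  by apply: le_trans (rdot_le _ _) _; rewrite ler_wpM2l ?nrm_ge0.
- rewrite -subr_le0; apply: (@squeeze _ (nrm x)) => N.
  rewrite -(subKr (Y N x) (Z x)) lerBlDr.
  apply: le_trans (nrmD _ _) _; rewrite nrmN addrC lerD ?ZE//.
  apply: le_trans (Yb _ _) _; rewrite -[leRHS]mul1r ler_wpM2r ?nrm_ge0//.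
  by have [] := newton_bounds N.
- apply: (@eq_of_small _ _ (2 * nrm x + nrm (Z x) + nrm x)) => N.
  have -> : Z x + Z x - (X x + Z (Z x)) = - ((Y N.+1 x - Z x) + (Y N.+1 x - Z x)) +
      (Y N (Y N x - Z x) + (Y N (Z x) - Z (Z x))).
    have -> : X x = Y N.+1 x + Y N.+1 x - Y N (Y N x).
      rewrite YS -scalerDl -rmorphD /= (_ : 2^-1 + 2^-1 = 1); last by field.
      by rewrite scale1r addrK.
    by rewrite YB; apply: rdot_inj => k; rewrite !(rdotDl, rdotNl); ring.
  pose E := 2 / N.+2%:R * nrm x.
  have -> : 2 / N.+2%:R * (2 * nrm x + nrm (Z x) + nrm x) =
      (E + E) + (E + 2 / N.+2%:R * nrm (Z x)) by rewrite /E; ring.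
  have h : nrm (Y N.+1 x - Z x) <= E.
    apply: le_trans (ZE _ _) _; rewrite ler_wpM2r ?nrm_ge0// ler_pM2l//.
    by rewrite lef_pV2 ?posrE// ler_nat.
  apply: le_trans (nrmD _ _) _; rewrite nrmN; apply: lerD.
    by apply: le_trans (nrmD _ _) _; exact: lerD.
  apply: le_trans (nrmD _ _) _; apply: lerD => //.
  apply: le_trans (Yb _ _) _; apply: le_trans (ZE x N).
  by rewrite -[leRHS]mul1r ler_wpM2r ?nrm_ge0//; have [] := newton_bounds N.
Qed.

(** * The norm of a square root *)

Lemma bounded_op_of (b : H -> H) (B : R) : (forall c x y, b (c *: x + y) = c *: b x + b y) ->
  (forall x, nrm (b x) <= B * nrm x) -> bounded_op b.
Proof.
move=> bL bB; split=> // x; apply/cvgrPdist_lt => e e0.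
have eE : e = (complex.Re e)%:C.
  by have := ltW e0; rewrite lecE => /andP[/eqP /= h _]; case: e e0 h => u v _ /= ->.
have e1 : 0 < complex.Re e by move: e0; rewrite eE ltcR.
have d0 : 0 < (complex.Re e / (`|B| + 1))%:C :> R[i] by rewrite ltcR divr_gt0.
apply: filterS (nbhsx_ballx x _ d0) => y.
rewrite -ball_normE /= !nrmE [X in _ -> _ < X]eE !ltcR ltr_pdivlMr// => h.
have bBB u v : b (u - v) = b u - b v by rewrite -scaleN1r addrC bL scaleN1r addrC.
rewrite -bBB; apply: le_lt_trans h; apply: le_trans (bB _) _.
rewrite mulrC ler_wpM2l ?nrm_ge0//; have := ler_norm B; lra.
Qed.

Lemma op_norm_le (b : H -> H) (N : R) : 0 <= N ->
  (forall x, nrm (b x) <= N * nrm x) -> (op_norm b <= N%:E)%E.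
Proof.
move=> N0 bN; apply: ge_ereal_sup => _ [h h1 <-]; rewrite lee_fin.
by apply: le_trans (bN h) _; rewrite -[leRHS]mulr1 ler_wpM2l.
Qed.

Lemma le_op_norm (b : H -> H) (N : R) :
  (forall c x y, b (c *: x + y) = c *: b x + b y) ->
  (op_norm b <= N%:E)%E -> forall x, nrm (b x) <= N * nrm x.
Proof.
move=> bL bN x; have b0 : b 0 = 0.
  by have := bL (-1) 0 0; rewrite scaler0 addr0 scaleN1r addNr.
have [x0|x0] := eqVneq (nrm x) 0; first by rewrite (nrm0_eq0 x0) b0 !nrm0 mulr0.
have xp : 0 < nrm x by rewrite lt_neqAle eq_sym x0 nrm_ge0.
have nt : nrm (((nrm x)^-1)%:C : R[i]) = (nrm x)^-1.
  apply/eqP; rewrite -(@eqrXn2 _ 2) ?nrm_ge0 ?invr_ge0 ?nrm_ge0//.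
  by rewrite nrm_sq sqr.
have : ((nrm (b (((nrm x)^-1)%:C *: x)))%:E <= N%:E)%E.
  apply: le_trans bN; apply: ereal_sup_ubound; exists (((nrm x)^-1)%:C *: x) => //=.
  by rewrite nrmZ nt mulVf.
rewrite lee_fin -[_ *: x]addr0 bL b0 addr0 nrmZ nt mulrC ler_pdivrMr//.
Qed.

(** A positive operator on a complex space is symmetric, by polarization. *)
Lemma positive_op_sym (b : H -> H) :
  (forall c x y, b (c *: x + y) = c *: b x + b y) -> positive_op dot b ->
  forall x y, dot (b x) y = dot x (b y).
Proof.
move=> bL bp x y.
have real z : complex.Im (dot (b z) z) = 0.
  by have := bp z; rewrite lecE => /andP[/eqP /= -> _].
have bD u v : b (u + v) = b u + b v by have := bL 1 u v; rewrite !scale1r.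
have bZ c u : b (c *: u) = c *: b u.
  have b0 : b 0 = 0 by have := bL (-1) 0 0; rewrite scaler0 addr0 scaleN1r addNr.
  by have := bL c u 0; rewrite b0 !addr0.
have := real (x + y); have := real (x + 'i%C *: y).
rewrite !bD bZ !dotDl !dotDr !dotZl !dotZr (dotC (b y) x).
have := real x; have := real y.
case: (dot (b x) x) (dot (b y) y) (dot (b x) y) (dot (b y) x) => a1 a2 [b1 b2] [c1 c2] [d1 d2].
move=> /= -> -> e1 e2; congr (_ +i* _); lra.
Qed.

Lemma sqrt_norm_ge0 (q : H -> \bar R) : (0 <= sqrt_norm dot q)%E.
Proof.
apply: le_ereal_inf_tmp => _ [b _ <-].
apply: (@le_trans _ _ (nrm (b 0))%:E); first by rewrite lee_fin nrm_ge0.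
by apply: ereal_sup_ubound; exists 0 => //=; rewrite nrm0.
Qed.

(** The form determines |b h|^2 for every admissible square root b, so the infimum
    over b loses nothing. *)
Lemma sqrt_norm_form (q : H -> \bar R) (N : R) :
  (sqrt_norm dot q <= N%:E)%E -> forall h, (0 <= q h <= (N ^+ 2 * nrm h ^+ 2)%:E)%E.
Proof.
move=> qN h.
have N0 : 0 <= N by rewrite -lee_fin; exact: le_trans (sqrt_norm_ge0 q) qN.
have bnd e : 0 < e -> exists2 r, q h = (r ^+ 2)%:E & 0 <= r <= (N + e) * nrm h.
  move=> e0; have : (sqrt_norm dot q < (N + e)%:E)%E.
    by apply: le_lt_trans qN _; rewrite lte_fin ltrDl.
  move=> /ereal_inf_lt[_ [b [[bl _] bp bq] <-]] /ltW bN.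
  have bL c x y : b (c *: x + y) = c *: b x + b y by exact: bl.
  exists (nrm (b h)); last by rewrite nrm_ge0 le_op_norm.
  by rewrite bq (positive_op_sym bL bp) dotxx.
have [r qr /andP[r0 _]] := bnd 1 ltr01.
rewrite qr !lee_fin sqr_ge0 /= -exprMn ler_sqr ?nnegrE ?mulr_ge0 ?nrm_ge0//.
apply/ler_addgt0Pl => d d0.
have n1 : 0 < nrm h + 1 by rewrite ltr_wpDl ?nrm_ge0.
have [r' qr' /andP[r'0 rN]] := bnd (d / (nrm h + 1)) (divr_gt0 d0 n1).
have -> : r = r'.
  apply/eqP; rewrite -(@eqrXn2 _ 2)//; move: qr'; rewrite qr => -[->].
  exact: eqxx.
apply: le_trans rN _; rewrite mulrDl addrC lerD2r mulrAC ler_pdivrMr//.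
by rewrite ler_wpM2l ?(ltW d0)// lerDl.
Qed.

(** With C >= N^2 and T the operator of q, the operator X = 1 - T / C is a
    contraction; if Y is given by [positive_sqrt] then b = sqrt C (1 - Y) is a
    positive square root of T. *)
Lemma sqrt_norm_le (q : H -> R) (N : R) : 0 <= N ->
  (forall x y, q (x + y) + q (x - y) = 2 * q x + 2 * q y) ->
  (forall c x, q (c *: x) = sq c * q x) ->
  (forall x, 0 <= q x <= N ^+ 2 * nrm x ^+ 2) ->
  (sqrt_norm dot (fun h => (q h)%:E) <= N%:E)%E.
Proof.
move=> N0 qpar qZ qN.
(* The summand 1 keeps C positive when N is 0. *)
pose C := N ^+ 2 + 1.
have C0 : 0 < C by rewrite ltr_wpDl ?sqr_ge0.
have q0 x : 0 <= q x by have /andP[] := qN x.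
have qC x : q x <= C * nrm x ^+ 2.
  have /andP[_ h] := qN x; apply: le_trans h _.
  by rewrite ler_wpM2r ?sqr_ge0// lerDl.
have [T [TL Ts Tq TC]] := form_operator q0 qpar qZ (ltW C0) qC.
pose X x := x - (C^-1)%:C *: T x.
have [c x y|x y|x|Y [YL Ys Yc YE]] := @positive_sqrt X.
- rewrite /X TL scalerBr !scalerDr !scalerA (mulrC c) opprD.
  by rewrite addrACA.
- by rewrite /X !rdotBl !rdotBr rdotZl rdotZr Ts.
- rewrite -ler_sqr ?nnegrE ?nrm_ge0// /X nrm2B nrm2Z sqr rdotZr rdotC Tq.
  have h : C^-1 ^+ 2 * nrm (T x) ^+ 2 <= C^-1 * q x.
    rewrite expr2 -mulrA ler_wpM2l ?invr_ge0 ?(ltW C0)// ler_pdivrMl//; exact: TC.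
  have : 0 <= C^-1 * q x by rewrite mulr_ge0 ?invr_ge0 ?(ltW C0).
  lra.
pose s := Num.sqrt C.
have s2 : s * s = C by rewrite -expr2 sqr_sqrtr ?(ltW C0).
have s0 : 0 <= s by exact: sqrtr_ge0.
pose b x := s%:C *: (x - Y x).
have bL c x y : b (c *: x + y) = c *: b x + b y.
  rewrite /b YL opprD addrACA -scalerBr scalerDr; congr (_ + _).
  by rewrite !scalerA mulrC.
have YB u v : Y (u - v) = Y u - Y v by rewrite -scaleN1r addrC YL scaleN1r addrC.
have YZ c u : Y (c *: u) = c *: Y u.
  have Y00 : Y 0 = 0 by have := YL (-1) 0 0; rewrite scaler0 addr0 scaleN1r addNr.
  by have := YL c u 0; rewrite Y00 !addr0.
have bb x : b (b x) = T x.
  rewrite /b YZ -scalerBr scalerA -rmorphM s2 YB.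
  have -> : x - Y x - (Y x - Y (Y x)) = (C^-1)%:C *: T x.
    have -> : (C^-1)%:C *: T x = x - X x by rewrite /X subKr.
    have -> : X x = Y x + Y x - Y (Y x) by rewrite YE addrK.
    by rewrite !opprD !opprK !addrA.
  by rewrite scalerA -rmorphM divff ?gt_eqF// scale1r.
have bs x y : rdot (b x) y = rdot x (b y).
  by rewrite /b rdotZl rdotZr rdotBl rdotBr Ys.
have bq x : nrm (b x) ^+ 2 = q x by rewrite -rdotxx bs bb rdotC Tq.
have bN x : nrm (b x) <= N * nrm x.
  rewrite -ler_sqr ?nnegrE ?nrm_ge0 ?mulr_ge0 ?nrm_ge0// bq exprMn.
  by have /andP[] := qN x.
apply: (@le_trans _ _ (op_norm b)); last exact: op_norm_le.
apply: ereal_inf_lbound; exists b => //; split.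
- exact: bounded_op_of bN.
- move=> x.
  have -> : dot (b x) x = (rdot (b x) x)%:C.
    have bZ c u : b (c *: u) = c *: b u by rewrite /b YZ -scalerBr !scalerA mulrC.
    have := Im_dot (b x) x; rewrite bs bZ rdotC rdot_i -Im_dot /rdot.
    by case: (dot (b x) x) => u v /= h; congr (_ +i* _); lra.
  rewrite ler0c /b rdotZl mulr_ge0// rdotBl rdotxx subr_ge0.
  apply: le_trans (ler_norm _) _; apply: le_trans (rdot_le _ _) _.
  by rewrite expr2 ler_wpM2r ?nrm_ge0.
- by move=> x; rewrite bb -/(rdot _ _) Tq.
Qed.

End HilbertSpace.

(** * Orthonormal sequences and Parseval's identity *)

Section Frames.
Variables (R : realType) (H : completeNormedModType R[i]).
Variable dot : {dot H for Num.conj}.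
Hypothesis hdot : hilbert_norm dot.
Implicit Types (e : nat -> H) (u v : H).

Definition proj e n v : H := \sum_(j < n) dot v (e j) *: e j.

(** What is needed of an orthonormal sequence; stated in this way it allows some
    terms to vanish, as those that Gram-Schmidt produces from dependent vectors. *)
Definition pythagoras e := forall n v,
  nrm v ^+ 2 = nrm (v - proj e n v) ^+ 2 + \sum_(j < n) sq (dot v (e j)).

(** Membership in the closed span, as convergence of the orthogonal expansion. *)
Definition spanned e v := forall r : R, 0 < r -> exists n, nrm (v - proj e n v) < r.

Lemma proj_lin e n (c : R[i]) u v : proj e n (c *: u + v) = c *: proj e n u + proj e n v.
Proof.
rewrite /proj scaler_sumr -big_split; apply: eq_bigr => j _.
by rewrite dotDl dotZl scalerDl scalerA.
Qed.

Section FrameTheory.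
Variable e : nat -> H.
Hypothesis eP : pythagoras e.

Lemma pythagoras_le n v : \sum_(j < n) sq (dot v (e j)) <= nrm v ^+ 2.
Proof. by rewrite (eP n v) lerDr sqr_ge0. Qed.

Lemma residual_le n v : nrm (v - proj e n v) <= nrm v.
Proof.
rewrite -ler_sqr ?nnegrE ?nrm_ge0// (eP n v) lerDl.
by apply: sumr_ge0 => j _; exact: sq_ge0.
Qed.

Lemma residual_mono m n v : (m <= n)%N -> nrm (v - proj e n v) <= nrm (v - proj e m v).
Proof.
move=> mn; rewrite -ler_sqr ?nnegrE ?nrm_ge0// -(lerD2r (\sum_(j < m) sq (dot v (e j)))).
rewrite -(eP m v) (eP n v) lerD2l -(subnK mn) addnC big_split_ord /= lerDl.
by apply: sumr_ge0 => j _; exact: sq_ge0.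
Qed.

Lemma spanned_lin (c : R[i]) u v : spanned e u -> spanned e v -> spanned e (c *: u + v).
Proof.
move=> su sv r r0.
have k0 : 0 < nrm c + 1 by rewrite ltr_wpDl ?nrm_ge0.
have r2 : 0 < r / 2 by rewrite divr_gt0.
have [m Hm] := su (r / 2 / (nrm c + 1)) (divr_gt0 r2 k0).
have [n Hn] := sv (r / 2) r2.
exists (maxn m n); rewrite proj_lin opprD addrACA -scalerBr.
apply: le_lt_trans (nrmD _ _) _; rewrite nrmZ [ltRHS](splitr r).
apply: ler_ltD; last by apply: le_lt_trans (residual_mono _ (leq_maxr _ _)) Hn.
move: Hm; rewrite ltr_pdivlMr// => /ltW; apply: le_trans.
rewrite mulrC; apply: ler_pM; rewrite ?nrm_ge0 ?lerDl//.
exact: residual_mono (leq_maxl _ _).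
Qed.

Lemma spanned_lim v : (forall r, 0 < r -> exists2 u, spanned e u & nrm (v - u) < r) ->
  spanned e v.
Proof.
move=> h r r0; have r2 : 0 < r / 2 by rewrite divr_gt0.
have [u su uv] := h _ r2; have [n Hn] := su _ r2; exists n.
have -> : v - proj e n v = (v - u - proj e n (v - u)) + (u - proj e n u).
  have -> : proj e n (v - u) = proj e n v - proj e n u.
    by rewrite -scaleN1r addrC proj_lin scaleN1r addrC.
  by apply: (rdot_inj hdot) => k; rewrite !(rdotDl, rdotNl); ring.
apply: le_lt_trans (nrmD _ _) _; rewrite [ltRHS](splitr r).
by apply: ltrD => //; apply: le_lt_trans (residual_le _ _) uv.
Qed.

Lemma parseval_le v : (\sum_(j <oo) (sq (dot v (e j)))%:E <= (nrm v ^+ 2)%:E)%E.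
Proof.
apply: lime_le; first by apply: is_cvg_nneseries => n _ _; rewrite lee_fin sq_ge0.
by apply: nearW => n; rewrite sumEFin lee_fin big_mkord pythagoras_le.
Qed.

Lemma parseval v : spanned e v -> (\sum_(j <oo) (sq (dot v (e j)))%:E = (nrm v ^+ 2)%:E)%E.
Proof.
move=> sv; apply/eqP; rewrite eq_le parseval_le /=.
apply/lee_addgt0Pr => r r0.
have [|n Hn] := sv (Num.sqrt r); first by rewrite sqrtr_gt0.
rewrite (eP n v) EFinD addeC; apply: leeD.
  rewrite -sumEFin -(big_mkord xpredT (fun j => (sq (dot v (e j)))%:E)).
  by apply: nneseries_lim_ge => j _ _; rewrite lee_fin sq_ge0.
rewrite lee_fin -[leRHS](sqr_sqrtr (ltW r0)) ler_sqr ?nnegrE ?nrm_ge0 ?sqrtr_ge0//.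
exact: ltW.
Qed.

End FrameTheory.

(** Normalizing 0 gives 0, so no case distinction on dependent vectors is made. *)
Lemma gram_schmidt (d : nat -> H) : exists e, pythagoras e /\ forall n, spanned e (d n).
Proof.
pose projs (s : seq H) v := \sum_(z <- s) dot v z *: z.
pose unit v : H := ((nrm v)^-1)%:C *: v.
pose E := fix E n := if n is m.+1 then rcons (E m) (unit (d m - projs (E m) (d m))) else [::].
pose e n := unit (d n - projs (E n) (d n)).
have projE n v : projs (E n) v = proj e n v.
  rewrite /proj; elim: n => [|n IH]; first by rewrite /projs big_nil big_ord0.
  by rewrite /projs /= -cats1 big_cat big_seq1 /= big_ord_recr /= -IH.
have un v : nrm (unit v) ^+ 2 = (v != 0)%:R.
  rewrite /unit nrm2Z sqr; have [->|v0] := eqVneq v 0; first by rewrite nrm0 expr0n mulr0.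
  rewrite -exprMn mulVf ?expr1n//; apply: contra_neq v0; exact: nrm0_eq0.
have eE n : e n = unit (d n - proj e n (d n)) by rewrite /e projE.
have PS n v : proj e n.+1 v = proj e n v + dot v (e n) *: e n.
  by rewrite /proj big_ord_recr.
have unorm n (a : R[i]) v : a = dot v (e n) -> a * (nrm (e n) ^+ 2)%:C = a.
  move=> ->; rewrite /e un; case: eqVneq => [z|_]; last by rewrite mulr1.
  by rewrite z /unit scaler0 -[0](scale0r 0) dotZr rmorph0 !mul0r.
have perp n v : (forall i, (i < n)%N -> dot (e n) (e i) = 0) ->
    dot (proj e n v) (e n) = 0.
  move=> e0; rewrite /proj; apply: (big_ind (fun z => dot z (e n) = 0)).
  - by rewrite dot0l.
  - by move=> x y hx hy; rewrite dotDl hx hy addr0.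
  - by move=> i _; rewrite dotZl (dotC dot (e n)) e0// rmorph0 mulr0.
have orth n v k : (k < n)%N -> dot (v - proj e n v) (e k) = 0.
  elim: n v k => [//|n IH] v k.
  have e0 i : (i < n)%N -> dot (e n) (e i) = 0.
    by move=> ik; rewrite eE /unit dotZl IH ?mulr0.
  rewrite ltnS leq_eqVlt => /predU1P[->|kn]; last first.
    by rewrite PS opprD addrA dotBl IH// dotZl e0// mulr0 subr0.
  rewrite PS opprD addrA !dotBl dotZl (dotxx hdot) (unorm _ _ v)//.
  by rewrite perp// subr0 subrr.
have py : pythagoras e.
  move=> n v; elim: n => [|n IH]; first by rewrite /proj !big_ord0 subr0 addr0.
  rewrite IH big_ord_recr /= addrA addrAC; congr (_ + _).
  set a := dot v (e n).
  have -> : v - proj e n v = (v - proj e n.+1 v) + a *: e n.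
    by rewrite PS opprD addrA subrK.
  rewrite (nrm2D hdot) /rdot dotZr orth// mulr0 /= mulr0 addr0 nrm2Z; congr (_ + _).
  apply: (@complexI R); rewrite rmorphM /=.
  have -> : (sq a)%:C = a^* * a by rewrite mulrC mulzJ.
  by rewrite -mulrA (unorm _ _ v).
exists e; split => // n r r0; exists n.+1.
suff -> : d n - proj e n.+1 (d n) = 0 by rewrite nrm0.
rewrite PS opprD addrA.
set z := d n - proj e n (d n).
have -> : dot (d n) (e n) = dot z (e n).
  rewrite /z dotBl; have -> : dot (proj e n (d n)) (e n) = 0; last by rewrite subr0.
  apply: perp => i ik; by rewrite eE /unit dotZl orth ?mulr0.
rewrite eE -/z /unit dotZr (dotxx hdot) scalerA.
have [->|z0] := eqVneq z 0; first by rewrite scaler0 subrr.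
have nz : nrm z != 0 by apply: contra_neq z0; exact: nrm0_eq0.
have -> : Num.conj ((nrm z)^-1)%:C = ((nrm z)^-1)%:C :> R[i] by exact: conjc_real.
rewrite -!rmorphM /= (_ : _ / _ = 1) ?scale1r ?subrr//; by field.
Qed.

End Frames.

(** * Strong measurability *)

Section StrongMeasurability.
Variables (R : realType) (H : completeNormedModType R[i]).
Variable dot : {dot H for Num.conj}.
Hypothesis hdot : hilbert_norm dot.
Local Notation leb := (@lebesgue_measure R).
Implicit Types (F G : R -> H) (u v h k : H).

(** A preimage is a finite union of fibres, whatever g is. *)
Lemma measurable_simple_comp (s : R -> H) (g : H -> R) :
  simple_fun s -> measurable_fun setT (g \o s).
Proof.
move=> [fs ms] _ Y mY; rewrite setTI.
rewrite (_ : _ @^-1` Y = \bigcup_(v in [set v | range s v /\ Y (g v)]) s @^-1` [set v]).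
  apply: fin_bigcup_measurable => [|v _]; last exact: ms.
  by apply: sub_finite_set fs => v [].
apply/seteqP; split => [x Yx|x [v [_ Yv] /= sv]]; last by rewrite /preimage /= sv.
by exists (s x) => //; split => //; exists x.
Qed.

Lemma strong_cvg F (s : nat -> R -> H) (r : R) x :
  s n x @[n --> \oo] --> F x -> 0 < r ->
  exists N, forall n, (N <= n)%N -> nrm (F x - s n x) < r.
Proof.
move=> /cvgrPdist_lt/(_ r%:C); rewrite ltcR => h /h[N _ HN]; exists N => n Nn.
by have := HN n Nn; rewrite /= nrmE ltcR.
Qed.

Lemma measurable_lipschitz_comp F (g : H -> R) (B : R) :
  (forall u v, `|g u - g v| <= B * nrm (u - v)) ->
  strongly_measurable F -> measurable_fun setT (fun x => g (F x)).
Proof.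
move=> gB [s ss sF].
apply: (@measurable_fun_cvg _ _ _ setT (fun n x => g (s n x))) => [n|x _].
  exact: (measurable_simple_comp g (ss n)).
have B1 : 0 < `|B| + 1 by rewrite ltr_wpDl.
apply/cvgrPdist_lt => e e0.
have [N HN] := strong_cvg (sF x) (divr_gt0 e0 B1).
exists N => // n /= /HN; rewrite ltr_pdivlMr// mulrC; apply: le_lt_trans.
apply: le_trans (gB _ _) _; rewrite ler_wpM2r ?nrm_ge0//.
by apply: le_trans (ler_norm _) _; rewrite lerDl.
Qed.

Lemma strong_meas_nrm F v : strongly_measurable F ->
  measurable_fun setT (fun x => nrm (F x - v) ^+ 2).
Proof.
move=> sF; apply: measurable_funX.
apply: (@measurable_lipschitz_comp F (fun z => nrm (z - v)) 1) => // a b.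
have tri (c d : H) : nrm (c - v) - nrm (d - v) <= nrm (c - d).
  rewrite lerBlDr; apply: le_trans (nrmD _ _).
  by rewrite subrKA.
rewrite mul1r ler_norml tri andbT lerNl opprB; apply: le_trans (tri _ _) _.
by rewrite nrmB.
Qed.

Lemma strong_meas_dot F k : strongly_measurable F -> cmeasurable (fun x => dot (F x) k).
Proof.
move=> sF.
have re v : measurable_fun setT (fun x => rdot dot (F x) v).
  apply: (@measurable_lipschitz_comp F (fun z => rdot dot z v) (nrm v)) => // a b.
  by rewrite -rdotBl mulrC; exact: rdot_le.
split; first exact: re.
by under eq_fun do rewrite Im_dot; exact: re.
Qed.

Lemma strong_values F : strongly_measurable F -> exists A : set H, countable A /\
  forall e, pythagoras dot e -> (forall v, A v -> spanned dot e v) -> forall x, spanned dot e (F x).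
Proof.
move=> [s ss sF]; exists (\bigcup_n range (s n)); split.
  apply: bigcup_countable => // n _; apply: finite_set_countable; exact: (ss n).1.
move=> e pe se x; apply: (spanned_lim hdot pe) => r r0.
have [N HN] := strong_cvg (sF x) r0; exists (s N x); last exact: HN.
by apply: se; exists N => //; exists x.
Qed.

Lemma countable_seq (A : set H) : countable A -> exists d : nat -> H, A `<=` range d.
Proof.
move=> /countable_injP[f fi]; exists (fun n => xget 0 [set v | A v /\ f v = n]) => v Av.
exists (f v) => //; case: xgetP => [u -> [Au fu]|/(_ v)/=]; last by case.
by apply: fi => //; rewrite inE.
Qed.

Lemma countable_union (A B : set H) : countable A -> countable B -> countable (A `|` B).
Proof.
move=> cA cB; rewrite -bigcup2E; apply: bigcup_countable => // -[|[|n]] _ //.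
Qed.

(** A strongly measurable function takes its values in the closure of a countable
    set, so one orthonormal sequence serves finitely many functions and countably
    many vectors at once. *)
Lemma frame_exists (Fs : seq (R -> H)) (A : set H) : (forall i, (i < size Fs)%N ->
    strongly_measurable (nth (fun=> 0) Fs i)) -> countable A ->
  exists e, [/\ pythagoras dot e, forall v, A v -> spanned dot e v &
    forall i, (i < size Fs)%N -> forall x, spanned dot e (nth (fun=> 0) Fs i x)].
Proof.
move=> sF cA.
have [B [cB BF]] : exists B : set H, countable B /\
    forall e, pythagoras dot e -> (forall v, B v -> spanned dot e v) ->
    forall i, (i < size Fs)%N -> forall x, spanned dot e (nth (fun=> 0) Fs i x).
  elim: Fs sF => [|F Fs IH] sF; first by exists set0; split => //; exact: countable0.
  have [|B [cB HB]] := IH; first by move=> i; exact: (sF i.+1).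
  have [C [cC HC]] := strong_values (sF 0 isT).
  exists (B `|` C); split; first exact: countable_union.
  move=> e pe se [_|i iF]; first by apply: HC => // v Cv; apply: se; right.
  by apply: HB => // v Bv; apply: se; left.
have [d AB] := countable_seq (countable_union cA cB).
have [e [pe ed]] := gram_schmidt hdot d.
have eA v : (A `|` B) v -> spanned dot e v by move=> /AB[n _ <-].
by exists e; split => // [v Av|i]; [apply: eA; left | apply: BF => // v Bv; apply: eA; right].
Qed.

(** The identity tested against each vector holds off a null set that depends on
    the vector; testing against a sequence whose span contains all the values
    makes the null set common. *)
Lemma strong_ae_comb F G K (c : R[i]) :
  strongly_measurable F -> strongly_measurable G -> strongly_measurable K ->
  (forall k, {ae leb, forall x, dot (K x) k = c * dot (F x) k + dot (G x) k}) ->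
  {ae leb, forall x, K x = c *: F x + G x}.
Proof.
move=> sF sG sK h.
have [|e [pe _ se]] := @frame_exists [:: F; G; K] set0 _ (countable0 _).
  by move=> [|[|[|]]].
have /ae_mono := ae_all (fun n => h (e n)); apply => x hx.
apply/eqP; rewrite -subr_eq0; apply/eqP/nrm0_eq0/eqP; rewrite -sqrf_eq0; apply/eqP.
have sp : spanned dot e (K x - (c *: F x + G x)).
  rewrite -scaleN1r addrC; apply: spanned_lin (se 2 isT x) => //.
  by apply: spanned_lin (se 0 isT x) (se 1 isT x).
apply/EFin_inj; rewrite -(parseval pe sp).
apply: eseries0 => j _ _.
by rewrite dotBl dotDl dotZl hx subrr sq0.
Qed.

End StrongMeasurability.

(** * Vector-valued inequalities *)

Section SumInterchange.
Variables (R : realType) (T : choiceType).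
Implicit Types (D : set T) (a : T -> nat -> \bar R).
Local Open Scope ereal_scope.

Lemma esum_series_le D a : (forall i j, 0 <= a i j) ->
  \esum_(i in D) (\sum_(j <oo) a i j) <= \sum_(j <oo) \esum_(i in D) a i j.
Proof.
move=> a0; apply: ge_ereal_sup => _ [X [finX XD] <-].
rewrite fsbig_finite//= -nneseries_sum//; apply: lee_nneseries => j _.
  by rewrite sume_ge0.
by rewrite -fsbig_finite//; apply: ereal_sup_ubound; exists X.
Qed.

Lemma series_esum_le D a (b : T -> \bar R) : (forall i j, 0 <= a i j) ->
  (forall i, \sum_(j <oo) a i j <= b i) ->
  \sum_(j <oo) \esum_(i in D) a i j <= \esum_(i in D) b i.
Proof.
move=> a0 ab; apply: lime_le.
  by apply: is_cvg_nneseries => n _ _; apply: esum_ge0 => i _.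
apply: nearW => n; rewrite -esum_sum//; apply: le_esum => i _.
by apply: le_trans (ab i); apply: nneseries_lim_ge.
Qed.

End SumInterchange.

Section VectorWeightedL2.
Variables (R : realType) (H : completeNormedModType R[i]).
Variable dot : {dot H for Num.conj}.
Hypothesis hdot : hilbert_norm dot.
Local Notation leb := (@lebesgue_measure R).
Implicit Types (F : R -> H) (h k v : H).

(** The H-valued version of [wL2]. *)
Definition vL2 F := strongly_measurable F /\
  (\int[leb]_x (nrm (F x) ^+ 2 * pois 0 1 x)%:E < +oo)%E.

Lemma sq_dot_le u v : sq (dot u v) <= nrm u ^+ 2 * nrm v ^+ 2.
Proof.
have := rdot_cs hdot ((dot u v)^* *: u) v; rewrite nrm2Z sq_conj.
have -> : rdot dot ((dot u v)^* *: u) v = sq (dot u v).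
  by rewrite /rdot dotZl mulrC mulzJ.
have := sq_ge0 (dot u v); rewrite le_eqVlt => /predU1P[<- _|s0].
  by rewrite mulr_ge0 ?sqr_ge0.
by rewrite expr2 -mulrA ler_pM2l.
Qed.

Lemma meas_nrm_pois F (v : H) (c L : R) : strongly_measurable F ->
  measurable_fun setT (fun x => nrm (F x - v) ^+ 2 * pois c L x).
Proof. by move=> sF; apply: measurable_funM; [exact: strong_meas_nrm|exact: meas_pois]. Qed.

Lemma int_dot_le F k (m : R -> R) : vL2 F -> measurable_fun setT m ->
  (forall x, 0 <= m x <= pois 0 1 x) ->
  (\int[leb]_x (sq (dot (F x) k) * m x)%:E <=
   (nrm k ^+ 2 * fine (\int[leb]_x (nrm (F x) ^+ 2 * pois 0 1 x)%:E))%:E)%E.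
Proof.
move=> [sF fF] mm m01.
have p0 x : 0 <= nrm (F x) ^+ 2 * pois 0 1 x by rewrite mulr_ge0 ?sqr_ge0 ?pois_ge0.
have mp : measurable_fun setT (fun x => nrm (F x) ^+ 2 * pois 0 1 x).
  by have := meas_nrm_pois 0 0 1 sF; under eq_fun do rewrite subr0.
rewrite EFinM fineK; last first.
  by rewrite ge0_fin_numE//; apply: integral_ge0 => x _; rewrite lee_fin.
rewrite -ge0_intZ ?sqr_ge0//; apply: ge0_le_int.
- by apply: measurable_funM => //; apply: meas_sq; exact: strong_meas_dot.
- exact: measurable_funM.
- by move=> x; rewrite mulr_ge0 ?sq_ge0//; have /andP[] := m01 x.
- move=> x; have /andP[m0 m1] := m01 x; rewrite mulrA ler_pM ?sq_ge0//.
  by rewrite mulrC sq_dot_le.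
Qed.

Lemma vL2_dot F k : vL2 F -> wL2 (fun x => dot (F x) k).
Proof.
move=> vF; split; first by apply: strong_meas_dot => //; exact: vF.1.
apply: le_lt_trans (ltry _); apply: (int_dot_le k vF (meas_pois 0 1)) => x.
by rewrite pois_ge0 lexx.
Qed.

(** Functions against which the weighted space can be integrated; they cover the
    wavelets and the means over intervals. *)
Definition test_fun (g : R -> R[i]) := cmeasurable g /\
  exists B : R, (\int[leb]_x (sq (g x) / pois 0 1 x ^+ 2)%:E <= B%:E)%E.

Lemma pairing_cs F g : vL2 F -> test_fun g -> exists B : R, forall k,
  cintegrable setT (fun x => dot (F x) k * (g x)^*) /\
  sq (ip (fun x => dot (F x) k) g) <= B * nrm k ^+ 2.
Proof.
move=> vF [mg [B gB]].
set A := fine (\int[leb]_x (nrm (F x) ^+ 2 * pois 0 1 x)%:E)%E.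
exists (A * B) => k; rewrite mulrC mulrA.
have wk := vL2_dot k vF.
apply: (weighted_cs wk.1 mg (meas_pois 0 1) (meas_poisV 0 1) (pois_gt0 0 1)) => //.
apply: int_dot_le => // [|x]; first by apply: measurable_funX; exact: meas_pois.
by rewrite sqr_ge0/= expr2 ler_piMr ?pois_ge0 ?pois_le1.
Qed.

(** The weak integral of F against g exists, by Riesz representation. *)
Lemma pairing F g : vL2 F -> test_fun g ->
  exists v, forall k, dot v k = ip (fun x => dot (F x) k) g.
Proof.
move=> vF tg; have [B cs] := pairing_cs vF tg.
apply: (@riesz _ _ dot hdot (fun k => ip (fun x => dot (F x) k) g) `|B|) => //.
- move=> x y; rewrite /ip -cintD//; [|exact: (cs x).1|exact: (cs y).1].
  by apply: eq_cint => t _; rewrite dotDr mulrDl.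
- move=> c x; rewrite /ip -cintZ//; last exact: (cs x).1.
  by apply: eq_cint => t _; rewrite dotZr mulrA.
- move=> x; apply: le_trans (cs x).2 _; rewrite ler_wpM2r ?sqr_ge0//.
  exact: ler_norm.
Qed.

Definition mean_test (a b x : R) : R[i] :=
  if x \in (`[a, b]%classic : set (measurableTypeR R)) then ((b - a)^-1)%:C else 0.

Lemma ip_mean_test (f : R -> R[i]) a b :
  ip f (mean_test a b) = cint `[a, b]%classic (fun x => f x * ((b - a)^-1)%:C).
Proof.
rewrite /ip [RHS]cint_mkcond; apply: eq_cint => x _; rewrite /mean_test.
case: ifP => _; last by rewrite rmorph0 mulr0.
by congr (_ * _); exact: conjc_real.
Qed.

Lemma mean_test_fun a b : test_fun (mean_test a b).
Proof.
set g := mean_test a b; pose D : set (measurableTypeR R) := `[a, b]%classic.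
pose c := (b - a)^-1.
have mD : measurable D by exact: measurable_itv.
have mg : cmeasurable g by apply: cmeas_if => //; exact: cmeas_cst.
split=> //; pose r := `|a| + `|b|.
pose C := c ^+ 2 * (1 + r ^+ 2) ^+ 2.
have fin : (\int[leb]_(x in D) C%:E)%E \is a fin_num.
  rewrite integral_cst//= lebesgue_measure_itv/=; case: ifP => _; last by rewrite mule0.
  by [].
exists (fine (\int[leb]_(x in D) C%:E)%E); rewrite fineK// (int_restrict D (fun=> C)).
apply: ge0_le_int.
- apply: measurable_funM; first exact: meas_sq.
  by under eq_fun do rewrite -exprVn; apply: measurable_funX; exact: meas_poisV.
- by apply: measurable_funM => //; exact: measurable_indic.
- by move=> x; rewrite divr_ge0 ?sq_ge0 ?sqr_ge0.
- move=> x; rewrite /g /mean_test -/D indicE; case: ifPn => xD; last by rewrite sq0 !mul0r.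
  rewrite sqr mul1r ler_wpM2l ?sqr_ge0// -exprVn /pois invrK subr0 divr1.
  have xr : x ^+ 2 <= r ^+ 2.
    rewrite -(real_normK (num_real x)) ler_sqr ?nnegrE ?addr_ge0//.
    move: xD; rewrite mem_setE in_itv /= /r => /andP[ax xb]; rewrite ler_norml.
    have := ler_norm (- a); have := ler_norm b; have := normr_ge0 a; have := normr_ge0 b.
    by rewrite normrN => *; apply/andP; split; lra.
  by rewrite ler_sqr ?nnegrE ?addr_ge0 ?sqr_ge0// lerD2l.
Qed.

Lemma mean_exists F a b : vL2 F -> exists v, forall k,
  dot v k = cint `[a, b]%classic (fun x => dot (F x) k * ((b - a)^-1)%:C).
Proof.
move=> vF; have [v vE] := pairing vF (mean_test_fun a b).
by exists v => k; rewrite vE ip_mean_test.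
Qed.

End VectorWeightedL2.

Section VectorInequalities.
Variables (R : realType) (H : completeNormedModType R[i]).
Variable dot : {dot H for Num.conj}.
Hypothesis hdot : hilbert_norm dot.
Local Notation leb := (@lebesgue_measure R).
Variables (w : R -> R[i]) (K : R).
Hypothesis mw : cmeasurable w.
Hypothesis K0 : 0 < K.
Hypothesis wdecay : forall y, sq (w y) <= K / (1 + y ^+ 2) ^+ 4.
Hypothesis wnear : forall y t, `|y - t| <= 1 ->
  sq (w y - w t) <= K * (y - t) ^+ 2 / (1 + t ^+ 2) ^+ 2.
Hypothesis wlip : forall y t, sq (w y - w t) <= K * (y - t) ^+ 2.
Hypothesis wwav : complete_orthonormal_wavelets w.
Local Notation wav := (wavelet w).

Variables (F : R -> H) (W : int * int -> H).
Hypothesis vF : vL2 F.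
Hypothesis WE : forall I k, dot (W I) k = ip (fun x => dot (F x) k) (wav I).

Lemma wav_test_fun I : test_fun (wav I).
Proof.
split; first exact: meas_wav.
exact: (wav_over_pois mw K0 wdecay I 0 (@ltr01 R)).
Qed.

Lemma frame_of m : exists e, [/\ pythagoras dot e, forall x, spanned dot e (F x - m) &
  forall I, spanned dot e (W I)].
Proof.
have [||e [pe eA eF]] := @frame_exists _ _ dot hdot [:: F] ([set m] `|` range W).
- by case=> [|//] _; exact: vF.1.
- apply: countable_union; first exact: finite_set_countable.
  exact: sub_countable (card_image_le _ _) (countableP _).
exists e; split => // [x|I]; last by apply: eA; right; exists I.
rewrite -scaleN1r addrC; apply: (spanned_lin pe) => //; first by apply: eA; left.
exact: (eF 0).
Qed.

Lemma cmeas_shift (m k : H) : cmeasurable (fun x => dot (F x - m) k).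
Proof.
under eq_fun do rewrite dotBl; apply: cmeasB; last exact: cmeas_cst.
by apply: strong_meas_dot => //; exact: vF.1.
Qed.

(** Parseval on the left, [coef_le_poisson] for each coordinate, and Parseval again
    on the right. *)
Theorem vec_coef_le m J :
  (\esum_(I in [set I | dyadic I `<=` (dyadic J : set R)]) (nrm (W I) ^+ 2)%:E <=
   (poissonC K)%:E * \int[leb]_x (nrm (F x - m) ^+ 2 * pois (dcenter R J) (dlen R J) x)%:E)%E.
Proof.
have [e [pe eF eW]] := frame_of m.
have C0 : 0 <= poissonC K by rewrite /poissonC addr_ge0 ?mulr_ge0 ?exprn_ge0 ?ler0n// ltW.
have mpj j : measurable_fun setT
    (fun x => sq (dot (F x - m) (e j)) * pois (dcenter R J) (dlen R J) x).
  exact: (meas_sq_pois (dcenter R J) (dlen R J) (cmeas_shift m (e j))).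
apply: (@le_trans _ _ (\esum_(I in [set I | dyadic I `<=` (dyadic J : set R)])
    \sum_(j <oo) (sq (dot (W I) (e j)))%:E)%E).
  by apply: le_esum => I _; rewrite (parseval pe (eW I)).
apply: le_trans (esum_series_le _ _) _; first by move=> I j; rewrite lee_fin sq_ge0.
apply: (@le_trans _ _ (\sum_(j <oo) (poissonC K)%:E * \int[leb]_x
    (sq (dot (F x - m) (e j)) * pois (dcenter R J) (dlen R J) x)%:E)%E).
  apply: lee_nneseries => j _; first by move=> _; apply: esum_ge0 => I _; rewrite lee_fin sq_ge0.
  under eq_esum do rewrite WE.
  under eq_integral do rewrite dotBl.
  apply: (coef_le_poisson mw K0 wdecay wlip wwav.1); exact: vL2_dot.
rewrite nneseriesZl; last first.
  by move=> j _; apply: integral_ge0 => x _; rewrite lee_fin mulr_ge0 ?sq_ge0 ?pois_ge0.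
rewrite lee_wpmul2l ?lee_fin// -integral_nneseries//; last 2 first.
- by move=> j; apply/measurable_EFinP; exact: mpj.
- by move=> j x _; rewrite lee_fin mulr_ge0 ?sq_ge0 ?pois_ge0.
apply: ge0_le_integral => //.
- by move=> x _; apply: nneseries_ge0 => j _ _; rewrite lee_fin mulr_ge0 ?sq_ge0 ?pois_ge0.
- by apply: ge0_emeasurable_sum => j *; [rewrite lee_fin mulr_ge0 ?sq_ge0 ?pois_ge0
                                        |apply/measurable_EFinP; exact: mpj].
- apply/measurable_EFinP; apply: meas_nrm_pois; exact: vF.1.
- move=> x _; under eq_eseriesr do rewrite mulrC EFinM.
  rewrite nneseriesZl; last by move=> j _; rewrite lee_fin sq_ge0.
  by rewrite mulrC EFinM lee_wpmul2l ?lee_fin ?pois_ge0// (parseval pe (eF x)).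
Qed.

(** Parseval on the left, [osc_le_coef] for each coordinate, and Bessel on the right. *)
Theorem vec_osc_le (u v : R) (j : int) (m : H) : u < v -> v - u <= 2 ^ j ->
  (forall k, dot m k = cint `[u, v]%classic (fun x => dot (F x) k * ((v - u)^-1)%:C)) ->
  (\int[leb]_(x in `[u, v]%classic) (nrm (F x - m) ^+ 2)%:E <=
   (2 * atomC K)%:E * \esum_(I in setT) ((scale_wt j u I)^-1 * nrm (W I) ^+ 2)%:E)%E.
Proof.
move=> uv vj mE; have [e [pe eF eW]] := frame_of m.
have C0 : 0 <= 2 * atomC K by rewrite mulr_ge0// ltW// atomC_gt0.
have sw0 I : 0 <= (scale_wt j u I)^-1 by rewrite invr_ge0 ltW// scale_wt_gt0.
under eq_integral do rewrite -(parseval pe (eF _)).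
rewrite integral_nneseries//; last 2 first.
- move=> n; apply: (@measurable_funS _ _ _ _ setT) => //; apply: measE_sq; exact: cmeas_shift.
- by move=> n x _; rewrite lee_fin sq_ge0.
apply: (@le_trans _ _ (\sum_(n <oo) (2 * atomC K)%:E *
    \esum_(I in setT) ((scale_wt j u I)^-1 * sq (dot (W I) (e n)))%:E)%E).
  apply: lee_nneseries => n _.
    by move=> _; apply: integral_ge0 => x _; rewrite lee_fin sq_ge0.
  under eq_integral do rewrite dotBl.
  under eq_esum do rewrite WE.
  apply: (osc_le_coef mw K0 wdecay wnear wwav (vL2_dot hdot (e n) vF) uv vj); exact: mE.
rewrite nneseriesZl; last first.
  by move=> n _; apply: esum_ge0 => I _; rewrite lee_fin mulr_ge0 ?sq_ge0.
rewrite lee_wpmul2l ?lee_fin//; apply: series_esum_le.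
  by move=> I n; rewrite lee_fin mulr_ge0 ?sq_ge0.
move=> I; under eq_eseriesr do rewrite EFinM.
rewrite nneseriesZl; last by move=> n _; rewrite lee_fin sq_ge0.
by rewrite EFinM lee_wpmul2l ?lee_fin//; exact: parseval_le.
Qed.

End VectorInequalities.

(** * Carleson sums and growth of means *)

Section CarlesonSums.
Variable R : realType.
Variables (a : int * int -> R) (S : R).
Hypothesis a0 : forall I, 0 <= a I.
Hypothesis S0 : 0 <= S.
Hypothesis carleson : forall J,
  (\esum_(I in [set I | dyadic I `<=` (dyadic J : set R)]) (a I)%:E <= (S * dlen R J)%:E)%E.

Lemma esum_group (T T' : choiceType) (D : set T) (g : T -> T') (b : T -> \bar R) :
  (forall i, 0 <= b i)%E ->
  (\esum_(i in D) b i = \esum_(k in [set: T']) \esum_(i in [set i | D i /\ g i = k]) b i)%E.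
Proof.
move=> b0; rewrite esum_esum//.
apply: (@reindex_esum _ _ _ _ _ (fun ki : T' * T => ki.2)); split.
- by move=> [k i] /= [_ [Di _]].
- move=> [k i] [k' i'] /set_mem[_ [_ /= gk]] /set_mem[_ [_ /= gk']] /= ii.
  by rewrite -gk -gk' ii.
- by move=> i Di; exists (g i, i).
Qed.

(** The position of the dyadic interval of length 2^j around the left endpoint of I. *)
Definition ancestor (j : int) (I : int * int) : int :=
  Num.floor (I.2%:~R * dlen R I / 2 ^ j).

(** The endpoints of I are integer multiples of |I|, so an interval of length 2^j
    that contains the left endpoint contains I. *)
Lemma ancestor_sub j I : (I.1 <= j)%R -> dyadic I `<=` (dyadic (j, ancestor j I) : set R).
Proof.
move=> Ij; set k := ancestor j I; set L : R := 2 ^ j; have L0 : 0 < L by rewrite exprz_gt0.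
have dI := dlen_gt0 R I.
have /andP[k1 k2] := Num.Theory.floor_itv (I.2%:~R * dlen R I / L).
rewrite -/(ancestor j I) -/k in k1 k2.
rewrite ler_pdivlMr// in k1; rewrite ltr_pdivrMr// in k2.
suff k3 : (I.2%:~R + 1) * dlen R I <= (k%:~R + 1) * L.
  move=> x; rewrite /dyadic /= !in_itv /= /dlen /= -/L => /andP[h1 h2].
  by rewrite (le_trans k1 h1) (lt_le_trans h2 k3).
pose n := `|j - I.1|%N.
have LE : L = 2 ^+ n * dlen R I.
  rewrite /L /dlen exprnP /n gez0_abs ?subr_ge0// -expfzDr//; congr (_ ^ _); ring.
move: k2; rewrite LE !mulrA ltr_pM2r// ler_pM2r//.
rewrite (_ : (k + 1)%:~R * 2 ^+ n = ((k + 1) * 2 ^+ n)%:~R :> R); last first.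
  by rewrite intrM rmorphXn.
rewrite (_ : (k%:~R + 1) * 2 ^+ n = ((k + 1) * 2 ^+ n)%:~R :> R); last first.
  by rewrite intrM rmorphXn /= intrD.
by rewrite ltr_int -intrD1 ler_int lezD1.
Qed.

Lemma pois_near (p L c c' : R) : 0 < L -> `|c - c'| <= L / 2 -> pois p L c <= 2 * pois p L c'.
Proof.
move=> L0 cc; set t := (c - p) / L; set s := (c' - p) / L.
have /ler_normlP[d1 d2] : `|t - s| <= 1 / 2.
  have -> : t - s = (c - c') / L by rewrite /t /s; field; rewrite gt_eqF.
  by rewrite normrM [`|L^-1|]gtr0_norm ?invr_gt0// ler_pdivrMr// mulrAC mul1r.
rewrite /pois -/t -/s.
have -> : 2 * (1 + s ^+ 2)^-1 = ((1 + s ^+ 2) / 2)^-1 by rewrite invf_div.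
have dd : (t - s) ^+ 2 <= 1 / 4.
  by have := mulr_ge0 (_ : 0 <= 1 / 2 + (t - s)) (_ : 0 <= 1 / 2 - (t - s)); lra.
rewrite lef_pV2 ?posrE ?divr_gt0 ?ltr_pwDl ?sqr_ge0//.
by have := sqr_ge0 (t + (t - s)); lra.
Qed.

(** Group the short intervals by their ancestor of length 2^j: the weight is nearly
    constant on each group and the Carleson condition bounds the group. *)
Lemma small_le (j : int) (p : R) :
  (\esum_(I in [set I : int * int | (I.1 <= j)%R]) (pois p (2 ^ j) (dcenter R I) * a I)%:E <=
   (48 * S * 2 ^ j)%:E)%E.
Proof.
set L : R := 2 ^ j; have L0 : 0 < L by rewrite exprz_gt0.
rewrite (esum_group _ (ancestor j)); last by move=> I; rewrite lee_fin mulr_ge0 ?pois_ge0.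
pose s := p / L - 2^-1.
apply: (@le_trans _ _ (\esum_(k in [set: int])
    ((2 * S * L)%:E * ((1 + (k%:~R - s) ^+ 2)^-1)%:E))%E).
  apply: le_esum => k _; pose J : int * int := (j, k).
  have pE : pois p L (dcenter R J) = (1 + (k%:~R - s) ^+ 2)^-1.
    rewrite /pois /dcenter /dlen /= -/L /s; congr ((1 + _ ^+ 2)^-1).
    by field; rewrite gt_eqF.
  apply: (@le_trans _ _ (\esum_(I in [set I | dyadic I `<=` (dyadic J : set R)])
      ((2 * pois p L (dcenter R J))%:E * (a I)%:E))%E).
    apply: (@le_trans _ _ (\esum_(I in [set I | (I.1 <= j)%R /\ ancestor j I = k])
      ((2 * pois p L (dcenter R J))%:E * (a I)%:E))%E).
      apply: le_esum => I [Ij Ik]; rewrite lee_fin ler_wpM2r// pois_near//.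
      by have := ancestor_sub Ij; rewrite Ik => /dyadic_center.
    apply: esum_sub => [I|I [Ij Ik]]; last by have := ancestor_sub Ij; rewrite Ik.
    by rewrite lee_fin !mulr_ge0 ?pois_ge0.
  rewrite esumZ ?mulr_ge0 ?pois_ge0//.
  have P0 : (0 <= (2 * pois p L (dcenter R J))%:E)%E by rewrite lee_fin mulr_ge0 ?pois_ge0.
  apply: le_trans (lee_wpmul2l P0 (carleson J)) _.
  by rewrite -!EFinM lee_fin pE /dlen /= -/L le_eqVlt; apply/orP; left; apply/eqP; ring.
rewrite esumZ; [|by rewrite !mulr_ge0// ltW|by move=> k; rewrite lee_fin invr_ge0 addr_ge0// sqr_ge0].
have SL : (0 <= (2 * S * L)%:E)%E by rewrite lee_fin !mulr_ge0// ltW.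
apply: le_trans (lee_wpmul2l SL (int_sum_shift s)) _.
by rewrite -EFinM lee_fin le_eqVlt; apply/orP; left; apply/eqP; ring.
Qed.

(** Short intervals are grouped by [small_le].  A longer one is bounded by the
    Carleson condition for itself, |I| = 2^n 2^j against the factor 6^n of the
    weight. *)
Lemma carleson_sum (j : int) (p : R) :
  (\esum_(I in setT) ((scale_wt j p I)^-1 * a I)%:E <= (84 * S * 2 ^ j)%:E)%E.
Proof.
set L : R := 2 ^ j; have L0 : 0 < L by rewrite exprz_gt0.
rewrite (_ : 84 * S * L = 48 * S * L + S * L * (24 / (1 - 3^-1))); last by field.
apply: esum_split => [I||].
- by rewrite mulr_ge0// invr_ge0 ltW// scale_wt_gt0.
- apply: le_trans (small_le j p); apply: le_esum => I /= Ij.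
  by rewrite /scale_wt Ij invrK.
have SL : 0 <= S * L by rewrite mulr_ge0// ltW.
apply: (@le_trans _ _ (\esum_(I in [set I : int * int | (j < I.1)%R])
    ((S * L)%:E * (3^-1 ^+ `|I.1 - j|%N * pois p (dlen R I) (dcenter R I))%:E))%E).
  apply: le_esum => I /= jI; have Ij : (I.1 <= j)%R = false by apply/negbTE; rewrite -ltNge.
  have aI : a I <= S * dlen R I.
    rewrite -lee_fin; apply: le_trans (carleson I).
    by apply: (@le_esum1 _ _ _ (fun I => (a I)%:E)) => // i; rewrite lee_fin.
  rewrite -EFinM lee_fin /scale_wt Ij invf_div.
  set n := `|_|%N; set P := pois _ _ _; have P0 : 0 <= P by exact: pois_ge0.
  apply: (@le_trans _ _ (P / 6 ^+ n * (S * dlen R I))).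
    by rewrite ler_wpM2l// divr_ge0// ltW.
  rewrite (dlen_big R Ij) -/L -/n.
  have -> : 6 ^+ n = 3 ^+ n * 2 ^+ n :> R by rewrite -exprMn; congr (_ ^+ _); ring.
  rewrite exprVn le_eqVlt; apply/orP; left; apply/eqP; field.
  by rewrite !expf_neq0.
rewrite esumZ//; last by move=> I; rewrite lee_fin mulr_ge0 ?pois_ge0// exprn_ge0// invr_ge0.
rewrite [leRHS]EFinM lee_wpmul2l ?lee_fin//; apply: esum_big; first by rewrite invr_ge0.
by rewrite invf_lt1// ltr1n.
Qed.

End CarlesonSums.

Section MeanGrowth.
Variables (R : realType) (H : completeNormedModType R[i]).
Variable dot : {dot H for Num.conj}.
Hypothesis hdot : hilbert_norm dot.
Local Notation leb := (@lebesgue_measure R).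
Variables (F : R -> H) (S : R).
Hypothesis vF : vL2 F.
Hypothesis S0 : 0 <= S.
Definition is_mean (a b : R) (m : H) := forall k,
  dot m k = cint `[a, b]%classic (fun x => dot (F x) k * ((b - a)^-1)%:C).
Hypothesis osc : forall a b m, a < b -> is_mean a b m ->
  (\int[leb]_(x in `[a, b]%classic) (nrm (F x - m) ^+ 2)%:E <= (S * (b - a))%:E)%E.

(** Between an interval and its double the mean moves by at most a constant, so
    m n - m 0 grows more slowly than the weights 4^-n of [int_pois_le] decay. *)
Lemma poisson_of_osc (c L : R) : 0 < L -> exists m,
  (\int[leb]_x (nrm (F x - m) ^+ 2 * pois c L x)%:E <= (5200 * S * L)%:E)%E.
Proof.
move=> L0.
pose r n := 2 ^+ n * L.
have r0 n : 0 < r n by rewrite mulr_gt0 ?exprn_gt0.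
have mex n : exists m, is_mean (c - r n) (c + r n) m by exact: mean_exists.
pose m n := sval (cid (mex n)).
have mP n : is_mean (c - r n) (c + r n) (m n) by exact: (svalP (cid (mex n))).
have len n : c + r n - (c - r n) = 2 * r n by ring.
have oscn n : (\int[leb]_(x in sym c (r n)) (nrm (F x - m n) ^+ 2)%:E <= (2 * S * r n)%:E)%E.
  have := osc _ (mP n); rewrite len => h; apply: le_trans (h _) _.
    by rewrite ltrD2l gtrN.
  by rewrite lee_fin mulrCA mulrA.
have mD n : measurable (sym c (r n)) := meas_sym c (r n).
have mn v D : measurable_fun D (fun x => (nrm (F x - v) ^+ 2)%:E).
  apply: (@measurable_funS _ _ _ _ setT) => //; apply/measurable_EFinP.
  exact: strong_meas_nrm vF.1.
have mI n (f : R -> R) : measurable_fun setT f ->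
    measurable_fun setT (fun x => \1_(sym c (r n)) x * f x : R).
  by move=> mf; apply: measurable_funM => //; exact: measurable_indic.
have sum2 n (f g : R -> R) : measurable_fun setT f -> measurable_fun setT g ->
    (forall x, 0 <= f x) -> (forall x, 0 <= g x) ->
    (\int[leb]_(x in sym c (r n)) (2 * f x + 2 * g x)%:E =
     2%:E * \int[leb]_(x in sym c (r n)) (f x)%:E + 2%:E * \int[leb]_(x in sym c (r n)) (g x)%:E)%E.
  move=> mf mg f0 g0.
  rewrite (int_restrict _ f) (int_restrict _ g) (int_restrict _ (fun x => 2 * f x + 2 * g x)).
  have p1 x : 0 <= \1_(sym c (r n)) x * f x by rewrite mulr_ge0.
  have p2 x : 0 <= \1_(sym c (r n)) x * g x by rewrite mulr_ge0.
  have t0 : (0 : R) <= 2 by [].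
  rewrite -(ge0_intZ t0 (mI n f mf) p1) -(ge0_intZ t0 (mI n g mg) p2) -ge0_intD.
  - by apply: eq_integral => x _; congr EFin; ring.
  - by apply: measurable_funM => //; exact: mI.
  - by apply: measurable_funM => //; exact: mI.
  - by move=> x; rewrite mulr_ge0.
  - by move=> x; rewrite mulr_ge0.
have cstI n (t : R) : (\int[leb]_(x in sym c (r n)) t%:E = (2 * r n * t)%:E)%E.
  rewrite integral_cst; last exact: mD.
  rewrite /sym/= lebesgue_measure_itv/= lte_fin ltrD2l gtrN//.
  by rewrite -EFinD -EFinM; congr EFin; ring.
have mF v : measurable_fun setT (fun x => nrm (F x - v) ^+ 2).
  exact: strong_meas_nrm vF.1.
have leI n (f g : R -> R) : measurable_fun setT f -> measurable_fun setT g ->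
    (forall x, 0 <= f x) -> (forall x, f x <= g x) ->
    (\int[leb]_(x in sym c (r n)) (f x)%:E <= \int[leb]_(x in sym c (r n)) (g x)%:E)%E.
  move=> mf mg f0 fg; rewrite (int_restrict _ f) (int_restrict _ g); apply: ge0_le_int.
  - exact: mI.
  - exact: mI.
  - by move=> x; rewrite mulr_ge0.
  - by move=> x; rewrite ler_wpM2l.
have step n : nrm (m n - m n.+1) ^+ 2 <= 6 * S.
  rewrite -(ler_pM2l (r0 n)) -(ler_pM2l (ltr0n R 2)) -lee_fin mulrA -cstI.
  apply: (@le_trans _ _ (2 * (2 * S * r n) + 2 * (2 * S * r n.+1))%:E); last first.
    by rewrite lee_fin /r exprS le_eqVlt; apply/orP; left; apply/eqP; ring.
  apply: le_trans (leI n _ (fun x => 2 * nrm (F x - m n) ^+ 2 + 2 * nrm (F x - m n.+1) ^+ 2)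
    _ _ _ _) _ => //.
  - by apply: measurable_funD; apply: measurable_funM.
  - by move=> x; exact: sqr_ge0.
  - move=> x; rewrite -(nrmB (m n) (F x)) (_ : m n - m n.+1 = (m n - F x) + (F x - m n.+1)); last first.
      by rewrite subrKA.
    exact: nrm2D_le.
  rewrite sum2//; [|by move=> x; exact: sqr_ge0|by move=> x; exact: sqr_ge0].
  have -> : ((2 * (2 * S * r n) + 2 * (2 * S * r n.+1))%:E =
      2%:E * (2 * S * r n)%:E + 2%:E * (2 * S * r n.+1)%:E)%E by rewrite -!EFinM -EFinD.
  apply: leeD; apply: lee_wpmul2l => //; apply: le_trans (oscn _).
  apply: ge0_subset_integral => //; [exact: mn|by move=> x _; rewrite lee_fin sqr_ge0|].
  move=> x /mem_set; rewrite symP => xr; apply/set_mem; rewrite symP.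
  by apply: le_trans xr _; rewrite /r exprS; have := r0 n; rewrite /r; lra.
(* (x + y)^2 <= 5 x^2 + (5 / 4) y^2 lets the squared norm grow by 5 / 4 per
   step, less than the factor 2 that the geometric series allows. *)
have grow n : nrm (m n - m 0) ^+ 2 <= 120 * S * ((5 / 4) ^+ n - 1).
  elim: n => [|n IH]; first by rewrite !subrr nrm0 expr0n mulr0.
  have st := step n; rewrite nrmB in st.
  have h x y : nrm (x + y : H) ^+ 2 <= 5 * nrm x ^+ 2 + 5 / 4 * nrm y ^+ 2.
    rewrite (nrm2D hdot); have := rdot_le hdot x y; have := ler_norm (rdot dot x y).
    have := sqr_ge0 (2 * nrm x - nrm y / 2); nra.
  have := h (m n.+1 - m n) (m n - m 0); rewrite subrKA (exprS _ n).
  move: IH st; set G := (5 / 4) ^+ n; set A := nrm (m n - m 0%N) ^+ 2; set B := nrm (m n.+1 - m n) ^+ 2.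
  move=> IH st /le_trans; apply.
  have -> : 120 * S * (5 / 4 * G - 1) = 5 * (6 * S) + 5 / 4 * (120 * S * (G - 1)) by field.
  by apply: lerD; rewrite ler_wpM2l.
exists (m 0%N).
apply: le_trans (int_pois_le c L0 _ _) _.
- exact: strong_meas_nrm vF.1.
- by move=> x; exact: sqr_ge0.
apply: (@le_trans _ _ (\sum_(n <oo) (1936 * S * L * (5 / 8) ^+ n)%:E)%E).
  apply: lee_nneseries => n _.
    by move=> _; rewrite mule_ge0 ?lee_fin ?divr_ge0 ?exprn_ge0// integral_ge0// => x _; rewrite lee_fin sqr_ge0.
  apply: (@le_trans _ _ ((4 / 4 ^+ n)%:E * (2 * (2 * S * r n) + 2 * (2 * r n * nrm (m n - m 0) ^+ 2))%:E)%E).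
    apply: lee_wpmul2l; first by rewrite lee_fin divr_ge0// exprn_ge0.
    apply: le_trans (leI n _ (fun x => 2 * nrm (F x - m n) ^+ 2 + 2 * nrm (m n - m 0) ^+ 2)
      _ _ _ _) _ => //.
    - by apply: measurable_funD => //; apply: measurable_funM.
    - by move=> x; exact: sqr_ge0.
    - by move=> x; rewrite -(subrKA (m n) (F x)); exact: nrm2D_le.
    rewrite (sum2 n _ (fun=> nrm (m n - m 0) ^+ 2))//; [|by move=> x; exact: sqr_ge0|by move=> x; exact: sqr_ge0].
    have -> : ((2 * (2 * S * r n) + 2 * (2 * r n * nrm (m n - m 0) ^+ 2))%:E =
        2%:E * (2 * S * r n)%:E + 2%:E * (2 * r n * nrm (m n - m 0%N) ^+ 2)%:E)%E.
      by rewrite -!EFinM -EFinD.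
    rewrite cstI; apply: leeD => //; apply: lee_wpmul2l => //; exact: oscn.
  rewrite -EFinM lee_fin.
  apply: (@le_trans _ _ (4 / 4 ^+ n * (484 * S * r n * (5 / 4) ^+ n))).
    apply: ler_wpM2l; first by rewrite divr_ge0// exprn_ge0.
    have g1 : 1 <= (5 / 4) ^+ n :> R by rewrite exprn_ege1//; lra.
    have := grow n; have := r0 n; have Sr := mulr_ge0 S0 (ltW (r0 n)).
    set G := (5 / 4) ^+ n in g1 *; set N := nrm _ ^+ 2; nra.
  rewrite /r (_ : 4 ^+ n = 2 ^+ n * 2 ^+ n :> R); last by rewrite -exprMn; congr (_ ^+ _); ring.
  rewrite (_ : (5 / 8) ^+ n = (5 / 4) ^+ n / 2 ^+ n :> R); last first.
    by rewrite -exprVn -exprMn; congr (_ ^+ _); field.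
  by rewrite le_eqVlt; apply/orP; left; apply/eqP; field; rewrite expf_neq0.
(* The series is 1936 S L (8 / 3). *)
rewrite series_geo ?lee_fin//; last by lra.
have -> : 1 - 5 / 8 = 3 / 8 :> R by field.
have := mulr_ge0 S0 (ltW L0); lra.
Qed.

End MeanGrowth.

(** * Comparison of the two norms *)

Section OperatorFunctions.
Variables (R : realType) (H : completeNormedModType R[i]).
Variable dot : {dot H for Num.conj}.
Hypothesis hdot : hilbert_norm dot.
Local Notation leb := (@lebesgue_measure R).

Lemma ae_integral (f g : R -> R) (D : set (measurableTypeR R)) : measurable D ->
  measurable_fun setT f -> measurable_fun setT g ->
  {ae leb, forall x, f x = g x} ->
  (\int[leb]_(x in D) (f x)%:E = \int[leb]_(x in D) (g x)%:E)%E.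
Proof.
move=> mD mf mg fg; apply: ae_eq_integral => //.
- by apply/measurable_EFinP; apply: (@measurable_funS _ _ _ _ setT).
- by apply/measurable_EFinP; apply: (@measurable_funS _ _ _ _ setT).
- by apply: ae_mono fg => x -> _.
Qed.

Lemma ae_ip (f f' g : R -> R[i]) : cmeasurable f -> cmeasurable f' -> cmeasurable g ->
  {ae leb, forall x, f x = f' x} -> ip f g = ip f' g.
Proof.
move=> mf mf' mg ff'; have [rf jf] := cmeasM mf (cmeas_conj mg).
have [rf' jf'] := cmeasM mf' (cmeas_conj mg).
rewrite /ip /cint; congr (_ +i* _); rewrite /Rintegral; congr fine;
  by apply: ae_integral => //; apply: ae_mono ff' => x ->.
Qed.

(** The two properties that make a form Hilbertian, for values in the extended reals. *)
Definition quad_form (q : H -> \bar R) : Prop :=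
  (forall x y : H, (q (x + y)%R + q (x - y)%R = 2%:E * q x + 2%:E * q y)%E) /\
  (forall (c : R[i]) (x : H), (q (c *: x)%R = (sq c)%:E * q x)%E).

Lemma quad_formZ (a : R) (q : H -> \bar R) : 0 <= a -> (forall h, 0 <= q h)%E ->
  quad_form q -> quad_form (fun h => a%:E * q h)%E.
Proof.
move=> a0 q0 [qp qz]; split => [x y|c x]; last by rewrite qz muleCA.
rewrite -ge0_muleDr// qp ge0_muleDr ?mule_ge0//.
by congr (_ + _)%E; rewrite muleCA.
Qed.

Definition int_sq (D : set (measurableTypeR R)) (G : H -> R -> H) (h : H) : \bar R :=
  (\int[leb]_(t in D) (nrm (G h t) ^+ 2)%:E)%E.

Lemma int_sq_form (D : set (measurableTypeR R)) (G : H -> R -> H) : measurable D ->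
  (forall h, measurable_fun setT (fun t => nrm (G h t) ^+ 2)) ->
  (forall c x y, {ae leb, forall t, G (c *: x + y) t = c *: G x t + G y t}) ->
  quad_form (int_sq D G).
Proof.
move=> mD mG GL.
have mGE h : measurable_fun D (fun t => (nrm (G h t) ^+ 2)%:E).
  by apply: (@measurable_funS _ _ _ _ setT) => //; apply/measurable_EFinP; exact: mG.
have G0 h t : (0 <= (nrm (G h t) ^+ 2)%:E)%E by rewrite lee_fin sqr_ge0.
have G00 : {ae leb, forall t, G 0 t = 0}.
  apply: ae_mono (GL (-1) 0 0) => t; rewrite scaler0 addr0 scaleN1r addNr; exact.
have Z (c : R) h : 0 <= c -> (c%:E * int_sq D G h =
    \int[leb]_(t in D) (c * nrm (G h t) ^+ 2)%:E)%E.
  by move=> c0; rewrite /int_sq -ge0_integralZl_EFin.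
have P (f g : R -> R) : measurable_fun setT f -> measurable_fun setT g ->
    (forall t, 0 <= f t) -> (forall t, 0 <= g t) ->
    (\int[leb]_(t in D) (f t)%:E + \int[leb]_(t in D) (g t)%:E =
     \int[leb]_(t in D) (f t + g t)%:E)%E.
  move=> mf mg f0 g0.
  have e (k : R -> R) : measurable_fun setT k -> measurable_fun D (EFin \o k).
    by move=> mk; apply: (@measurable_funS _ _ _ _ setT) => //; exact/measurable_EFinP.
  have p (k : R -> R) t : (forall t, 0 <= k t) -> D t -> (0 <= (EFin \o k) t)%E.
    by move=> k0 _; rewrite lee_fin.
  exact: (esym (ge0_integralD leb mD (fun t => p f t f0) (e _ mf) (fun t => p g t g0) (e _ mg))).
have t0 : (0 : R) <= 2 by [].
have m2 h : measurable_fun setT (fun t => 2 * nrm (G h t) ^+ 2) by exact: measurable_funM.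
have p2 h t : 0 <= 2 * nrm (G h t) ^+ 2 by rewrite mulr_ge0 ?sqr_ge0.
have p1 h t : 0 <= nrm (G h t) ^+ 2 by exact: sqr_ge0.
split => [x y|c x].
  rewrite (Z _ x t0) (Z _ y t0) (P _ _ (m2 x) (m2 y) (p2 x) (p2 y)).
  rewrite [LHS](P _ _ (mG (x + y)) (mG (x - y)) (p1 _) (p1 _)).
  apply: ae_integral => //; [exact: measurable_funD|exact: measurable_funD|].
  have := ae_and (GL 1 x y) (GL (-1) y x); apply: ae_mono => t.
  rewrite !scale1r !scaleN1r [- y + x]addrC [- G y t + _]addrC => -[-> ->].
  exact: (parallelogram hdot).
rewrite (Z _ x (sq_ge0 c)) /int_sq.
apply: ae_integral => //; first exact: measurable_funM.
have := ae_and (GL c x 0) G00; apply: ae_mono => t; rewrite addr0 => -[-> ->].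
by rewrite addr0 nrm2Z.
Qed.

Variables (M : set (H -> H)) (phi : opfun H).
Hypothesis phiL : L2c dot M phi.
Local Notation F := (vec dot phi).

Lemma vecP h : represents dot phi h (F h).
Proof.
by rewrite /vec; case: xgetP => [f -> //|no]; have [_ /(_ h)[f /no]] := phiL.
Qed.

Lemma vec_vL2 h : vL2 (F h).
Proof.
split; first exact: (vecP h).1.
have [_ _ _ fin _] := phiL.
have [N NE] : exists N : R, L2c_norm dot phi = N%:E.
  exists (fine (L2c_norm dot phi)); rewrite fineK// ge0_fin_numE//; exact: sqrt_norm_ge0.
have pE x : pois 0 1 x = (1 + x ^+ 2)^-1 :> R by rewrite /pois subr0 divr1.
under eq_integral do rewrite pE.
have := @sqrt_norm_form _ _ dot hdot _ N; rewrite -NE => /(_ _ (lexx _) h) /andP[_].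
by move=> /le_lt_trans; apply; exact: ltry.
Qed.

Lemma vec_lin (c : R[i]) h h' :
  {ae leb, forall x, F (c *: h + h') x = c *: F h x + F h' x}.
Proof.
apply: (strong_ae_comb hdot (vecP h).1 (vecP h').1 (vecP _).1) => k.
have [_ _ lin _ _] := phiL.
have := ae_and (ae_and ((vecP h).2 k) ((vecP h').2 k))
  (ae_and ((vecP (c *: h + h')).2 k) (lin c h h' k)).
by apply: ae_mono => x [[<- <-] [<- ->]].
Qed.

Section Pairings.
Variables (D : set R) (g g' : R -> R[i]).
Hypothesis tg : test_fun g.
Hypothesis gg' : forall f, ip f g = cint D (fun x => f x * g' x).

(** The entries of phi and the vector-valued function agree almost everywhere, so
    the weak integral that defines wint exists and is given by the pairing. *)
Lemma wintP h k : dot (wint dot D phi g' h) k = ip (fun x => dot (F h x) k) g.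
Proof.
have [mphi _ _ _ _] := phiL.
have E k' : cint D (fun x => phi h k' x * g' x) = ip (fun x => dot (F h x) k') g.
  rewrite -gg'; apply: ae_ip => //; last exact: (vecP h).2.
  - by apply: strong_meas_dot => //; exact: (vecP h).1.
  - exact: tg.1.
rewrite /wint; case: xgetP => [v -> /= ->|no]; first exact: E.
have [v vE] := pairing hdot (vec_vL2 h) tg.
by case: (no v) => k'; rewrite vE E.
Qed.

Lemma wint_lin c h h' :
  wint dot D phi g' (c *: h + h') = c *: wint dot D phi g' h + wint dot D phi g' h'.
Proof.
apply: (dot_inj hdot) => k; rewrite dotDl dotZl !wintP.
have mF z : cmeasurable (fun x => dot (F z x) k).
  by apply: strong_meas_dot => //; exact: (vecP z).1.
have [B cs] := pairing_cs hdot (vec_vL2 h) tg.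
have [B' cs'] := pairing_cs hdot (vec_vL2 h') tg.
rewrite (@ae_ip _ (fun x => c * dot (F h x) k + dot (F h' x) k)) //; last 3 first.
- by apply: cmeasD => //; exact: cmeasZ.
- exact: tg.1.
- by apply: ae_mono (vec_lin c h h') => x ->; rewrite dotDl dotZl.
rewrite /ip -cintZ//; last exact: (cs k).1.
rewrite -cintD//; [|exact: cintegrableZ (cs k).1|exact: (cs' k).1].
by apply: eq_cint => x _; rewrite mulrDl mulrA.
Qed.

End Pairings.

Lemma meanP a b h k : dot (mean dot phi a b h) k =
  cint `[a, b]%classic (fun x => dot (F h x) k * ((b - a)^-1)%:C).
Proof.
rewrite (@wintP _ (mean_test a b)); first exact: ip_mean_test.
  exact: mean_test_fun.
by move=> f; rewrite ip_mean_test.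
Qed.

Lemma mean_lin a b c h h' :
  mean dot phi a b (c *: h + h') = c *: mean dot phi a b h + mean dot phi a b h'.
Proof.
by apply: (@wint_lin _ (mean_test a b)); [exact: mean_test_fun|move=> f; rewrite ip_mean_test].
Qed.

Lemma sqrt_norm_le_form (q : H -> \bar R) (N : R) : 0 <= N ->
  quad_form q ->
  (forall x : H, (0 <= q x <= (N ^+ 2 * nrm x ^+ 2)%:E)%E) ->
  (sqrt_norm dot q <= N%:E)%E.
Proof.
move=> N0 [qpar qZ] qN.
have [r qE] : exists r : H -> R, q = fun x => (r x)%:E.
  exists (fine \o q); apply/funext => x /=.
  have /andP[h1 h2] := qN x; rewrite fineK// ge0_fin_numE//.
  by apply: le_lt_trans h2 _; exact: ltry.
rewrite {}qE in qpar qZ qN *.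
apply: sqrt_norm_le => // [x y|c x].
- by have := qpar x y; rewrite -!EFinM -!EFinD => -[].
- by have := qZ c x; rewrite -EFinM => -[].
Qed.

Lemma coef_form (W : int * int -> H -> H) (D : set (int * int))
    (q := fun h => (\esum_(I in D) (nrm (W I h) ^+ 2)%:E)%E) :
  (forall I c h h', W I (c *: h + h') = c *: W I h + W I h') ->
  quad_form q.
Proof.
move=> Wl.
have WD I x y : W I (x + y) = W I x + W I y by have := Wl I 1 x y; rewrite !scale1r.
have W0 I : W I 0 = 0 by have := Wl I (-1) 0 0; rewrite scaler0 addr0 scaleN1r addNr.
have WZ I c x : W I (c *: x) = c *: W I x by have := Wl I c x 0; rewrite W0 !addr0.
have n0 I x : (0 <= (nrm (W I x) ^+ 2)%:E)%E by rewrite lee_fin sqr_ge0.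
split => [x y|c x]; rewrite /q.
  rewrite -!esumZ// -!esumD//; try by move=> I _; rewrite ?mule_ge0.
  apply: eq_esum => I _; rewrite -!EFinM -!EFinD; congr EFin.
  by rewrite -scaleN1r !WD WZ scaleN1r (parallelogram hdot).
rewrite -esumZ ?sq_ge0//; apply: eq_esum => I _; rewrite WZ -EFinM nrm2Z.
by [].
Qed.

Section Comparison.
Variables (w : R -> R[i]) (K : R).
Hypothesis mw : cmeasurable w.
Hypothesis K0 : 0 < K.
Hypothesis wdecay : forall y, sq (w y) <= K / (1 + y ^+ 2) ^+ 4.
Hypothesis wnear : forall y t, `|y - t| <= 1 ->
  sq (w y - w t) <= K * (y - t) ^+ 2 / (1 + t ^+ 2) ^+ 2.
Hypothesis wlip : forall y t, sq (w y - w t) <= K * (y - t) ^+ 2.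
Hypothesis wwav : complete_orthonormal_wavelets w.
Local Notation wav := (wavelet w).

Lemma wcoefP I h k : dot (wcoef dot w phi I h) k = ip (fun x => dot (F h x) k) (wav I).
Proof.
rewrite (@wintP _ (wav I))//.
exact: (wav_test_fun mw K0 wdecay).
Qed.

Lemma wcoef_lin I c h h' :
  wcoef dot w phi I (c *: h + h') = c *: wcoef dot w phi I h + wcoef dot w phi I h'.
Proof. by apply: (@wint_lin _ (wav I)) => //; exact: (wav_test_fun mw K0 wdecay). Qed.

Lemma mean_unique a b h m : is_mean dot (F h) a b m -> m = mean dot phi a b h.
Proof. by move=> mE; apply: (dot_inj hdot) => k; rewrite mE meanP. Qed.

Definition coef_norm_const : R := Num.sqrt (poissonC K * 5200).

(** For each h the oscillations of F = phi(.) h are at most N^2 |h|^2, hence so are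
    its Poisson averages on J by [poisson_of_osc], and [vec_coef_le] applies. *)
Theorem wBMOc_le (N : R) : 0 <= N -> (BMOc_norm dot phi <= N%:E)%E ->
  (wBMOc_norm dot w phi <= (coef_norm_const * N)%:E)%E.
Proof.
move=> N0 BN; have C0 : 0 <= poissonC K.
  by rewrite /poissonC addr_ge0 ?mulr_ge0 ?exprn_ge0 ?ler0n// ltW.
apply: ge_ereal_sup => _ [J _ <-].
have dJ := dlen_gt0 R J.
have s0 (h : H) : (0 <= \esum_(I in [set I | dyadic I `<=` (dyadic J : set R)])
    (nrm (wcoef dot w phi I h) ^+ 2)%:E)%E.
  by apply: esum_ge0 => I _; rewrite lee_fin sqr_ge0.
have J0 : 0 <= (dlen R J)^-1 by rewrite invr_ge0 ltW.
apply: sqrt_norm_le_form; first by rewrite mulr_ge0// sqrtr_ge0.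
  by apply: quad_formZ => //; apply: coef_form; exact: wcoef_lin.
move=> h; apply/andP; split; first by rewrite mule_ge0 ?lee_fin.
pose S := N ^+ 2 * nrm h ^+ 2.
have S0 : 0 <= S by rewrite mulr_ge0 ?sqr_ge0.
have osc a b m : a < b -> is_mean dot (F h) a b m ->
    (\int[leb]_(x in `[a, b]%classic) (nrm (F h x - m) ^+ 2)%:E <= (S * (b - a))%:E)%E.
  move=> ab /mean_unique ->.
  have bnd : (sqrt_norm dot (fun h => (b - a)^-1%:E *
      int_sq `[a, b]%classic (fun h x => F h x - mean dot phi a b h)%R h)%E <= N%:E)%E.
    by apply: le_trans BN; apply: ereal_sup_ubound; exists (a, b).
  have /andP[_] := sqrt_norm_form hdot bnd h.
  by rewrite -/S muleC lee_pdivrMr ?subr_gt0// -EFinM.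
have [m mP] := poisson_of_osc hdot (vec_vL2 h) S0 osc (dcenter R J) dJ.
have := vec_coef_le hdot mw K0 wdecay wlip wwav (vec_vL2 h) (wcoefP ^~ h) m J.
move=> le1; rewrite muleC lee_pdivrMr//; apply: le_trans le1 _.
apply: le_trans (lee_wpmul2l _ mP) _; first by rewrite lee_fin.
rewrite -!EFinM lee_fin exprMn sqr_sqrtr; last by rewrite mulr_ge0 ?ler0n.
by rewrite /S le_eqVlt; apply/orP; left; apply/eqP; ring.
Qed.

Lemma dyadic_scale (r : R) : 0 < r -> exists j : int, r <= 2 ^ j <= 2 * r.
Proof.
move=> r0.
have [n] := expr_half_lt r (@ltr01 R); rewrite ltr_pdivrMr ?exprn_gt0// mul1r => rn.
have [k kr kmin] := ex_minnP (expr_half_lt (2 ^+ n) r0).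
case: k kr kmin => [|k] kr kmin; first by move: kr; rewrite divr1 ltNge (ltW rn).
have rk : r <= 2 ^+ n / 2 ^+ k.
  by rewrite leNgt; apply/negP => /kmin; rewrite ltnn.
exists (n%:Z - k%:Z); rewrite expfzDr// -exprnN -exprnP rk /=.
have -> : 2 ^+ n / 2 ^+ k = 2 * (2 ^+ n / 2 ^+ k.+1) :> R.
  by rewrite exprS; field; rewrite expf_neq0.
by rewrite ler_pM2l// ltW.
Qed.

Definition osc_norm_const : R := Num.sqrt (2 * atomC K * 168).

(** For each h the squared coefficients of phi(.) h satisfy a Carleson condition
    with constant N^2 |h|^2; [vec_osc_le] and [carleson_sum] bound the oscillation
    on [a, b], with 2^j between b - a and 2 (b - a). *)
Theorem BMOc_le (N : R) : 0 <= N -> (wBMOc_norm dot w phi <= N%:E)%E ->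
  (BMOc_norm dot phi <= (osc_norm_const * N)%:E)%E.
Proof.
move=> N0 BN; have A0 := atomC_gt0 K0.
apply: ge_ereal_sup => _ [[a b] /= ab <-].
have ba : 0 < b - a by rewrite subr_gt0.
have ba0 : 0 <= (b - a)^-1 by rewrite invr_ge0 ltW.
pose G h x := F h x - mean dot phi a b h.
have g0 h : (0 <= int_sq `[a, b]%classic G h)%E.
  by apply: integral_ge0 => x _; rewrite lee_fin sqr_ge0.
apply: (@sqrt_norm_le_form (fun h => (b - a)^-1%:E * int_sq `[a, b]%classic G h)%E).
- by rewrite mulr_ge0// sqrtr_ge0.
- apply: quad_formZ => //; apply: int_sq_form; first exact: measurable_itv.
    by move=> h; apply: strong_meas_nrm; exact: (vecP h).1.
  move=> c x y; apply: ae_mono (vec_lin c x y) => t Ft.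
  by rewrite /G Ft mean_lin scalerBr opprD addrACA.
move=> h; apply/andP; split; first by rewrite mule_ge0 ?lee_fin.
pose S := N ^+ 2 * nrm h ^+ 2.
have S0 : 0 <= S by rewrite mulr_ge0 ?sqr_ge0.
have car J : (\esum_(I in [set I | dyadic I `<=` (dyadic J : set R)])
    (nrm (wcoef dot w phi I h) ^+ 2)%:E <= (S * dlen R J)%:E)%E.
  have bnd : (sqrt_norm dot (fun h => (dlen R J)^-1%:E *
      \esum_(I in [set I | dyadic I `<=` (dyadic J : set R)])
        (nrm (wcoef dot w phi I h) ^+ 2)%:E)%E <= N%:E)%E.
    by apply: le_trans BN; apply: ereal_sup_ubound; exists J.
  have /andP[_] := sqrt_norm_form hdot bnd h.
  by rewrite -/S muleC lee_pdivrMr ?dlen_gt0// -EFinM.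
have [j /andP[j1 j2]] := dyadic_scale ba.
have le1 := vec_osc_le hdot mw K0 wdecay wnear wwav (vec_vL2 h) (wcoefP ^~ h) ab j1 (meanP a b h).
rewrite muleC lee_pdivrMr//; apply: le_trans le1 _.
have le2 := carleson_sum (fun I => sqr_ge0 (nrm (wcoef dot w phi I h))) S0 car j a.
apply: le_trans (lee_wpmul2l _ le2) _; first by rewrite lee_fin mulr_ge0// ltW.
rewrite -!EFinM lee_fin exprMn sqr_sqrtr; last by rewrite !mulr_ge0 ?ler0n ?(ltW A0).
rewrite -/S.
have -> : 2 * atomC K * 168 * N ^+ 2 * nrm h ^+ 2 * (b - a) =
    2 * atomC K * (84 * S * (2 * (b - a))) by rewrite /S; ring.
apply: ler_wpM2l; first by rewrite mulr_ge0// ltW.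
by apply: ler_wpM2l => //; rewrite mulr_ge0 ?ler0n.
Qed.

End Comparison.

End OperatorFunctions.

Section Equivalence.
Variables (R : realType) (H : completeNormedModType R[i]).
Variable dot : {dot H for Num.conj}.
Variable M : set (H -> H).
Variable w : R -> R[i].

Lemma ereal_sup_sqrt_ge0 (T : Type) (A : set T) (q : T -> H -> \bar R) : A !=set0 ->
  (0 <= ereal_sup [set sqrt_norm dot (q t) | t in A])%E.
Proof.
move=> [t At]; apply: le_trans (sqrt_norm_ge0 dot (q t)) _.
by apply: ereal_sup_ubound; exists t.
Qed.

Lemma wBMOc_ge0 phi : (0 <= wBMOc_norm dot w phi)%E.
Proof.
by apply: ereal_sup_sqrt_ge0; exists (0, 0).
Qed.

Lemma BMOc_ge0 phi : (0 <= BMOc_norm dot phi)%E.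
Proof.
by apply: ereal_sup_sqrt_ge0; exists (0, 1); rewrite /= ltr01.
Qed.

Lemma norm_comparison (hdot : hilbert_norm dot) (hw : schwartz w)
    (hwav : complete_orthonormal_wavelets w) : exists C : R, 0 < C /\
  forall phi, L2c dot M phi ->
    (wBMOc_norm dot w phi <= C%:E * BMOc_norm dot phi)%E /\
    (BMOc_norm dot phi <= C%:E * wBMOc_norm dot w phi)%E.
Proof.
have [mw [K [K0 wdecay wnear wlip]]] := schwartz_bounds hw.
pose C : R := 1 + coef_norm_const K + osc_norm_const K.
have u0 : 0 <= coef_norm_const K by exact: sqrtr_ge0.
have d0 : 0 <= osc_norm_const K by exact: sqrtr_ge0.
have C0 : 0 < C by rewrite /C -addrA ltr_pwDl// addr_ge0.
have lift (x y : \bar R) (c : R) : 0 <= c <= C -> (0 <= y)%E ->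
    (forall N : R, 0 <= N -> (y <= N%:E)%E -> (x <= (c * N)%:E)%E) -> (x <= C%:E * y)%E.
  move=> /andP[c0 cC] y0 h; case: y y0 h => [N| |//] y0 h; last by rewrite gt0_muley ?lte_fin ?leey.
  apply: le_trans (h N y0 (lexx _)) _; rewrite -EFinM lee_fin ler_wpM2r//.
exists C; split => // phi pL; split.
  apply: (lift _ _ (coef_norm_const K)); [|exact: BMOc_ge0|].
    by rewrite u0 /C addrAC lerDr addr_ge0.
  by move=> N N0; apply: (wBMOc_le hdot pL mw K0 wdecay wlip hwav).
apply: (lift _ _ (osc_norm_const K)); [|exact: wBMOc_ge0|].
  by rewrite d0 /C lerDr addr_ge0.
by move=> N N0; apply: (BMOc_le hdot pL mw K0 wdecay wnear hwav).
Qed.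

Lemma equiv_of_bounds (X Y : set (opfun H)) (nX nY : opfun H -> \bar R) (C : R) : 0 < C ->
  X = Y ->
  (forall phi, X phi -> (nX phi <= C%:E * nY phi)%E /\ (nY phi <= C%:E * nX phi)%E) ->
  eq_equiv_norms dot M X Y nX nY.
Proof.
move=> C0 XY h; split; first by rewrite XY.
exists C^-1, C; split; rewrite ?invr_gt0// => phi /h[h1 h2]; split => //.
by rewrite muleC lee_pdivrMr// muleC.
Qed.

Lemma maxe_le_pMl (C : R) (a b a' b' : \bar R) : 0 < C ->
  (a <= C%:E * a')%E -> (b <= C%:E * b')%E -> (maxe a b <= C%:E * maxe a' b')%E.
Proof.
move=> C0 aa bb; rewrite ge_max (le_trans aa) ?(le_trans bb)//;
  by apply: lee_wpmul2l; rewrite ?lee_fin ?(ltW C0)// le_max lexx ?orbT.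
Qed.

End Equivalence.

Theorem theorem5p1 (R : realType) (H : completeNormedModType R[i])
    (dot : {dot H for Num.conj}) (hdot : hilbert_norm dot)
    (M : set (H -> H)) (hM : von_neumann_algebra dot M)
    (tau : (H -> H) -> \bar R) (htau : nsf_trace dot M tau)
    (w : R -> R[i]) (hw : schwartz w)
    (hwav : complete_orthonormal_wavelets w) :
  [/\ eq_equiv_norms dot M (wBMOc dot M w) (BMOc dot M)
        (wBMOc_norm dot w) (BMOc_norm dot),
      eq_equiv_norms dot M (wBMOr dot M w) (BMOr dot M)
        (wBMOr_norm dot w) (BMOr_norm dot) &
      eq_equiv_norms dot M (wBMO dot M w) (BMO dot M)
        (wBMO_norm dot w) (BMO_norm dot)].
Proof.
have [C [C0 cmp]] := norm_comparison M hdot hw hwav.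
have fin (x y : \bar R) : (x <= C%:E * y)%E -> (y < +oo)%E -> (x < +oo)%E.
  move=> xy yoo; apply: le_lt_trans xy _.
  by rewrite lte_mul_pinfty ?lee_fin ?(ltW C0).
have eqc : wBMOc dot M w = BMOc dot M.
  by apply/seteqP; split => phi [pL pf]; split => //; apply: fin pf; have [] := cmp _ pL.
have eqr : wBMOr dot M w = BMOr dot M.
  by apply/seteqP; split => phi [pL pf]; split => //; apply: fin pf; have [] := cmp _ pL.
split.
- by apply: (equiv_of_bounds _ _ C0 eqc) => phi [/cmp].
- by apply: (equiv_of_bounds _ _ C0 eqr) => phi [/cmp].
- apply: (equiv_of_bounds _ _ C0); first by rewrite /wBMO eqc eqr.
  move=> phi [[/cmp[c1 c2] _] [/cmp[r1 r2] _]].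
  by split; apply: maxe_le_pMl.
Qed.
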